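(* Let $G = A \rtimes Q$ be a group, where $A$ and $Q$ are abelian and $Q = \mathbb{Z}^s$ with $s \geq 2$. View $A$ as a right $\mathbb{Z}Q$-module via conjugation and assume that 1) $A$ is a cyclic $\mathbb{Z}Q$-module, say $A \simeq \mathbb{Z}Q/I$; with the induced ring structure, $A$ is a $\mathbb{Z}$-torsion-free integral domain, and the Krull dimension of $A$ is $2$; 2) for every prime number $p$ the ring $A/pA$ is an infinite integral domain; 3) the image of any non-trivial element of $Q$ in the field of fractions of $A$ is not algebraic over $\mathbb{Q}$ (in particular $C_Q(A) = 1_Q$); 4) $G$ is finitely presented. Then $G$ is not a self-similar group.
   Context: Module structure: for $G = A \rtimes Q$ with $A, Q$ abelian, the addition in $A$ is the restriction of the group operation of $G$ to $A$, and $q \in Q$ acts on $a \in A$ (on the right) by $a \circ q = q^{-1} a q$; this makes $A$ a right $\mathbb{Z}Q$-module. If $A$ is cyclic, then $A \simeq \mathbb{Z}Q/I$ where $I = \mathrm{ann}_{\mathbb{Z}Q}(A)$, and $A$ gets the structure of a commutative ring via this isomorphism; the image of $q\in Q$ in $A$ is the class of $q$ in $\mathbb{Z}Q/I$. $C_Q(A) = \{q \in Q : [q,A]=1\}$. The Krull dimension of a commutative ring is the maximal length $k$ of a chain of prime ideals $P_0 \subsetneq P_1 \subsetneq \dots \subsetneq P_k$. Self-similar groups: let $\mathcal{T}_m$ be the $m$-ary rooted tree (a unique root, every vertex has precisely $m$ descendants). If a group $G$ acts faithfully on $\mathcal{T}_m$ by rooted tree automorphisms, each $g \in G$ can be written as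 $g = (g_0, \ldots, g_{m-1})\sigma$, where $\sigma \in S_m$ describes the action of $g$ on the first layer and $g_i$ is an automorphism acting on the $m$-ary subtree $\mathcal{T}_m^{(i)}$ rooted at the $i$-th vertex of the first layer; identifying $\mathcal{T}_m^{(i)}$ with $\mathcal{T}_m$, the $g_i$ (the states of $g$) are viewed as automorphisms of $\mathcal{T}_m$. The action is self-similar if for every $g\in G$ all states $g_0, \ldots, g_{m-1}$ belong to $G$. $G$ is a self-similar group if for some $m$ it admits a faithful self-similar action on $\mathcal{T}_m$ (transitivity on the first layer is not required). *)

(* Defs.v *)
From HB Require Import structures.
From mathcomp Require Import all_boot all_order all_algebra.
From mathcomp Require Import finmap monalg.
From mathcomp Require Import classical_sets cardinality.

Set Implicit Arguments.
Unset Strict Implicit.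
Unset Printing Implicit Defensive.

Import GRing.Theory.

Local Open Scope ring_scope.

(* A subgroup S of G, given as a [groupClosed] predicate, as a group in its
   own right. *)
Definition subgroup_of (G : groupType) (S : groupClosed G) : Type :=
  {x : G | x \in S}.

HB.instance Definition _ (G : groupType) (S : groupClosed G) :=
  SubChoice.copy (subgroup_of S) {x : G | x \in S}.

Fact subgroup_of_closed (G : groupType) (S : groupClosed G) : group_closed S.
Proof. by split=> [|x y Sx Sy]; rewrite ?gpred1 // gpredM // gpredVr. Qed.

HB.instance Definition _ (G : groupType) (S : groupClosed G) :=
  SubChoice_isSubGroup.Build G _ (subgroup_of S) (subgroup_of_closed S).

Definition abelian_subgroup (G : groupType) (S : groupClosed G) : Prop :=
  {in S &, forall x y, commute x y}.

(* G = A ><| Q, internally. *)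
Definition semidirect_product (G : groupType) (A Q : groupClosed G) : Prop :=
  [/\ forall a g, a \in A -> (a ^ g)%g \in A,
      forall x, x \in A -> x \in Q -> x = 1%g
    & forall g : G, exists a q, [/\ a \in A, q \in Q & g = (a * q)%g]].

Definition isomorphic_Zn (n : nat) (H : groupType) : Prop :=
  exists f : 'rV[int]_n -> H,
    {morph f : u v / u + v >-> (u * v)%g} /\ bijective f.

(* The integral group ring ZQ. The ring structure that monalg puts on
   {malg int[K]} requires K to have no invertible element but 1, so only the
   underlying free abelian group is taken from there. *)
Definition groupRing (Q : groupType) : Type := {malg int[Q]}.

HB.instance Definition _ (Q : groupType) :=
  GRing.Zmodule.copy (groupRing Q) {malg int[Q]}.

Definition groupRing_of (Q : groupType) (q : Q) : groupRing Q := << 1 *g q >>.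

Section GroupRing.
Variable Q : groupType.
Implicit Types x y z : {malg int[Q]}.

Definition groupRing_mul x y : {malg int[Q]} :=
  \sum_(p <- msupp x) \sum_(q <- msupp y) << x@_p * y@_q *g (p * q)%g >>.

Local Notation mul := groupRing_mul.

Let mulw (d1 d2 : {fset Q}) x y :
  (msupp x `<=` d1)%fset -> (msupp y `<=` d2)%fset ->
  mul x y = \sum_(p <- d1) \sum_(q <- d2) << x@_p * y@_q *g (p * q)%g >>.
Proof.
move=> le1 le2; rewrite /mul (big_fset_incl _ le1) /=.
  apply/eq_bigr=> p _; apply/big_fset_incl => // q _ /mcoeff_outdom ->.
  by rewrite mulr0 monalgU0.
move=> p _ /mcoeff_outdom xp; rewrite big1 // => q _.
by rewrite xp mul0r monalgU0.
Qed.

Fact groupRing_mulDl : left_distributive mul +%R.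
Proof.
move=> x y z.
rewrite (mulw (msuppD_le x y) (fsubset_refl _)).
rewrite (mulw (fsubsetUl (msupp x) (msupp y)) (fsubset_refl (msupp z))).
rewrite (mulw (fsubsetUr (msupp x) (msupp y)) (fsubset_refl (msupp z))).
rewrite -big_split; apply/eq_bigr=> p _; rewrite -big_split.
by apply/eq_bigr=> q _; rewrite mcoeffD mulrDl monalgUD.
Qed.

Fact groupRing_mulDr : right_distributive mul +%R.
Proof.
move=> z x y.
rewrite (mulw (fsubset_refl _) (msuppD_le x y)).
rewrite (mulw (fsubset_refl (msupp z)) (fsubsetUl (msupp x) (msupp y))).
rewrite (mulw (fsubset_refl (msupp z)) (fsubsetUr (msupp x) (msupp y))).
rewrite -big_split; apply/eq_bigr=> p _; rewrite -big_split.
by apply/eq_bigr=> q _; rewrite mcoeffD mulrDr monalgUD.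
Qed.

Let mul0 : left_zero 0 mul.
Proof. by move=> x; rewrite /mul msupp0 big_seq_fset0. Qed.

Let mulx0 : right_zero 0 mul.
Proof. by move=> x; rewrite /mul big1 // => p _; rewrite msupp0 big_seq_fset0. Qed.

Let mulUU a b p q : mul << a *g p >> << b *g q >> = << a * b *g (p * q)%g >>.
Proof. by rewrite (mulw msuppU_le msuppU_le) !big_seq_fset1 !mcoeffUU. Qed.

Let mul_suml (I : Type) (r : seq I) (F : I -> {malg int[Q]}) y :
  mul (\sum_(i <- r) F i) y = \sum_(i <- r) mul (F i) y.
Proof.
exact: (big_morph (fun x => mul x y) (fun _ _ => groupRing_mulDl _ _ _) (mul0 y)).
Qed.

Let mul_sumr (I : Type) (r : seq I) (F : I -> {malg int[Q]}) x :
  mul x (\sum_(i <- r) F i) = \sum_(i <- r) mul x (F i).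
Proof. exact: (big_morph (mul x) (groupRing_mulDr x) (mulx0 x)). Qed.

Fact groupRing_mulA : associative mul.
Proof.
move=> x y z; rewrite [x]monalgE !mul_suml; apply/eq_bigr=> p _.
rewrite [y]monalgE mul_suml !mul_sumr mul_suml; apply/eq_bigr=> q _.
rewrite [z]monalgE !mul_sumr; apply/eq_bigr=> r _.
by rewrite !mulUU mulrA mulgA.
Qed.

Fact groupRing_mul1 : left_id (groupRing_of 1%g : {malg int[Q]}) mul.
Proof.
move=> x; rewrite {1}[x]monalgE mul_sumr [RHS]monalgE.
by apply/eq_bigr=> p _; rewrite mulUU mul1r mul1g.
Qed.

Fact groupRing_mulx1 : right_id (groupRing_of 1%g : {malg int[Q]}) mul.
Proof.
move=> x; rewrite {1}[x]monalgE mul_suml [RHS]monalgE.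
by apply/eq_bigr=> p _; rewrite mulUU mulr1 mulg1.
Qed.

Fact groupRing_1_neq0 : (groupRing_of 1%g : {malg int[Q]}) != 0.
Proof. by rewrite monalgU_eq0 oner_eq0. Qed.

HB.instance Definition _ := GRing.Zmodule_isNzRing.Build (groupRing Q)
  groupRing_mulA groupRing_mul1 groupRing_mulx1
  groupRing_mulDl groupRing_mulDr groupRing_1_neq0.

End GroupRing.

Definition expgz (G : groupType) (g : G) (n : int) : G :=
  match n with Posz k => (g ^+ k)%g | Negz k => (g ^- k.+1)%g end.

(* The right ZQ-module structure by conjugation,
   a o (\sum_q n_q q) = \prod_q (q^-1 a q)^(n_q), in multiplicative notation;
   meaningful for a in an abelian normal subgroup, where the factors commute. *)
Definition module_act (G : groupType) (Q : groupClosed G) (a : G)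
    (x : groupRing (subgroup_of Q)) : G :=
  (\prod_(q <- msupp x) expgz (a ^ val q) (mcoeff q x))%g.

Definition cyclic_module (G : groupType) (A Q : groupClosed G) : Prop :=
  exists2 a0, a0 \in A & forall a, a \in A -> exists x, a = @module_act G Q a0 x.

Definition annihilator (G : groupType) (A Q : groupClosed G)
    (x : groupRing (subgroup_of Q)) : Prop :=
  forall a, a \in A -> module_act a x = 1%g.

(* f exhibits S as the quotient ring R / I. *)
Definition quotient_map (R S : nzRingType) (I : R -> Prop)
    (f : {rmorphism R -> S}) : Prop :=
  (forall y, exists x, y = f x) /\ (forall x, f x = 0 <-> I x).

Definition Z_torsion_free (R : nzRingType) : Prop :=
  forall (n : nat) (x : R), x *+ n = 0 -> n = 0%N \/ x = 0.

Definition prime_ideal (R : comNzRingType) (P : {pred R}) : Prop :=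
  idealr_closed P /\ prime_idealr_closed P.

(* Only P 0, ..., P k matter: a chain of length k has k+1 prime ideals. *)
Definition prime_chain (R : comNzRingType) (k : nat) (P : nat -> {pred R}) :
    Prop :=
  (forall i, (i <= k)%N -> prime_ideal (P i)) /\
  (forall i, (i < k)%N -> {subset P i <= P i.+1} /\
     exists x, (x \in P i.+1) && (x \notin P i)).

Definition Krull_dimension (R : comNzRingType) (k : nat) : Prop :=
  (exists P : nat -> {pred R}, prime_chain k P) /\
  (forall l (P : nat -> {pred R}), prime_chain l P -> (l <= k)%N).

Definition infinite_type (T : Type) : Prop := infinite_set [set: T]%classic.

(* Words over x_0, ..., x_(n-1) and their inverses: (i, false) stands for x_i
   and (i, true) for its inverse. *)
Definition word (n : nat) : Type := seq ('I_n * bool).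

(* Two words represent the same element of < x_0, ..., x_(n-1) | rels >. *)
Inductive word_eq (n : nat) (rels : seq (word n)) : word n -> word n -> Prop :=
| word_eq_refl w : word_eq rels w w
| word_eq_sym w1 w2 : word_eq rels w1 w2 -> word_eq rels w2 w1
| word_eq_trans w1 w2 w3 :
    word_eq rels w1 w2 -> word_eq rels w2 w3 -> word_eq rels w1 w3
| word_eq_cancel (u v : word n) i b :
    word_eq rels (u ++ [:: (i, b); (i, ~~ b)] ++ v) (u ++ v)
| word_eq_rel (u v : word n) r :
    r \in rels -> word_eq rels (u ++ r ++ v) (u ++ v).

Definition word_eval (n : nat) (G : groupType) (g : 'I_n -> G) (w : word n) : G :=
  (\prod_(l <- w) if l.2 then (g l.1)^-1 else g l.1)%g.

Definition finitely_presented (G : groupType) : Prop :=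
  exists (n : nat) (rels : seq (word n)) (g : 'I_n -> G),
    (forall x, exists w, x = word_eval g w) /\
    (forall w1 w2, word_eval g w1 = word_eval g w2 <-> word_eq rels w1 w2).

(* Vertices of the m-ary rooted tree are the words over 'I_m: the root is
   [::], and the descendants of v are the rcons v i. *)
Definition vertex (m : nat) : Type := seq 'I_m.

Definition child (m : nat) (v w : vertex m) : Prop := exists i, w = rcons v i.

Definition tree_automorphism (m : nat) (f : vertex m -> vertex m) : Prop :=
  [/\ bijective f, f [::] = [::]
    & forall v w, child v w <-> child (f v) (f w)].

(* The restriction of f to the subtree rooted at the first-layer vertex i, both
   this subtree and its image being identified with the whole tree by removing
   the first letter. *)
Definition state (m : nat) (f : vertex m -> vertex m) (i : 'I_m) :
    vertex m -> vertex m :=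
  fun v => behead (f (i :: v)).

(* A faithful right action of G by rooted tree automorphisms. *)
Definition faithful_tree_action (G : groupType) (m : nat)
    (act : G -> vertex m -> vertex m) : Prop :=
  [/\ forall v, act 1%g v = v,
      forall g h v, act (g * h)%g v = act h (act g v),
      forall g, tree_automorphism (act g)
    & forall g, (forall v, act g v = v) -> g = 1%g].

Definition self_similar (G : groupType) : Prop :=
  exists (m : nat) (act : G -> vertex m -> vertex m),
    faithful_tree_action act /\
    (forall g i, exists h, forall v, state (act g) i v = act h v).

(* Main.v *)
(* Let chi : Z^s -> A be the image of Q in the ring A, K the fraction field of A,
   H the stabiliser of the first layer, M an exponent of the group induced on
   that layer, and b the ideal of A formed by the elements in H. Each state map f_i : H -> G
   either kills b (chi(Mv) - 1) for all v, or maps b into A, not to 0, in a way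
   that is semilinear along an additive map sigma_i <> 0 of Z^s:
     f_i(r chi(Mv)) = f_i(r) chi(sigma_i v).
   In the second case the integral relations between the chi(Mv) hold between
   the chi(sigma_i v). As K has transcendence degree 1 over Q (Krull dimension
   2), N(v) = [K : Q(chi v)] is a positive integer, N(nv) = n N(v),
   N(u + v) <= N(u) + N(v), and N(sigma_i v) = M N(v). For the last equality both
   sides are compared over the subfield common to all Q(chi(n Z^s)), which has
   finite index in K because it contains the transcendental element
   dlog chi(u) / dlog chi(v). The iterated directional derivatives of N that are
   linear form a finite spanning set which every sigma_i permutes up to the
   factor M, so each ray of Z^s meets a finite set O with sigma_i(O) = M O for
   all i. The coefficients of prod_{w in O} (X - chi(Mw)) then commute with all
   the f_i, and are integers modulo the elements killed by the other states; the
   ring they generate has infinite image in A/pA for each prime p. This yields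
   c in b that commutes with the f_i, is killed by the other states and is not in
   pA for p dividing 2M. From M f_i(cr) = c f_i(Mr) one gets f_i(cr) in cA, so
   that cA is a non-trivial normal subgroup in H containing its own states, which
   contradicts faithfulness. *)

Require Import Defs.
From HB Require Import structures.
From mathcomp Require Import all_boot all_order all_algebra.
From mathcomp Require Import perm fingroup cyclic all_field generic_quotient.
From mathcomp Require Import finmap monalg.
From mathcomp Require Import boolp ring lra zify.
From mathcomp Require classical_sets cardinality.
Import GRing.Theory Num.Theory Order.TTheory.
Set Implicit Arguments.
Unset Strict Implicit.
Unset Printing Implicit Defensive.
Local Open Scope ring_scope.

(** * Linear algebra over subfields *)

(** A state map f_i is semilinear only along its own sigma_i, so no non-zero ideal of A is evidently
    carried into itself: the multiplier c must commute with all the f_i at once. Symmetric functions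
    of chi on M O do so. The finiteness of O rests on N: a map that multiplies N by M permutes, up
    to M, finitely many linear forms with common kernel 0, so the sigma_i / M generate a finite
    group. The map chi(Mv) -> chi(sigma_i v) need not extend to K, whence the comparison over a
    common subfield. The ratio dlog chi(u) / dlog chi(v) lies in each Q(chi(n Z^s)) because passing
    to nu, nv multiplies both differentials by n. It is transcendental because a constant ratio
    would make chi(w) algebraic for some w != 0. The coefficients are integers modulo the elements
    killed by the other states because each chi(Mw) is 1 there. Take two elements of the ring they
    generate, equal modulo b, with integers congruent modulo p, yet distinct modulo pA. Their
    difference d and its integer n give c = d(d - n), which is d^2 modulo p. *)

Section SubfieldDegree.
Variable K : fieldType.
Implicit Types (E F L : K -> Prop) (x y z : K).

(** A predicate rather than a structure, since many subfields of one K are compared and some arise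
    as intersections. Division by 0 is harmless because 0^-1 = 0. *)
Definition subfield E : Prop :=
  [/\ E 1, forall x y, E x -> E y -> E (x - y)
         & forall x y, E x -> E y -> E (x / y)].

Section Closure.
Variable E : K -> Prop.
Hypothesis hE : subfield E.

Lemma subfield1 : E 1. Proof. by case: hE. Qed.
Lemma subfieldB x y : E x -> E y -> E (x - y). Proof. by case: hE => _ h _; apply: h. Qed.
Lemma subfield_div x y : E x -> E y -> E (x / y). Proof. by case: hE => _ _; apply. Qed.
Lemma subfield0 : E 0. Proof. by rewrite -(subrr 1); apply: subfieldB; apply: subfield1. Qed.
Lemma subfieldN x : E x -> E (- x).
Proof. by rewrite -sub0r => ?; apply: subfieldB => //; apply: subfield0. Qed.
Lemma subfieldD x y : E x -> E y -> E (x + y).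
Proof. by move=> ? ?; rewrite -[y]opprK; apply: subfieldB => //; apply: subfieldN. Qed.
Lemma subfieldV x : E x -> E x^-1.
Proof. by rewrite -[x^-1]mul1r => ?; apply: subfield_div => //; apply: subfield1. Qed.
Lemma subfieldM x y : E x -> E y -> E (x * y).
Proof. by move=> ? ?; rewrite -[y]invrK; apply: subfield_div => //; apply: subfieldV. Qed.
Lemma subfieldX x n : E x -> E (x ^+ n).
Proof. by move=> Ex; elim: n => [|n IH]; rewrite ?exprS; [exact: subfield1 | exact: subfieldM]. Qed.
Lemma subfield_sum (I : Type) (r : seq I) (P : pred I) (f : I -> K) :
  (forall i, E (f i)) -> E (\sum_(i <- r | P i) f i).
Proof. by move=> Ef; apply: big_ind => //; [exact: subfield0 | exact: subfieldD]. Qed.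
End Closure.

Definition lincomb E (I : finType) (b : I -> K) z : Prop :=
  exists c : I -> K, (forall i, E (c i)) /\ z = \sum_i c i * b i.

Definition indep E (I : finType) (b : I -> K) : Prop :=
  forall c : I -> K, (forall i, E (c i)) -> \sum_i c i * b i = 0 ->
  forall i, c i = 0.

Definition basis E F (I : finType) (b : I -> K) : Prop :=
  [/\ forall i, F (b i), indep E b & forall z, F z -> lincomb E b z].

Definition fdegree E F (n : nat) : Prop := exists b : 'I_n -> K, basis E F b.

(** Stated as a bound on independent families, finiteness passes at once to a smaller [F] and to a
    larger [E]. *)
Definition ffinite E F : Prop :=
  exists N, forall n (b : 'I_n -> K), (forall i, F (b i)) -> indep E b ->
  (n <= N)%N.

(** Gaussian elimination by induction on the number of equations: [B] clears the first column with
    the pivot row [i0], and [t] is the coefficient of that row in the solution. *)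
Lemma homogeneous_system E : subfield E ->
  forall n m (A : 'I_m -> 'I_n -> K), (n < m)%N -> (forall i j, E (A i j)) ->
  exists c : 'I_m -> K, [/\ forall i, E (c i), exists i, c i != 0
    & forall j, \sum_i c i * A i j = 0].
Proof.
move=> hE; elim=> [|n IH] [|m] A // lt_nm EA.
  exists (fun=> 1); split=> [i||[]//]; first exact: subfield1 hE.
  by exists ord0; apply: oner_neq0.
have [/existsP [i0 nz]|/existsPn zero] := boolP [exists i, A i ord0 != 0]; last first.
  have [|c [Ec nzc hc]] := IH m.+1 (fun i j => A i (lift ord0 j)) (ltnW lt_nm).
    by move=> *; apply: EA.
  exists c; split=> // j; have [j'|] := unliftP ord0 j.
    by move->; apply: hc.
  by move->; rewrite big1 // => i _; rewrite (eqP (negbNE (zero i))) mulr0.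
pose B i j := A (lift i0 i) (lift ord0 j)
  - A (lift i0 i) ord0 / A i0 ord0 * A i0 (lift ord0 j).
have [|c [Ec [i1 nzc] hc]] := IH m B lt_nm.
  by move=> i j; apply: (subfieldB hE) => //; apply: (subfieldM hE) => //; apply: (subfield_div hE).
pose t := - \sum_i c i * A (lift i0 i) ord0 / A i0 ord0.
exists (fun i => if unlift i0 i is Some i' then c i' else t).
have Et : E t.
  apply: (subfieldN hE); apply: (subfield_sum hE) => i.
  by apply: (subfield_div hE) => //; apply: (subfieldM hE).
split=> [i||j].
- by case: (unlift i0 i).
- by exists (lift i0 i1); rewrite liftK.
rewrite (bigD1_ord i0) //= unlift_none.
under eq_bigr do rewrite liftK.
have [j' ->|->] := unliftP ord0 j; last first.
  by rewrite mulNr mulr_suml -sumrN -big_split big1 // => i _ /=; rewrite divfK ?addNr.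
rewrite -[RHS](hc j') mulNr mulr_suml -sumrN -big_split; apply: eq_bigr => i _ /=.
by rewrite /B mulrBr addrC !mulrA.
Qed.

Lemma sum_enum_val (I : finType) (F : I -> K) :
  \sum_i F i = \sum_(k < #|I|) F (enum_val k).
Proof. by rewrite (reindex _ (onW_bij _ (@enum_val_bij I))). Qed.

Lemma indep_le_span E (I J : finType) (u : I -> K) (b : J -> K) :
  subfield E -> indep E u -> (forall i, lincomb E b (u i)) -> (#|I| <= #|J|)%N.
Proof.
move=> hE ind /choice [C hC]; rewrite leqNgt; apply/negP => lt.
have [|c [Ec [i0 nz] hc]] := homogeneous_system hE
  (A := fun i j => C (enum_val i) (enum_val j)) lt.
  by move=> i j; case: (hC (enum_val i)).
case/negP: nz; apply/eqP.
rewrite -(enum_valK i0); apply: (ind (fun i => c (enum_rank i))) => [i//|].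
transitivity (\sum_i \sum_j c (enum_rank i) * C i j * b j).
  apply: eq_bigr => i _; have [_ {1}->] := hC i; rewrite mulr_sumr.
  by apply: eq_bigr => j _; rewrite mulrA.
rewrite exchange_big big1 // => j _ /=; rewrite -mulr_suml sum_enum_val.
under eq_bigr do rewrite enum_valK.
by have /= := hc (enum_rank j); rewrite enum_rankK => ->; rewrite mul0r.
Qed.

Lemma basis_fdegree E F (I : finType) (b : I -> K) :
  basis E F b -> fdegree E F #|I|.
Proof.
case=> Fb ind span; exists (b \o enum_val); split=> [i|c Ec h i|z /span [c [Ec ->]]].
- exact: Fb.
- rewrite -(enum_valK i); apply: (ind (fun i => c (enum_rank i))) => //.
  by rewrite sum_enum_val; under eq_bigr do rewrite enum_valK.
- by exists (c \o enum_val); split=> [i|]; [exact: Ec | rewrite sum_enum_val].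
Qed.

Lemma fdegree_unique E F m n :
  subfield E -> fdegree E F m -> fdegree E F n -> m = n.
Proof.
move=> hE [b [Fb ib sb]] [c [Fc ic sc]]; apply/eqP; rewrite eqn_leq.
rewrite -[in X in X && _](card_ord m) -[in X in X && _](card_ord n).
rewrite -[in X in _ && X](card_ord m) -[in X in _ && X](card_ord n).
by apply/andP; split; apply: indep_le_span; eauto.
Qed.

Lemma sum_pair (I J : finType) (F : I * J -> K) :
  \sum_p F p = \sum_j \sum_i F (i, j).
Proof. by rewrite exchange_big pair_bigA; apply: eq_bigr => -[]. Qed.

Lemma fdegree_tower E F L m n :
  subfield F -> (forall z, E z -> F z) -> (forall z, F z -> L z) -> subfield L ->
  fdegree E F m -> fdegree F L n -> fdegree E L (m * n).
Proof.
move=> hF EF FL hL [b [Fb ib sb]] [c [Lc ic sc]].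
rewrite -[m in (m * n)%N](card_ord m) -[n in (_ * n)%N](card_ord n) -card_prod.
apply: (@basis_fdegree _ _ _ (fun ij : 'I_m * 'I_n => b ij.1 * c ij.2)).
split=> [[i j] /=|d Ed h [i j]|z].
- by apply: (subfieldM hL) => //; apply: FL.
- apply: (ib (fun i => d (i, j))) => // {i}.
  apply: (ic (fun j => \sum_i d (i, j) * b i)) => [k|].
    by apply: (subfield_sum hF) => i; apply: (subfieldM hF) => //; apply: EF.
  rewrite -[RHS]h sum_pair /=.
  by apply: eq_bigr => k _; rewrite mulr_suml; apply: eq_bigr => i _; rewrite mulrA.
- case/sc=> e [Fe ->]; have /choice [d hd] : forall j, lincomb E b (e j) by move=> j; apply: sb.
  exists (fun ij => d ij.2 ij.1); split=> [[i j]|]; first by case: (hd j).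
  rewrite sum_pair /=.
  apply: eq_bigr => j _; have [_ {1}->] := hd j; rewrite mulr_suml.
  by apply: eq_bigr => i _; rewrite mulrA.
Qed.

(** A longest independent family is a basis; it is not empty because 1 alone is independent. *)
Lemma ffinite_fdegree E F : subfield E -> (forall z, E z -> F z) -> subfield F ->
  ffinite E F -> exists2 n, (0 < n)%N & fdegree E F n.
Proof.
move=> hE EF hF [N hN].
pose P n := `[< exists b : 'I_n -> K, (forall i, F (b i)) /\ indep E b >].
have P1 : P 1%N.
  apply/asboolP; exists (fun=> 1); split=> [i|c _]; first exact: subfield1 hF.
  by rewrite big_ord1 mulr1 => h i; rewrite [i]ord1.
have ex : exists n, P n by exists 1%N.
have bd n : P n -> (n <= N)%N by move=> /asboolP [b [Fb ib]]; apply: hN ib.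
case: (ex_maxnP ex bd) => n /asboolP [b [Fb ib]] max.
exists n; first exact: max P1.
exists b; split=> // z Fz.
pose b' (i : 'I_n.+1) := if unlift ord0 i is Some j then b j else z.
have : ~ indep E b'.
  move=> ib'; have /max : P n.+1 by apply/asboolP; exists b'; split=> // i; rewrite /b'; case: unlift.
  by rewrite ltnn.
move=> nind; apply: contrapT => ncomb; apply: nind => c Ec.
rewrite big_ord_recl {1}/b' unlift_none.
under eq_bigr do rewrite /b' liftK.
have [c0 |nz h] := eqVneq (c ord0) 0.
  rewrite c0 mul0r add0r => /ib h i; have [j ->|-> //] := unliftP ord0 i.
  - exact: h.
case: ncomb; exists (fun j => - (c (lift ord0 j) / c ord0)); split=> [i|].
  by apply: (subfieldN hE); apply: (subfield_div hE).
have {h} -> : z = - (\sum_i c (lift ord0 i) * b i) / c ord0.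
  by move/eqP: h; rewrite addr_eq0 => /eqP <-; rewrite mulrAC divff // mul1r.
rewrite -sumrN mulr_suml; apply: eq_bigr => j _; ring.
Qed.
End SubfieldDegree.

Definition coefs_in (K : nzRingType) (E : K -> Prop) (p : {poly K}) := forall i, E p`_i.

(** * Simple extensions and transport of degrees *)

Section SubfieldExtension.
Variable K : fieldType.
Implicit Types (E F L : K -> Prop) (x y z a : K) (p q : {poly K}).

Lemma span_ffinite E F (J : finType) (b : J -> K) : subfield E ->
  (forall z, F z -> lincomb E b z) -> ffinite E F.
Proof.
move=> hE span; exists #|J| => n u Fu iu; rewrite -[n](card_ord n).
by apply: indep_le_span hE iu _ => i; apply: span.
Qed.

Lemma ffinite_sub E F L : ffinite E L -> (forall z, F z -> L z) -> ffinite E F.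
Proof. by case=> N hN FL; exists N => n b Fb; apply: hN => i; apply: FL. Qed.

Lemma ffinite_base E F L : ffinite E L -> (forall z, E z -> F z) -> ffinite F L.
Proof.
case=> N hN EF; exists N => n b Fb ib; apply: hN (Fb) _ => c Ec.
by apply: ib => i; apply: EF.
Qed.

Lemma ffinite_trans E F L : subfield E -> subfield F -> subfield L ->
  (forall z, E z -> F z) -> (forall z, F z -> L z) ->
  ffinite E F -> ffinite F L -> ffinite E L.
Proof.
move=> hE hF hL EF FL fEF fFL.
have [m _ dm] := ffinite_fdegree hE EF hF fEF.
have [n _ dn] := ffinite_fdegree hF FL hL fFL.
have [b [_ _ span]] := fdegree_tower hF EF FL hL dm dn.
exact: span_ffinite hE span.
Qed.

Lemma coefs_inM E p q : subfield E -> coefs_in E p -> coefs_in E q -> coefs_in E (p * q).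
Proof.
move=> hE Ep Eq i; rewrite coefM; apply: (subfield_sum hE) => j.
exact: (subfieldM hE).
Qed.

Definition algebraic_over E a := exists p, [/\ p != 0, coefs_in E p & p.[a] = 0].

(** The ring E[a]. It is a field when [a] is algebraic over a subfield [E]; for the extension of
    homomorphisms [E] is only a subring. *)
Definition adjoin E a z := exists p, coefs_in E p /\ z = p.[a].

Lemma adjoin_base E a z : subfield E -> E z -> adjoin E a z.
Proof.
move=> hE Ez; exists z%:P; split=> [i|]; rewrite ?hornerC // coefC.
by case: ifP => // _; apply: subfield0 hE.
Qed.

Lemma adjoin_gen E a : subfield E -> adjoin E a a.
Proof.
move=> hE; exists 'X; split=> [i|]; rewrite ?hornerX // coefX.
by case: eqP => _; [apply: subfield1 hE | apply: subfield0 hE].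
Qed.

Lemma adjoinB E a x y : subfield E -> adjoin E a x -> adjoin E a y -> adjoin E a (x - y).
Proof.
move=> hE [p [Ep ->]] [q [Eq ->]]; exists (p - q); split=> [i|].
  by rewrite coefB; apply: (subfieldB hE).
by rewrite hornerD hornerN.
Qed.

Lemma adjoinM E a x y : subfield E -> adjoin E a x -> adjoin E a y -> adjoin E a (x * y).
Proof.
move=> hE [p [Ep ->]] [q [Eq ->]]; exists (p * q); split; last by rewrite hornerM.
exact: coefs_inM.
Qed.

(** The equation [p] rewrites each power of [a] of exponent at least deg p through lower powers. *)
Lemma adjoin_span E a p d : subfield E -> p != 0 -> coefs_in E p -> p.[a] = 0 ->
  (size p <= d.+1)%N ->
  forall z, adjoin E a z -> lincomb E (fun i : 'I_d => a ^+ i) z.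
Proof.
move=> hE p0 Ep pa0 szp z [q [Eq ->]] {z}.
have sub0 : lincomb E (fun i : 'I_d => a ^+ i) 0.
  exists (fun=> 0); split=> [_|]; first exact: subfield0 hE.
  by rewrite big1 // => i _; rewrite mul0r.
have subD c x y : E c -> lincomb E (fun i : 'I_d => a ^+ i) x ->
   lincomb E (fun i : 'I_d => a ^+ i) y -> lincomb E (fun i : 'I_d => a ^+ i) (c * x + y).
  move=> Ec [u [Eu ->]] [v [Ev ->]]; exists (fun i => c * u i + v i).
  split=> [i|]; first by apply: (subfieldD hE) => //; apply: (subfieldM hE).
  by rewrite mulr_sumr -big_split; apply: eq_bigr => i _ /=; rewrite mulrDl mulrA.
have subS (I : Type) (r : seq I) (c f : I -> K) : (forall i, E (c i)) ->
    (forall i, lincomb E (fun i : 'I_d => a ^+ i) (f i)) ->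
    lincomb E (fun i : 'I_d => a ^+ i) (\sum_(i <- r) c i * f i).
  move=> Ec Hf; elim: r => [|i r IH]; rewrite ?big_nil ?big_cons //.
  exact: subD.
suff pow n : lincomb E (fun i : 'I_d => a ^+ i) (a ^+ n).
  rewrite horner_coef; apply: (subS _ _ (fun i : 'I_(size q) => q`_i) (fun i => a ^+ i)) => i.
    exact: Eq.
  exact: pow.
pose m := (size p).-1.
have sp : size p = m.+1 by rewrite /m prednK // lt0n size_poly_eq0.
elim/ltn_ind: n => n IH; have [lt_nd|le_dn] := ltnP n d.
  exists (fun i => if i == Ordinal lt_nd then 1 else 0); split=> [i|].
    by case: ifP => _; [apply: subfield1 hE | apply: subfield0 hE].
  rewrite (bigD1 (Ordinal lt_nd)) //= eqxx mul1r big1 ?addr0 // => i /negPf ->.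
  by rewrite mul0r.
have le_mn : (m <= n)%N by rewrite (leq_trans _ le_dn) // -ltnS -sp.
have -> : a ^+ n = \sum_(i < m) - (p`_i / p`_m) * a ^+ (i + (n - m)).
  move: pa0; rewrite horner_coef sp big_ord_recr /= => /eqP.
  have nz : p`_m != 0 by have := lead_coef_eq0 p; rewrite /lead_coef sp => ->.
  rewrite addr_eq0 => /eqP h; apply: (mulfI nz); rewrite mulr_sumr.
  rewrite -[in LHS](subnKC le_mn) exprD mulrA -[p`_m * _]opprK -h mulNr mulr_suml -sumrN.
  by apply: eq_bigr => i _; rewrite exprD; field.
apply: (subS _ _ (fun i : 'I_m => - (p`_i / p`_m)) (fun i => a ^+ (i + (n - m)))) => i.
  by apply: (subfieldN hE); apply: (subfield_div hE).
by apply: IH; have := ltn_ord i; lia.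
Qed.

(** Finite dimension gives an equation q(y) y + e = 0 over [E]. If e != 0 then y^-1 = - q(y) / e; if
    e = 0 a factor y is cancelled and the argument repeated. *)
Lemma finite_subring_field E (B : K -> Prop) : subfield E ->
  (forall z, E z -> B z) -> (forall x y, B x -> B y -> B (x - y)) ->
  (forall x y, B x -> B y -> B (x * y)) -> ffinite E B -> subfield B.
Proof.
move=> hE EB BB BM [N hN].
have B1 : B 1 by apply: EB; apply: subfield1 hE.
have BD x y : B x -> B y -> B (x + y).
  move=> Bx By; rewrite -[y]opprK; apply: (BB) => //; rewrite -sub0r; apply: (BB) => //.
  by apply: EB; apply: subfield0 hE.
split=> // x y Bx By; apply: (BM) => // {x Bx}.
have [->|nzy] := eqVneq y 0; first by rewrite invr0; apply: EB; apply: subfield0 hE.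
have BX n : B (y ^+ n) by elim: n => [|n IH]; rewrite ?expr0 ?exprS //; apply: BM.
have [c Ec [i0 nz] h] : exists2 c : 'I_N.+1 -> K, forall i, E (c i) &
    exists2 i0, c i0 != 0 & \sum_i c i * y ^+ i = 0.
  apply: contrapT => none.
  have /hN : indep E (fun i : 'I_N.+1 => y ^+ i).
    move=> c Ec h i; apply: contrapT => /eqP nz; apply: none.
    by exists c => //; exists i.
  by rewrite ltnn => /(_ (fun=> BX _)).
pose q := \poly_(j < N.+1) (if insub j is Some i then c i else 0).
have Eq : coefs_in E q.
  move=> j; rewrite coef_poly; case: ifP => _; last exact: subfield0 hE.
  by case: insub => [i|]; [exact: Ec|exact: subfield0 hE].
have q0 : q != 0.
  apply: contra_neq nz => /(congr1 (fun r : {poly K} => r`_i0)).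
  by rewrite coef_poly ltn_ord coef0 valK.
have qy : q.[y] = 0.
  by rewrite horner_poly -[RHS]h; apply: eq_bigr => i _; rewrite valK.
elim/poly_ind: {c Ec i0 nz h} q Eq q0 qy => [|q e IH] Eq q0; first by rewrite eqxx in q0.
rewrite hornerMXaddC => h.
have Eq' : coefs_in E q.
  by move=> i; have := Eq i.+1; rewrite coefD coefMX coefC /= addr0.
have Ee : E e by have := Eq 0%N; rewrite coefD coefMX coefC /= add0r.
have Bq : B q.[y].
  rewrite horner_coef; apply: (big_ind B) => //; first by apply: EB; apply: subfield0 hE.
  by move=> i _; apply: BM => //; apply: EB.
have [e0|nze] := eqVneq e 0.
  apply: IH => //; first by apply: contra_neq q0 => ->; rewrite e0 mul0r addr0.
  by move/eqP: h; rewrite e0 addr0 mulf_eq0 (negPf nzy) orbF => /eqP.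
have -> : y^-1 = q.[y] * - e^-1.
  apply: (mulfI nzy); rewrite divff // mulrA [y * _]mulrC mulrN.
  by move/eqP: h; rewrite addr_eq0 => /eqP ->; rewrite mulNr opprK divff.
by apply: BM => //; apply: EB; apply: (subfieldN hE); apply: (subfieldV hE).
Qed.

Lemma adjoin_ffinite E a : subfield E -> algebraic_over E a -> ffinite E (adjoin E a).
Proof.
move=> hE [p [p0 Ep pa0]]; apply: (span_ffinite hE (adjoin_span hE p0 Ep pa0 (leqnSn _))).
Qed.

Lemma adjoin_subfield E a : subfield E -> algebraic_over E a -> subfield (adjoin E a).
Proof.
move=> hE aa; apply: (@finite_subring_field E) => //.
- by move=> z; apply: adjoin_base.
- by move=> x y; apply: adjoinB.
- by move=> x y; apply: adjoinM.
- exact: adjoin_ffinite.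
Qed.

Lemma adjoin_min E F a : subfield F -> (forall z, E z -> F z) -> F a ->
  forall z, adjoin E a z -> F z.
Proof.
move=> hF EF Fa z [p [Ep ->]]; rewrite horner_coef; apply: (subfield_sum hF) => i.
by apply: (subfieldM hF); [apply: EF | apply: (subfieldX hF)].
Qed.

Lemma adjoin_degree_le E a p d n : subfield E -> p != 0 -> coefs_in E p -> p.[a] = 0 ->
  (size p <= d.+1)%N -> fdegree E (adjoin E a) n -> (n <= d)%N.
Proof.
move=> hE p0 Ep pa sz [b [Fb ib _]]; rewrite -(card_ord n) -[d](card_ord d).
apply: indep_le_span ib _ => // i; exact: (adjoin_span hE p0 Ep pa sz).
Qed.

Lemma fdegree_annul E F a n : subfield E -> subfield F -> fdegree E F n -> F a ->
  exists p, [/\ p != 0, coefs_in E p, (size p <= n.+1)%N & p.[a] = 0].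
Proof.
move=> hE hF [b [Fb ib sb]] Fa.
have [c Ec [i0 nz] h] : exists2 c : 'I_n.+1 -> K, forall i, E (c i) &
    exists2 i0, c i0 != 0 & \sum_i c i * a ^+ i = 0.
  apply: contrapT => none.
  have ia : indep E (fun i : 'I_n.+1 => a ^+ i).
    move=> c Ec h i; apply: contrapT => /eqP nz; apply: none.
    by exists c => //; exists i.
  have := indep_le_span hE ia (fun i => sb _ (subfieldX hF i Fa)).
  by rewrite !card_ord ltnn.
pose q := \poly_(j < n.+1) (if insub j is Some i then c i else 0).
exists q; split.
- apply: contra_neq nz => /(congr1 (fun r : {poly K} => r`_i0)).
  by rewrite coef_poly ltn_ord coef0 valK.
- move=> j; rewrite coef_poly; case: ifP => _; last exact: subfield0 hE.
  by case: insub => [i|]; [exact: Ec|exact: subfield0 hE].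
- exact: size_poly.
- by rewrite horner_poly -[RHS]h; apply: eq_bigr => i _; rewrite valK.
Qed.

(** [T] is the graph of a field isomorphism F1 -> F2 carrying E1 to E2. A relation is convenient
    because the isomorphism to which this is applied is given on expressions in generators, which
    are not unique. *)
Lemma fdegree_transport (E1 F1 E2 F2 : K -> Prop) (T : K -> K -> Prop) n :
  subfield F1 -> (forall z, E1 z -> F1 z) -> (forall z, E2 z -> F2 z) ->
  (forall z, F1 z -> exists2 w, F2 w & T z w) ->
  (forall w, F2 w -> exists2 z, F1 z & T z w) ->
  (forall z w z' w', T z w -> T z' w' -> T (z - z') (w - w')) ->
  (forall z w z' w', T z w -> T z' w' -> T (z * z') (w * w')) ->
  (forall z w, T z w -> z = 0 <-> w = 0) ->
  (forall z w, T z w -> E1 z <-> E2 w) ->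
  fdegree E1 F1 n -> fdegree E2 F2 n.
Proof.
move=> hF1 EF1 EF2 f12 f21 TB TM T0 TE [b [Fb ib sb]].
have T00 : T 0 0.
  have [w _ h] := f12 0 (subfield0 hF1); have : w = 0 by apply/(T0 _ _ h).
  by move=> w0; rewrite w0 in h.
have TD z w z' w' : T z w -> T z' w' -> T (z + z') (w + w').
  move=> h h'; rewrite -[z']opprK -[w']opprK -(sub0r z') -(sub0r w').
  by apply: (TB) => //; apply: (TB).
have TS (c d u v : 'I_n -> K) : (forall i, T (c i) (d i)) -> (forall i, T (u i) (v i)) ->
    T (\sum_i c i * u i) (\sum_i d i * v i).
  by move=> h h'; apply: (big_ind2 T) => // i _; apply: TM.
have /choice [b' hb'] : forall i, exists w, F2 w /\ T (b i) w.
  by move=> i; have [w] := f12 _ (Fb i); exists w.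
have back (c : 'I_n -> K) : (forall i, E2 (c i)) -> exists d, (forall i, E1 (d i) /\ T (d i) (c i)).
  move=> Ec; have /choice [d hd] : forall i, exists z, E1 z /\ T z (c i).
    by move=> i; have [z _ h] := f21 _ (EF2 _ (Ec i)); exists z; split=> //; apply/(TE _ _ h).
  by exists d.
exists b'; split=> [i|c Ec h i|w Fw].
- by case: (hb' i).
- have [d hd] := back _ Ec.
  have d0 : forall i, d i = 0.
    apply: ib => [j|]; first by case: (hd j).
    by apply/(T0 _ _ (TS d c b b' (fun j => (hd j).2) (fun j => (hb' j).2))).
  by apply/(T0 _ _ (hd i).2).
- have [z Fz Tzw] := f21 _ Fw; have [c [Ec zE]] := sb _ Fz.
  have /choice [d hd] : forall i, exists w, E2 w /\ T (c i) w.
    move=> i; have [v _ h] := f12 _ (EF1 _ (Ec i)); exists v; split=> //.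
    by apply/(TE _ _ h).
  exists d; split=> [i|]; first by case: (hd i).
  apply/eqP; rewrite -subr_eq0; apply/eqP.
  have h := TB _ _ _ _ Tzw (TS c d b b' (fun j => (hd j).2) (fun j => (hb' j).2)).
  by apply/(T0 _ _ h); rewrite zE subrr.
Qed.

End SubfieldExtension.

(** * Rational functions and the degree over k(x) *)

Section GaussLemma.
Variable F : fieldType.
Implicit Types (p c : {poly F}) (P S G : {poly {poly F}}).

Lemma irreducible_factor c : (1 < size c)%N ->
  exists2 p, irreducible_poly p & p %| c.
Proof.
move=> szc.
pose Pr n := `[< exists p, [/\ (1 < size p)%N, p %| c & size p = n] >].
have ex : exists n, Pr n by exists (size c); apply/asboolP; exists c.
case: (ex_minnP ex) => n /asboolP [p [szp dvd <-]] min.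
exists p => //; split=> // q szq dvq.
have q0 : q != 0 by apply: contraTneq dvq => ->; rewrite dvd0p -size_poly_gt0; apply: ltnW.
rewrite /eqp dvq /=.
have le : (size p <= size q)%N.
  apply: min; apply/asboolP; exists q; split=> //; last exact: dvdp_trans dvd.
  by move: szq q0; rewrite -size_poly_gt0; case: (size q) => [|[]].
have p0 : p != 0 by rewrite -size_poly_gt0; apply: ltnW.
suff /andP [] : q %= p by [].
by rewrite -(dvdp_size_eqp dvq) eqn_leq le dvdp_leq.
Qed.

Lemma content_cofactor p P : (forall i, p %| P`_i) -> exists S : {poly {poly F}}, P = p%:P * S.
Proof.
move=> h; exists (\poly_(i < size P) (P`_i %/ p)); apply/polyP => i.
rewrite coefCM coef_poly; case: ltnP => [_|le]; last by rewrite mulr0 nth_default.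
by rewrite mulrC divpK.
Qed.

(** If i and j are the least indices at which [p] fails to divide [P] and [S], the coefficient i + j
    of the product is P[_i S]_j modulo [p]. *)
Lemma gauss_content p P S : irreducible_poly p -> (forall i, p %| (P * S)`_i) ->
  (forall i, p %| P`_i) \/ (forall i, p %| S`_i).
Proof.
move=> irr h; apply: contrapT => /not_orP [/existsNP nP /existsNP nS].
have eP : exists i, ~~ (p %| P`_i) by case: nP => i /negP; exists i.
have eS : exists i, ~~ (p %| S`_i) by case: nS => i /negP; exists i.
case: (ex_minnP eP) => i ndP minP; case: (ex_minnP eS) => j ndS minS.
have := h (i + j)%N; rewrite coefM.
have lt : (i < (i + j).+1)%N by lia.
rewrite (bigD1 (Ordinal lt)) //= addKn.
rewrite dvdp_addl; last first.
  apply: (big_ind (fun q => p %| q)) => [||k nk]; [exact: dvdp0 | by move=> ? ?; apply: dvdp_add |].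
  have [lti|lei] := ltnP k i.
    by apply: dvdp_mulr; apply: contraLR lti => /minP; rewrite -leqNgt.
  apply: dvdp_mull; apply: contraT => /minS.
  by have := ltn_ord k; move: nk; rewrite -(inj_eq val_inj) /=; lia.
have cop (q : {poly F}) : ~~ (p %| q) -> coprimep p q.
  move=> nd; apply/coprimepP => d dp dq; rewrite -size_poly_eq1.
  apply: contraT => szd; have := irr.2 d szd dp => /eqp_dvdl e.
  by move: nd; rewrite -e dq.
by rewrite Gauss_dvdpr ?(negPf ndS) //; apply: cop.
Qed.

(** The irreducible factors of [c] are removed one at a time: each divides all coefficients of
    [P * S], hence those of [S]. *)
Lemma primitive_dvd P : (forall p, irreducible_poly p -> exists i, ~~ (p %| P`_i)) ->
  forall c G S, c != 0 -> c%:P * G = P * S -> exists S', G = P * S'.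
Proof.
move=> prim c; have [n] := ubnP (size c); elim: n c => // n IH c szc G S c0 e.
have [le1|gt1] := leqP (size c) 1.
  have [u u0 cu] : exists2 u, u != 0 & c = u%:P.
    have /size_poly1P [u u0 ->] : size c == 1%N by rewrite eqn_leq le1 size_poly_gt0.
    by exists u.
  by exists (u^-1%:P%:P * S); rewrite mulrCA -e cu mulrA -!polyCM mulVf // !polyC1 mul1r.
have [p irr dvd] := irreducible_factor gt1.
have [c' ec] : exists c', c = c' * p by exists (c %/ p); rewrite divpK.
have p0 : p != 0 by case: irr => h _; rewrite -size_poly_gt0; apply: ltnW.
have [] := @gauss_content p P S irr.
- by move=> i; rewrite -e coefCM; apply: dvdp_mulr.
- by have [i /negP nd] := prim p irr => /(_ i).
case/content_cofactor=> S1 eS.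
apply: (IH c' _ G S1).
- have c'0 : c' != 0 by apply: contra_neq c0 => h; rewrite ec h mul0r.
  move: szc; rewrite ec size_mul //; case: irr => h _; move: h.
  by move: (size c') (size p) => u v; lia.
- by apply: contra_neq c0 => h; rewrite ec h mul0r.
apply: (@mulfI _ p%:P); first by rewrite polyC_eq0.
by rewrite mulrA -polyCM [p * _]mulrC -ec e eS mulrCA.
Qed.

End GaussLemma.

Section RationalFunctions.
Variables (k : fieldType) (K : fieldType) (i : {rmorphism k -> K}).
Implicit Types (f g : {poly k}) (P G : {poly {poly k}}) (x y z w : K) (F : K -> Prop).

Definition ev x f : K := (map_poly i f).[x].

Lemma evC x c : ev x c%:P = i c. Proof. by rewrite /ev map_polyC hornerC. Qed.
Lemma evX x : ev x 'X = x. Proof. by rewrite /ev map_polyX hornerX. Qed.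
Lemma evB x f g : ev x (f - g) = ev x f - ev x g.
Proof. by rewrite /ev rmorphB hornerD hornerN. Qed.
Lemma evD x f g : ev x (f + g) = ev x f + ev x g.
Proof. by rewrite /ev rmorphD hornerD. Qed.
Lemma evM x f g : ev x (f * g) = ev x f * ev x g.
Proof. by rewrite /ev rmorphM hornerM. Qed.
Lemma ev0 x : ev x 0 = 0. Proof. by rewrite /ev rmorph0 horner0. Qed.
Lemma ev1 x : ev x 1 = 1. Proof. by rewrite /ev rmorph1 hornerC. Qed.
Lemma ev_prod x (I : Type) (r : seq I) (P : pred I) (f : I -> {poly k}) :
  ev x (\prod_(j <- r | P j) f j) = \prod_(j <- r | P j) ev x (f j).
Proof. exact: (big_morph (ev x) (evM x) (ev1 x)). Qed.
Lemma ev_sum x f : ev x f = \sum_(j < size f) i f`_j * x ^+ j.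
Proof.
rewrite /ev horner_coef size_map_poly; apply: eq_bigr => j _.
by rewrite coef_map.
Qed.

Definition transcendental x := forall f, ev x f = 0 -> f = 0.

(** The subfield k(x); a vanishing denominator only contributes the value 0. *)
Definition ratf x w := exists f g, w = ev x f / ev x g.

Lemma ratf_ev x f : ratf x (ev x f).
Proof. by exists f, 1; rewrite ev1 divr1. Qed.

Lemma ratf_const x c : ratf x (i c).
Proof. by rewrite -(evC x); apply: ratf_ev. Qed.

Lemma ratf_gen x : ratf x x.
Proof. by rewrite -{2}(evX x); apply: ratf_ev. Qed.

Lemma ratf_nz x w : ratf x w -> exists f g, ev x g != 0 /\ w = ev x f / ev x g.
Proof.
case=> f [g ->]; have [->|nz] := eqVneq (ev x g) 0; last by exists f, g.
by exists 0, 1; rewrite ev1 oner_neq0 ev0 invr0 mulr0 mul0r.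
Qed.

Lemma ratf_subfield x : subfield (ratf x).
Proof.
split=> [|w w' /ratf_nz [f [g [g0 ->]]] /ratf_nz [f' [g' [g0' ->]]]|w w' [f [g ->]] [f' [g' ->]]].
- by rewrite -(ev1 x); apply: ratf_ev.
- exists (f * g' - f' * g), (g * g'); rewrite evB !evM; field.
  by rewrite g0 g0'.
- exists (f * g'), (g * f'); rewrite !evM !invfM invrK; ring.
Qed.

Lemma ev_closed F x f : subfield F -> (forall c, F (i c)) -> F x -> F (ev x f).
Proof.
move=> hF Fi Fx; rewrite ev_sum; apply: (subfield_sum hF) => j.
by apply: (subfieldM hF) => //; apply: (subfieldX hF).
Qed.

Lemma ratf_min F x : subfield F -> (forall c, F (i c)) -> F x ->
  forall w, ratf x w -> F w.
Proof.
by move=> hF Fi Fx w [f [g ->]]; apply: (subfield_div hF); apply: ev_closed.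
Qed.

Lemma ratf_common x (I : finType) (c : I -> K) : (forall j, ratf x (c j)) ->
  exists g, ev x g != 0 /\ exists f : I -> {poly k}, forall j, c j = ev x (f j) / ev x g.
Proof.
move=> h; have /choice [fg hfg] : forall j, exists fg : {poly k} * {poly k},
    ev x fg.2 != 0 /\ c j = ev x fg.1 / ev x fg.2.
  by move=> j; have [f [g hh]] := ratf_nz (h j); exists (f, g).
exists (\prod_j (fg j).2); split.
  by rewrite ev_prod; apply/prodf_neq0 => j _; case: (hfg j).
exists (fun j => (fg j).1 * \prod_(l | l != j) (fg l).2) => j.
rewrite [X in _ / ev x X](bigD1 j) //= !evM; have [nz ->] := hfg j.
have nz' : ev x (\prod_(l | l != j) (fg l).2) != 0.
  by rewrite ev_prod; apply/prodf_neq0 => l _; case: (hfg l).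
by field; rewrite nz nz'.
Qed.

(** For [P] in k[X][Y] the inner variable X becomes [x] and the outer Y becomes [y]. Accordingly
    [size] bounds the degree in Y and [sizeY], the largest size of a coefficient, the degree in
    X. *)
Definition ev2 x y P : K := (map_poly (ev x) P).[y].

Definition ev_morph x : {rmorphism {poly k} -> K} := horner_eval x \o map_poly i.
Definition ev2_morph x y : {rmorphism {poly {poly k}} -> K} :=
  horner_eval y \o map_poly (ev_morph x).

Lemma ev2C x y f : ev2 x y f%:P = ev x f.
Proof. by rewrite /ev2 (map_polyC (ev_morph x)) hornerC. Qed.
Lemma ev2X x y : ev2 x y 'X = y.
Proof. by rewrite /ev2 (map_polyX (ev_morph x)) hornerX. Qed.
Lemma ev2D x y P G : ev2 x y (P + G) = ev2 x y P + ev2 x y G.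
Proof. exact: (rmorphD (ev2_morph x y)). Qed.
Lemma ev2M x y P G : ev2 x y (P * G) = ev2 x y P * ev2 x y G.
Proof. exact: (rmorphM (ev2_morph x y)). Qed.
Lemma ev20 x y : ev2 x y 0 = 0. Proof. exact: (rmorph0 (ev2_morph x y)). Qed.
Lemma ev2_sum x y P : ev2 x y P = \sum_(j < size P) ev x P`_j * y ^+ j.
Proof.
rewrite /ev2 (@horner_coef_wide _ (size P)) ?size_poly //.
by apply: eq_bigr => j _; rewrite coef_map_id0 ?ev0.
Qed.

Lemma ev2_swap x y P : ev2 x y (swapXY P) = ev2 y x P.
Proof.
elim/poly_ind: P => [|P f IH]; first by rewrite raddf0 !ev20.
rewrite rmorphD rmorphM /= !ev2D !ev2M IH swapXY_X ev2C evX ev2X swapXY_polyC ev2C.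
congr (_ + _); rewrite /ev2 -map_poly_comp_id0 ?ev0 // [RHS]/ev; congr _.[_].
by apply: eq_map_poly => c /=; rewrite evC.
Qed.

Lemma fdegree_relation x y F n : subfield F -> fdegree (ratf x) F n -> F y ->
  exists P, [/\ P != 0, (size P <= n.+1)%N & ev2 x y P = 0].
Proof.
move=> hF d Fy; have [q [q0 Eq sq qy]] := fdegree_annul (ratf_subfield x) hF d Fy.
have [g [g0 [f hf]]] := ratf_common (fun j : 'I_n.+1 => Eq j).
exists (\poly_(j < n.+1) (if insub j is Some l then f l else 0)); split.
- have lq : q`_(size q).-1 != 0 by rewrite -[_`__]/(lead_coef q) lead_coef_eq0.
  have lt : ((size q).-1 < n.+1)%N by lia.
  apply: contra_neq lq => /(congr1 (fun r : {poly {poly k}} => r`_(Ordinal lt))).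
  by rewrite coef_poly ltn_ord coef0 valK -[(size q).-1]/(val (Ordinal lt)) hf => ->; rewrite ev0 mul0r.
- exact: size_poly.
rewrite /ev2 (_ : map_poly _ _ = (ev x g) *: q) ?hornerZ ?qy ?mulr0 //.
apply/polyP => j; rewrite coefZ coef_map_id0 ?ev0 // coef_poly; case: ltnP => [lt|le].
  by rewrite insubT /= -[j]/(val (Ordinal lt)) hf mulrC divfK.
by rewrite ev0 nth_default ?mulr0 // (leq_trans sq).
Qed.

Lemma relation_algebraic x y P : transcendental x -> P != 0 -> ev2 x y P = 0 ->
  algebraic_over (ratf x) y.
Proof.
move=> tx P0 Pxy; exists (map_poly (ev x) P); split=> [|j|//].
  by rewrite map_poly_eq0_id0 // (contra_neq (tx _)) // lead_coef_eq0.
by rewrite coef_map_id0 ?ev0 //; apply: ratf_ev.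
Qed.

(** [P] has least degree in Y and, among these, least degree in X. By the first choice,
    pseudo-division makes [P] divide any relation times a power of its leading coefficient; by the
    second [P] is primitive, so Gauss's lemma removes that power. *)
Lemma relations_principal x y : transcendental x ->
  (exists2 P, P != 0 & ev2 x y P = 0) ->
  exists P, [/\ P != 0, ev2 x y P = 0 &
    forall G, ev2 x y G = 0 -> exists S : {poly {poly k}}, G = P * S].
Proof.
move=> tx [P0 P0nz P0xy].
pose A n := `[< exists P, [/\ P != 0, ev2 x y P = 0 & size P = n] >].
have exA : exists n, A n by exists (size P0); apply/asboolP; exists P0.
case: (ex_minnP exA) => n /asboolP [P1 [P1nz P1xy sP1]] minA.
pose B m := `[< exists P, [/\ P != 0, ev2 x y P = 0, size P = n & sizeY P = m] >].
have exB : exists m, B m by exists (sizeY P1); apply/asboolP; exists P1.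
case: (ex_minnP exB) => m /asboolP [P [Pnz Pxy sP sYP]] minB.
exists P; split=> // G Gxy.
have := Pdiv.ComRing.rdivp_eq P G; set q := Pdiv.Ring.rdivp _ _; set r := Pdiv.Ring.rmodp _ _ => e.
have rxy : ev2 x y r = 0.
  have := congr1 (ev2 x y) e; rewrite -mul_polyC ev2D !ev2M Gxy Pxy !mulr0 add0r.
  by move=> <-.
have r0 : r = 0.
  apply: contrapT => /eqP rnz; have /minA : A (size r) by apply/asboolP; exists r.
  by rewrite leqNgt -sP Pdiv.Ring.ltn_rmodpN0.
rewrite r0 addr0 -mul_polyC mulrC [q * P]mulrC mulrC in e.
apply: (primitive_dvd _ _ e); last by rewrite expf_neq0 // lead_coef_eq0.
move=> p irr; apply: contrapT => none.
have [|S eS] := @content_cofactor _ p P.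
  by move=> j; apply/negPn/negP => nd; apply: none; exists j.
have szp : (1 < size p)%N by case: irr.
have p0 : p != 0 by rewrite -size_poly_gt0; apply: ltnW.
have S0 : S != 0 by apply: contra_neq Pnz => h; rewrite eS h mulr0.
have /minB : B (sizeY S).
  apply/asboolP; exists S; split=> //.
    move/eqP: Pxy; rewrite eS ev2M mulf_eq0 ev2C => /orP [/eqP/tx h|/eqP //].
    by rewrite h eqxx in p0.
  by rewrite -sP eS mul_polyC size_scale.
rewrite -sYP eS !sizeYE rmorphM /= swapXY_polyC size_mul ?swapXY_eq0 //; last first.
  by rewrite map_poly_eq0_id0 ?polyC_eq0 ?lead_coef_eq0.
rewrite size_map_inj_poly ?polyC0 //; last exact: polyC_inj.
have : (0 < size (swapXY S))%N by rewrite size_poly_gt0 swapXY_eq0.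
by move: (size (swapXY S)) szp => v; case: (size p) => [|[|u]] //=; rewrite ?addSn /=; lia.
Qed.

(** The generator of the ideal of relations divides both a relation of degree at most b in Y and one
    of degree at most a in X. *)
Lemma relation_bidegree x y F a b : transcendental x -> transcendental y ->
  subfield F -> fdegree (ratf x) F b -> fdegree (ratf y) F a -> F x -> F y ->
  exists P, [/\ P != 0, (size P <= b.+1)%N, (sizeY P <= a.+1)%N & ev2 x y P = 0].
Proof.
move=> tx ty hF db da Fx Fy.
have [P1 [P1nz sP1 P1xy]] := fdegree_relation hF db Fy.
have [P2 [P2nz sP2 P2xy]] := fdegree_relation hF da Fx.
have ex1 : exists2 P, P != 0 & ev2 x y P = 0 by exists P1.
have [P [Pnz Pxy dv]] := relations_principal tx ex1.
have size_dv (A C : {poly {poly k}}) : A * C != 0 -> (size A <= size (A * C)%R)%N.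
  rewrite mulf_eq0 negb_or => /andP [A0 C0]; rewrite size_mul //.
  by move: A0 C0; rewrite -!size_poly_gt0; move: (size A) (size C) => u v; lia.
exists P; split=> //.
- have [S eS] := dv _ P1xy; rewrite eS in P1nz sP1.
  exact: leq_trans (size_dv _ _ P1nz) sP1.
- have [|S eS] := dv (swapXY P2); first by rewrite ev2_swap.
  rewrite sizeYE; have eP2 : P2 = swapXY P * swapXY S by have := congr1 swapXY eS; rewrite swapXYK rmorphM.
  rewrite eP2 in P2nz sP2; exact: leq_trans (size_dv _ _ P2nz) sP2.
Qed.

End RationalFunctions.

(** * Degrees over k(z^n) and over k(xy) *)

Section DegreeInequalities.
Variables (k K : fieldType) (i : {rmorphism k -> K}).
Implicit Types (f g : {poly k}) (P G : {poly {poly k}}) (x y z w : K) (F : K -> Prop).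

Lemma ev_comp_Xn x f n : ev i x (f \Po 'X^n) = ev i (x ^+ n) f.
Proof. by rewrite /ev map_comp_poly map_polyXn horner_comp hornerXn. Qed.

Lemma ev_poly x n (E : nat -> k) :
  ev i x (\poly_(j < n) E j) = \sum_(j < n) i (E j) * x ^+ j.
Proof.
rewrite /ev (@horner_coef_wide _ n) ?size_map_poly ?size_poly //.
by apply: eq_bigr => j _; rewrite coef_map coef_poly ltn_ord.
Qed.

Lemma transcendental_pow x n : (0 < n)%N -> transcendental i x -> transcendental i (x ^+ n).
Proof.
move=> n0 tx f; rewrite -ev_comp_Xn => /tx h; apply/polyP => j; rewrite coef0.
by have := coef_comp_poly_Xn f (n * j) n0; rewrite h coef0 dvdn_mulr // mulKn // => <-.
Qed.

(** Independence of 1, z, ..., z^(n-1): without denominators, a dependence is an identity sum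
    f_l(X^n) X^l = 0, in which the exponents of different l lie in different classes modulo n. *)
Lemma fdegree_pow z n : (0 < n)%N -> transcendental i z ->
  fdegree (ratf i (z ^+ n)) (ratf i z) n.
Proof.
move=> n0 tz; have hE := ratf_subfield i (z ^+ n).
pose p := 'X^n - (z ^+ n)%:P.
have sp : size p = n.+1 by rewrite size_XnsubC.
have p0 : p != 0 by rewrite -size_poly_eq0 sp.
have Ep : coefs_in (ratf i (z ^+ n)) p.
  move=> j; rewrite coefB coefXn coefC; apply: (subfieldB hE).
    by case: (_ == _); [exact: subfield1 hE|exact: subfield0 hE].
  by case: (_ == _); [exact: ratf_gen|exact: subfield0 hE].
have pz : p.[z] = 0 by rewrite hornerD hornerN hornerXn hornerC subrr.
have hA : subfield (adjoin (ratf i (z ^+ n)) z).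
  by apply: adjoin_subfield => //; exists p.
have Ez : ratf i z (z ^+ n) by apply: (subfieldX (ratf_subfield i z)); apply: ratf_gen.
exists (fun j : 'I_n => z ^+ j); split=> [j|c Ec h j|w rw].
- by apply: (subfieldX (ratf_subfield i z)); apply: ratf_gen.
- have [g [g0 [f hf]]] := ratf_common Ec.
  suff f0 : f j = 0 by rewrite hf f0 ev0 mul0r.
  have : \sum_(l < n) (f l \Po 'X^n) * 'X^l = 0.
    apply: tz; transitivity (ev i (z ^+ n) g * \sum_l c l * z ^+ l); last by rewrite h mulr0.
    rewrite (big_morph _ (evD i z) (ev0 i z)) mulr_sumr; apply: eq_bigr => l _.
    rewrite evM ev_comp_Xn hf mulrA [ev i _ g * _]mulrC divfK //.
    by congr (_ * _); rewrite /ev map_polyXn hornerXn.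
  move=> h0; apply/polyP => m; rewrite coef0.
  have := congr1 (fun r : {poly k} => r`_(n * m + j)) h0.
  rewrite coef0 coef_sum (bigD1 j) //= coefMXn ltnNge leq_addl /= addnK.
  rewrite coef_comp_poly_Xn // dvdn_mulr // mulKn // big1 ?addr0 // => l nlj.
  rewrite coefMXn; case: ltnP => // le; rewrite coef_comp_poly_Xn //.
  case: ifP => // dv; case/negP: nlj; apply/eqP/val_inj => /=.
  have : n * m + j = l %[mod n].
    by apply/eqP; rewrite eqn_mod_dvd.
  by rewrite mulnC modnMDl !modn_small.
- apply: (adjoin_span hE p0 Ep pz); rewrite ?sp //.
  apply: ratf_min rw => //; last exact: adjoin_gen.
  by move=> c; apply: adjoin_base => //; apply: ratf_const.
Qed.

Lemma fdegree_split E F L n : subfield E -> subfield F -> subfield L ->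
  (forall z, E z -> F z) -> (forall z, F z -> L z) -> fdegree E L n ->
  exists a b, [/\ fdegree E F a, fdegree F L b & n = (a * b)%N].
Proof.
move=> hE hF hL EF FL d; have fin : ffinite E L.
  by case: d => b [_ _ sp]; apply: span_ffinite sp.
have [a _ da] := ffinite_fdegree hE EF hF (ffinite_sub fin FL).
have [b _ db] := ffinite_fdegree hF FL hL (ffinite_base fin EF).
exists a, b; split=> //; apply: (fdegree_unique hE d).
exact: fdegree_tower EF FL hL da db.
Qed.

(** Source of the subadditivity of the degree norm. In L = k(x, y) there is a relation of degree at
    most a' in Y and b' in X. Substituting y = z / x with z = xy gives an equation of degree at most
    a' + b' for x over k(z), and L = k(z)(x). *)
Lemma fdegree_mul_gen x y F a b c :
  transcendental i x -> transcendental i y -> transcendental i (x * y) ->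
  subfield F -> (forall c, F (i c)) -> F x -> F y ->
  fdegree (ratf i x) F a -> fdegree (ratf i y) F b -> fdegree (ratf i (x * y)) F c ->
  (c <= a + b)%N.
Proof.
move=> tx ty txy hF Fi Fx Fy da db dc.
have nz0 z : transcendental i z -> z != 0.
  move=> tz; apply/eqP => z0; have /tz /eqP : ev i z 'X = 0 by rewrite evX.
  by rewrite polyX_eq0.
pose L := adjoin (ratf i x) y.
have rF z : F z -> forall w, ratf i z w -> F w by move=> Fz; apply: ratf_min.
have hx := ratf_subfield i x.
have ay : algebraic_over (ratf i x) y.
  have [P [P0 _ h]] := fdegree_relation hF da Fy; exact: relation_algebraic tx P0 h.
have hL : subfield L by apply: adjoin_subfield.
have LF z : L z -> F z by apply: adjoin_min => //; apply: rF.
have Lbase z : ratf i x z -> L z by apply: adjoin_base.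
have Lx : L x by apply: Lbase; apply: ratf_gen.
have Ly : L y by apply: adjoin_gen.
have Li e : L (i e) by apply: Lbase; apply: ratf_const.
have rL z : L z -> forall w, ratf i z w -> L w by move=> Lz; apply: ratf_min.
have Lxy : L (x * y) by apply: (subfieldM hL).
have [a' [m [da' dm ->]]] := fdegree_split hx hL hF (rL _ Lx) LF da.
have [b' [m2 [db' dm2 ->]]] := fdegree_split (ratf_subfield i y) hL hF (rL _ Ly) LF db.
have [c' [m3 [dc' dm3 ->]]] := fdegree_split (ratf_subfield i _) hL hF (rL _ Lxy) LF dc.
(* All three degrees are multiples of [F : L], which is cancelled. *)
rewrite (fdegree_unique hL dm2 dm) (fdegree_unique hL dm3 dm) -mulnDl leq_mul2r.
apply/orP; right => {da db dc dm dm2 dm3 m m2 m3}.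
have [P [P0 sP sYP Pxy]] := relation_bidegree tx ty hL da' db' Lx Ly.
pose z := x * y; have hz := ratf_subfield i z.
(* This is X^a' P(X, z / X). *)
pose q := \sum_(j < a'.+1) (z ^+ j) *: ('X^(a' - j) * map_poly i P`_j).
have coefq e : q`_e = ev i z (\poly_(j < a'.+1) (if (e < a' - j)%N then 0 else P`_j`_(e - (a' - j)))).
  rewrite coef_sum ev_poly; apply: eq_bigr => j _.
  rewrite coefZ coefXnM coef_map mulrC; congr (_ * _).
  by case: ifP => _; rewrite ?rmorph0.
have Eq : coefs_in (ratf i z) q by move=> e; rewrite coefq; apply: ratf_ev.
(* As [z] is transcendental, its powers keep the coefficients of [P] apart. *)
have q0 : q != 0.
  apply: contra_neq P0 => q0; apply/polyP => j; rewrite coef0.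
  have [lt|le] := ltnP j a'.+1; last by rewrite nth_default // (leq_trans sP).
  apply/polyP => e; rewrite coef0; have := coefq (e + (a' - j))%N.
  rewrite q0 coef0 => /esym /txy /polyP /(_ j).
  by rewrite coef0 coef_poly lt ltnNge leq_addl /= addnK.
have qx : q.[x] = 0.
  transitivity (x ^+ a' * ev2 i x y P); last by rewrite Pxy mulr0.
  rewrite horner_sum ev2_sum.
  rewrite (big_ord_widen a'.+1 (fun j => ev i x P`_j * y ^+ j)) //.
  rewrite mulr_sumr.
  rewrite [RHS]big_mkcond /=; apply: eq_bigr => j _.
  rewrite hornerZ hornerM hornerXn -/(ev i x _); case: ltnP => [_|le]; last first.
    by rewrite nth_default // ev0 !mulr0.
  have -> : x ^+ a' = x ^+ j * x ^+ (a' - j) by rewrite -exprD subnKC ?leq_ord.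
  rewrite /z exprMn; ring.
have sq : (size q <= (a' + b').+1)%N.
  apply: (leq_trans (size_sum _ _ _)); apply/bigmax_leqP => j _.
  apply: (leq_trans (size_scale_leq _ _)); apply: (leq_trans (size_polyMleq _ _)).
  rewrite size_polyXn size_map_poly; have := leq_trans (max_size_coefXY P j) sYP.
  by move: (size _) => u; have := leq_ord j; lia.
apply: (@adjoin_degree_le _ (ratf i z) x q) => //.
have eqL w : L w <-> adjoin (ratf i z) x w.
  have az : algebraic_over (ratf i z) x by exists q.
  have hA := adjoin_subfield hz az.
  split.
    apply: adjoin_min => //.
    - apply: ratf_min => // [e|]; last exact: adjoin_gen.
      by apply: adjoin_base => //; apply: ratf_const.
    - have -> : y = z / x by rewrite /z mulrC mulKf // nz0.
      apply: (subfield_div hA); last exact: adjoin_gen.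
      by apply: adjoin_base => //; apply: ratf_gen.
  by apply: adjoin_min => //; apply: rL.
case: dc' => u [Lu iu su]; exists u; split=> // [l|w /eqL /su //]; exact/eqL.
Qed.

End DegreeInequalities.

(** * Logarithmic derivatives *)

Section Euler.
Variable R : comNzRingType.
Implicit Types p q : {poly R}.

Definition euler p := p^`() * 'X.

Lemma coef_euler p j : (euler p)`_j = p`_j *+ j.
Proof. by rewrite coefMX coef_deriv; case: j. Qed.

Lemma eulerD p q : euler (p + q) = euler p + euler q.
Proof. by rewrite /euler derivD mulrDl. Qed.

Lemma euler0 : euler 0 = 0.
Proof. by rewrite /euler deriv0 mul0r. Qed.

Lemma eulerM p q : euler (p * q) = euler p * q + p * euler q.
Proof. by rewrite /euler derivM; ring. Qed.

Lemma size_euler p : (size (euler p) <= size p)%N.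
Proof. by apply/leq_sizeP => j le; rewrite coef_euler nth_default ?mul0rn. Qed.
End Euler.

Section LogarithmicRatio.
Variables (k K : fieldType) (i : {rmorphism k -> K}).
Hypothesis char0 : forall n, (0 < n)%N -> n%:R != 0 :> k.
Implicit Types (f g : {poly k}) (P G S : {poly {poly k}}) (x y z w : K) (F : K -> Prop).

(* [euler] is Y d/dY and [eulerX] is X d/dX on polynomials in Y over k[X]. *)
Definition eulerX P := map_poly (@euler k) P.

Lemma coef_eulerX P j : (eulerX P)`_j = euler P`_j.
Proof. by rewrite coef_map_id0 ?euler0. Qed.

Lemma eulerXM P G : eulerX (P * G) = eulerX P * G + P * eulerX G.
Proof.
apply/polyP => j; rewrite coef_eulerX coefD !coefM -big_split.
rewrite (big_morph _ (@eulerD _) (@euler0 _)); apply: eq_bigr => l _.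
by rewrite /= eulerM !coef_eulerX.
Qed.

Definition principal_relation x y P := [/\ P != 0, ev2 i x y P = 0 &
  forall G, ev2 i x y G = 0 -> exists S : {poly {poly k}}, G = P * S].

(** Separability: the derivative in Y has smaller degree, so a multiple of [P] only if it is 0. In
    characteristic 0 the relation [P] would then involve the transcendental [x] alone. *)
Lemma principal_euler x y P : transcendental i x -> y != 0 ->
  principal_relation x y P -> ev2 i x y (euler P) != 0.
Proof.
move=> tx y0 [P0 Pxy dv]; rewrite ev2M ev2X mulf_neq0 //.
apply/eqP => /dv [S eS].
have P'0 : P^`() = 0.
  apply/eqP; rewrite eS mulf_eq0 (negPf P0) /=; apply/negP => /negP S0.
  have := lt_size_deriv P0; rewrite eS size_mul //.
  by move: S0; rewrite -size_poly_gt0; move: (size S) (size P) => u v; lia.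
have sP : (size P <= 1)%N.
  apply/leq_sizeP => -[//|j] _; have := congr1 (fun r : {poly {poly k}} => r`_j) P'0.
  rewrite coef_deriv coef0 => h; apply/polyP => l; rewrite coef0.
  have := congr1 (fun r : {poly k} => r`_l) h; rewrite coefMn coef0 -mulr_natr.
  by move/eqP; rewrite mulf_eq0 (negPf (char0 _)) // orbF => /eqP.
move: Pxy P0; rewrite (size1_polyC sP) ev2C => /tx ->.
by rewrite polyC0 eqxx.
Qed.

(** The polynomial P(X^n, Y^n). *)
Definition comp_pow n P := (map_poly (comp_poly 'X^n) P) \Po 'X^n.

Lemma coef_comp_pow n P j l : (0 < n)%N -> (comp_pow n P)`_j`_l =
  if (n %| j)%N && (n %| l)%N then P`_(j %/ n)`_(l %/ n) else 0.
Proof.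
move=> n0; rewrite coef_comp_poly_Xn //; case: ifP => //= _; last by rewrite coef0.
by rewrite coef_map_id0 ?comp_poly0 // coef_comp_poly_Xn.
Qed.

Lemma ev2_comp_pow n P x y : ev2 i x y (comp_pow n P) = ev2 i (x ^+ n) (y ^+ n) P.
Proof.
rewrite /ev2 /comp_pow (map_comp_poly (ev_morph i x)) (map_polyXn (ev_morph i x)).
rewrite horner_comp hornerXn -(map_poly_comp_id0 _ _ (ev0 i x)); congr _.[_].
by apply: eq_map_poly => f /=; apply: ev_comp_Xn.
Qed.

Lemma euler_comp_pow n P : (0 < n)%N -> euler (comp_pow n P) = comp_pow n (euler P) *+ n.
Proof.
move=> n0; apply/polyP => j; apply/polyP => l.
rewrite coef_euler !coefMn !coef_comp_pow // coef_euler coefMn; case: ifP => [/andP [/dvdnP [m ->] _]|_].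
  by rewrite mulnK // mulrnA.
by rewrite !mul0rn.
Qed.

Lemma eulerX_comp_pow n P : (0 < n)%N -> eulerX (comp_pow n P) = comp_pow n (eulerX P) *+ n.
Proof.
move=> n0; apply/polyP => j; apply/polyP => l.
rewrite coef_eulerX !coefMn coef_euler !coef_comp_pow // coef_eulerX coef_euler.
case: ifP => [/andP [_ /dvdnP [m ->]]|_]; last by rewrite !mul0rn.
by rewrite mulnK // mulrnA.
Qed.

(** Expresses r = dlog y / dlog x without differentials: G(x, y) = 0 gives x G_X(x, y) dlog x + y
    G_Y(x, y) dlog y = 0. *)
Definition log_ratio x y r := forall G, ev2 i x y G = 0 ->
  ev2 i x y (eulerX G) + r * ev2 i x y (euler G) = 0.

Lemma log_ratio_exists x y P : transcendental i x -> y != 0 ->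
  principal_relation x y P -> exists r, log_ratio x y r.
Proof.
move=> tx y0 hP; have nz := principal_euler tx y0 hP.
case: hP => P0 Pxy dv.
exists (- ev2 i x y (eulerX P) / ev2 i x y (euler P)) => G /dv [S ->].
rewrite eulerM eulerXM !ev2D !ev2M Pxy; field.
by move: nz; rewrite ev2M mulf_eq0 negb_or andbC.
Qed.

Lemma ev2_closed F x y P : subfield F -> (forall c, F (i c)) -> F x -> F y -> F (ev2 i x y P).
Proof.
move=> hF Fi Fx Fy; rewrite ev2_sum; apply: (subfield_sum hF) => j.
by apply: (subfieldM hF); [apply: ev_closed | apply: (subfieldX hF)].
Qed.

(** Both logarithmic derivatives of P(X^n, Y^n) acquire the same factor n, so that [r] is a quotient
    of two values at (x^n, y^n). *)
Lemma log_ratio_pow F x y r n : subfield F -> (forall c, F (i c)) -> (0 < n)%N ->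
  F (x ^+ n) -> F (y ^+ n) -> transcendental i x -> y != 0 ->
  (exists2 P, P != 0 & ev2 i (x ^+ n) (y ^+ n) P = 0) -> log_ratio x y r -> F r.
Proof.
move=> hF Fi n0 Fx Fy tx y0 ex hr.
have txn := transcendental_pow n0 tx.
have [P hP] := relations_principal txn ex.
have nz := principal_euler txn (expf_neq0 n y0) hP.
have [P0 Pxy dv] := hP.
have := hr (comp_pow n P); rewrite ev2_comp_pow Pxy => /(_ erefl).
have evn G m : ev2 i x y (G *+ m) = m%:R * ev2 i x y G.
  by elim: m => [|m IH]; rewrite ?mulr0n ?ev20 ?mul0r // mulrS ev2D IH mulrS; ring.
rewrite euler_comp_pow // eulerX_comp_pow // !evn !ev2_comp_pow => h.
have nK : n%:R != 0 :> K by rewrite -(rmorph_nat i) fmorph_eq0 char0.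
have -> : r = - ev2 i (x ^+ n) (y ^+ n) (eulerX P) / ev2 i (x ^+ n) (y ^+ n) (euler P).
  apply: (mulIf nz); rewrite divfK //; apply: (mulfI nK).
  by move/eqP: h; rewrite addrC addr_eq0 mulrCA => /eqP ->; rewrite mulrN.
by apply: (subfield_div hF); [apply: (subfieldN hF)|]; apply: ev2_closed.
Qed.

(* If dlog y / dlog x is a constant c, then X d/dX + c Y d/dY multiplies the
   irreducible relation by a constant, so the exponents of its monomials lie on
   a line and the relation is one between powers of a single monomial. *)
Lemma log_ratio_const x y c : transcendental i x -> y != 0 ->
  (exists2 P, P != 0 & ev2 i x y P = 0) -> log_ratio x y (i c) ->
  exists (a : int) (b : nat), (0 < b)%N /\
    exists2 f, f != 0 & ev i (x ^ a * y ^+ b) f = 0.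
Proof.
move=> tx y0 ex hr; have [P [P0 Pxy dv]] := relations_principal tx ex.
have x0 : x != 0.
  apply/eqP => x0; have /tx /eqP : ev i x 'X = 0 by rewrite evX.
  by rewrite polyX_eq0.
have [S eS] : exists S : {poly {poly k}}, eulerX P + c%:P%:P * euler P = P * S.
  by apply: dv; rewrite ev2D [ev2 _ _ _ (_%:P * _)]ev2M ev2C evC hr.
(* The left side of [eS] exceeds [P] in degree neither in X nor in Y, so the cofactor [S] is a
   constant, the eigenvalue [s]. *)
have [s es] : exists s : k, forall j l, P`_j`_l *+ l + c * (P`_j`_l *+ j) = s * P`_j`_l.
  have [S0|S0] := eqVneq S 0.
    exists 0 => j l; rewrite mul0r; have := congr1 (fun r : {poly {poly k}} => r`_j`_l) eS.
    by rewrite S0 mulr0 !coef0 coefD coefCM coefD coefCM coef_eulerX !coef_euler coefMn.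
  have sS : (size S <= 1)%N.
    have : (size (P * S)%R <= size P)%N.
      rewrite -eS (leq_trans (size_polyD _ _)) // geq_max.
      rewrite (leq_trans (size_poly _ _)) //= mul_polyC (leq_trans (size_scale_leq _ _)) //.
      exact: size_euler.
    rewrite size_mul //; move: P0; rewrite -size_poly_gt0.
    by move: (size P) (size S) => u v; lia.
  have sYS : (sizeY S <= 1)%N.
    have : (sizeY (P * S)%R <= sizeY P)%N.
      suff bnd (j : nat) : (size ((eulerX P + c%:P%:P * euler P)`_j)%R <= sizeY P)%N.
        by rewrite -eS; apply/bigmax_leqP => j _; apply: bnd.
      rewrite coefD coefCM coef_eulerX coef_euler.
      rewrite (leq_trans (size_polyD _ _)) // geq_max.
      rewrite (leq_trans (size_euler _)) ?max_size_coefXY //= mul_polyC.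
      rewrite (leq_trans (size_scale_leq _ _)) // -scaler_nat.
      by rewrite (leq_trans (size_scale_leq _ _)) // max_size_coefXY.
    rewrite !sizeYE rmorphM /= size_mul ?swapXY_eq0 //.
    have : (0 < size (swapXY P))%N by rewrite size_poly_gt0 swapXY_eq0.
    by move: (size (swapXY P)) (size (swapXY S)) => u v; lia.
  have eS0 : S = (S`_0)%:P by apply: size1_polyC.
  have eS1 : S`_0 = (S`_0`_0)%:P by apply: size1_polyC; apply: leq_trans sYS; apply: max_size_coefXY.
  exists S`_0`_0 => j l; have := congr1 (fun r : {poly {poly k}} => r`_j`_l) eS.
  have -> : P * S = (S`_0`_0)%:P%:P * P by rewrite mulrC {1}eS0 {1}eS1.
  rewrite [in RHS]coefCM [in RHS]coefCM => <-.
  by rewrite coefD coefCM coefD coefCM coef_eulerX !coef_euler coefMn.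
have line j l : P`_j`_l != 0 -> l%:R + c * j%:R = s.
  move=> nz; apply: (mulIf nz); rewrite -es -mulr_natr -[P`_j`_l *+ j]mulr_natr; ring.
have natI m n : m%:R = n%:R :> k -> m = n.
  wlog le : m n / (m <= n)%N.
    by move=> h; case: (leqP m n) => [|/ltnW] le e; [exact: h|apply/esym/h].
  move/eqP; rewrite eq_sym -subr_eq0 -natrB //; case: (posnP (n - m)) => [|pos].
    by move=> e _; lia.
  by rewrite (negPf (char0 pos)).
have uniql j l l' : P`_j`_l != 0 -> P`_j`_l' != 0 -> l = l'.
  by move=> /line h /line h'; apply: natI; apply: (addIr (c * j%:R)); rewrite h h'.
have exl j : P`_j != 0 -> exists2 l, P`_j`_l != 0 & P`_j = P`_j`_l *: 'X^l.
  move=> nz; pose l := (size P`_j).-1.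
  have nzl : P`_j`_l != 0 by rewrite -[_`_l]/(lead_coef P`_j) lead_coef_eq0.
  exists l => //; apply/polyP => l'; rewrite coefZ coefXn.
  have [->|ne] := eqVneq l' l; first by rewrite mulr1.
  by rewrite mulr0; apply: contraNeq ne => nz'; apply/eqP; apply: uniql nz' nzl.
have exj : exists j, P`_j != 0 by exists (size P).-1; rewrite -[P`__]/(lead_coef P) lead_coef_eq0.
case: (ex_minnP exj) => j0 nzj0 minj0.
have [l0 nz0 eP0] := exl _ nzj0.
have [j1 ne1 nzj1] : exists2 j, j != j0 & P`_j != 0.
  apply: contrapT => none.
  have eP : P = P`_j0 *: 'X^j0.
    apply/polyP => j; rewrite coefZ coefXn; have [->|ne] := eqVneq j j0; first by rewrite mulr1.
    by rewrite mulr0; apply: contrapT => /eqP nz; apply: none; exists j.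
  move/eqP: Pxy; rewrite eP -mul_polyC ev2M ev2C mulf_eq0 => /orP [/eqP /tx h|].
    by rewrite h eqxx in nzj0.
  rewrite /ev2 (map_polyXn (ev_morph i x)) hornerXn expf_eq0 (negPf y0).
  by rewrite andbF.
have [l1 nz1 _] := exl _ nzj1.
have lt01 : (j0 < j1)%N by rewrite ltn_neqAle eq_sym ne1 minj0.
pose a := l1%:Z - l0%:Z; pose b := (j1 - j0)%N.
have intI (m n : int) : m%:~R = n%:~R :> k -> m = n.
  move/eqP; rewrite -subr_eq0 -rmorphB /=; case: (intP (m - n)) (subr0_eq (x := m) (y := n)).
  - by move=> h _; apply: h.
  - by move=> p _; rewrite -[_%:~R]/(p.+1%:R) (negPf (char0 _)).
  - by move=> p _; rewrite rmorphN /= oppr_eq0 -[_%:~R]/(p.+1%:R) (negPf (char0 _)).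
have prop j l : P`_j`_l != 0 -> (l%:Z - l0%:Z) * b%:Z = (j%:Z - j0%:Z) * a.
  move=> nz; apply: intI; rewrite /b /a -subzn ?(ltnW lt01) //.
  have h1 := line _ _ nz; have h2 := line _ _ nz0; have h3 := line _ _ nz1.
  rewrite !rmorphM !rmorphB /= -![_%:~R]/(_%:R).
  have -> : l%:R = s - c * j%:R by rewrite -h1; ring.
  have -> : l0%:R = s - c * j0%:R by rewrite -h2; ring.
  have -> : l1%:R = s - c * j1%:R by rewrite -h3; ring.
  ring.
have b0 : (0 < b)%N by rewrite subn_gt0.
pose g := gcdz a b%:Z.
have g0 : g != 0 by rewrite gcdz_eq0 negb_and orbC -lt0n b0.
have [a' ea] : exists a', a = a' * g by exists (a %/ g)%Z; rewrite divzK ?dvdz_gcdl.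
have [b' eb] : exists b', b%:Z = b' * g by exists (b%:Z %/ g)%Z; rewrite divzK ?dvdz_gcdr.
have g_ge0 : 0 <= g by rewrite /g.
have b'pos : 0 < b'.
  have : 0 < b%:Z by [].
  by rewrite eb pmulr_lgt0 // lt_def g0.
have [u [v uv]] := Bezoutz a b%:Z; rewrite -/g in uv.
(* The direction (a', b') of the line is primitive, so Bezout's identity makes the parameter [m] an
   integer; it is not negative since j0 is least and b' > 0. *)
have expo j l : P`_j`_l != 0 -> exists m : nat, (j = j0 + m * `|b'|)%N /\ l%:Z = l0%:Z + m%:Z * a'.
  move=> nz; have h := prop _ _ nz.
  have jj : (j0 <= j)%N by apply: minj0; apply: contra_neq nz => ->; rewrite coef0.
  pose m := u * (l%:Z - l0%:Z) + v * (j%:Z - j0%:Z).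
  have mb : m * b' = j%:Z - j0%:Z.
    apply: (mulIf g0); rewrite -mulrA -eb -uv /m.
    transitivity (u * ((l%:Z - l0%:Z) * b%:Z) + v * (j%:Z - j0%:Z) * b%:Z); first ring.
    rewrite h; ring.
  have ma : m * a' = l%:Z - l0%:Z.
    apply: (mulIf g0); rewrite -mulrA -ea -uv /m.
    transitivity (u * (l%:Z - l0%:Z) * a + v * ((j%:Z - j0%:Z) * a)); first ring.
    rewrite -h; ring.
  have m0 : 0 <= m by rewrite -(pmulr_lge0 _ b'pos) mb subr_ge0 lez_nat.
  exists `|m|%N; rewrite gez0_abs // ma; split; last by ring.
  have emb : (`|m| * `|b'|)%N%:Z = j%:Z - j0%:Z.
    by rewrite PoszM (gez0_abs m0) (gez0_abs (ltW b'pos)) -mb.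
  by move: emb; move: (`|m| * _)%N => w; lia.
have b'0 : (0 < `|b'|)%N by rewrite absz_gt0 (gt_eqF b'pos).
pose e j := ((j - j0) %/ `|b'|)%N.
pose f := \sum_(j < size P) (P`_j).[1] *: 'X^(e j).
exists a', `|b'|%N; split=> //.
have suppf j : P`_j != 0 -> exists l m, [/\ P`_j = P`_j`_l *: 'X^l, e j = m,
     (j = j0 + m * `|b'|)%N & l%:Z = l0%:Z + m%:Z * a'].
  move=> nz; have [l nzl el] := exl _ nz; have [m [ej eqal]] := expo _ _ nzl.
  by exists l, m; split=> //; rewrite /e ej addKn mulnK.
exists f.
  have lt0 : (j0 < size P)%N by rewrite ltnNge; apply: contra_neqN nzj0 => le; rewrite nth_default.
  apply: contra_neq nz0 => /(congr1 (fun r : {poly k} => r`_0)).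
  rewrite coef0 coef_sum (bigD1 (Ordinal lt0)) //= big1 ?addr0.
    by rewrite coefZ coefXn /e subnn div0n eqxx mulr1 eP0 hornerZ hornerXn expr1n mulr1 coefZ coefXn eqxx mulr1.
  move=> j ne; rewrite coefZ coefXn; have [->|nz] := eqVneq P`_j 0; first by rewrite horner0 mul0r.
  have [l [m [_ em ej _]]] := suppf _ nz.
  rewrite em; case: m em ej => [|m] em ej; last by rewrite mulr0.
  by case/eqP: ne; apply: val_inj; rewrite /= ej mul0n addn0.
pose t := x ^ a' * y ^+ `|b'|.
have nzm : x ^+ l0 * y ^+ j0 != 0 by rewrite mulf_neq0 // expf_neq0.
apply: (mulfI nzm); rewrite mulr0 -Pxy ev2_sum (big_morph _ (evD i t) (ev0 i t)) mulr_sumr.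
apply: eq_bigr => j _; rewrite -mul_polyC evM evC.
have [->|nz] := eqVneq P`_j 0; first by rewrite ev0 horner0 rmorph0 !(mul0r, mulr0).
have [l [m [-> -> ej el]]] := suppf _ nz; rewrite hornerZ hornerXn expr1n mulr1.
have evXn z n : ev i z 'X^n = z ^+ n by rewrite /ev map_polyXn hornerXn.
rewrite -mul_polyC evM evC !evXn [X in _ = _ * y ^+ X]ej exprD exprMn.
have -> : x ^+ l = x ^+ l0 * (x ^ a') ^+ m.
  by rewrite [(_ ^ a') ^+ m]exprnP [x ^+ l0]exprnP exprz_exp [a' * _]mulrC -expfzDr // -el.
by rewrite -exprM [(_ * m)%N]mulnC; ring.
Qed.
End LogarithmicRatio.

(** * The field of constants and the transcendence of the logarithmic ratio *)

Section AlgebraicElements.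
Variables (k K : fieldType) (i : {rmorphism k -> K}).

Definition algebraic_elements : {pred K} := fun z => `[< algebraicOver i z >].

Lemma algebraic_elementsE z : z \in algebraic_elements = `[< algebraicOver i z >].
Proof. by []. Qed.

Fact algebraic_elements_closed : divring_closed algebraic_elements.
Proof.
split=> [|x y|x y]; rewrite !algebraic_elementsE.
- by apply/asboolP; apply: algebraic1.
- by move=> /asboolP ax /asboolP ay; apply/asboolP; apply: algebraic_sub.
- by move=> /asboolP ax /asboolP ay; apply/asboolP; apply: algebraic_div.
Qed.
HB.instance Definition _ := GRing.isDivringClosed.Build K algebraic_elements algebraic_elements_closed.

(** A logarithmic ratio algebraic over k need not lie in k, so [log_ratio_const] is applied over
    this field instead. Transcendence over k and over this field agree. *)
Definition constant_field : Type := {z : K | z \in algebraic_elements}.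
HB.instance Definition _ := SubChoice.copy constant_field {z : K | z \in algebraic_elements}.
HB.instance Definition _ := [SubChoice_isSubIntegralDomain of constant_field by <:].
HB.instance Definition _ := [SubIntegralDomain_isSubField of constant_field by <:].

(** The default 0 never occurs, as [i c] is algebraic over k. *)
Definition to_constant (c : k) : constant_field := insubd 0 (i c).

Lemma val_to_constant c : val (to_constant c) = i c.
Proof. by rewrite val_insubd algebraic_elementsE asboolT //; apply: algebraic_id. Qed.

Lemma to_constant0 : to_constant 0 = 0.
Proof. by apply: val_inj; rewrite val_to_constant !rmorph0. Qed.

Definition lift2 (P : {poly {poly k}}) : {poly {poly constant_field}} :=
  map_poly (map_poly to_constant) P.

Lemma coef_lift2 P j l : (lift2 P)`_j`_l = to_constant P`_j`_l.
Proof. by rewrite !coef_map_id0 ?to_constant0 ?map_poly0. Qed.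

Let v : {rmorphism constant_field -> K} := val.

Lemma ev2_lift2 P x y : ev2 v x y (lift2 P) = ev2 i x y P.
Proof.
rewrite /ev2 /lift2 -(map_poly_comp_id0 _ _ (ev0 v x)); congr _.[_].
apply: eq_map_poly => f; rewrite /= /ev -(map_poly_comp_id0 _ _ (rmorph0 v)).
by congr _.[_]; apply: eq_map_poly => c; apply: val_to_constant.
Qed.

Lemma lift2_eq0 P : (lift2 P == 0) = (P == 0).
Proof.
apply/idP/idP => [/eqP h|/eqP ->]; last by rewrite /lift2 map_poly0.
apply/eqP/polyP => j; apply/polyP => l; rewrite !coef0; apply/eqP.
have := congr1 (fun r : {poly {poly constant_field}} => val r`_j`_l) h.
by rewrite coef_lift2 val_to_constant !coef0 rmorph0 => /eqP; rewrite fmorph_eq0.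
Qed.

Lemma to_constantMn c n : to_constant (c *+ n) = to_constant c *+ n.
Proof. by apply: val_inj; rewrite val_to_constant !rmorphMn /= val_to_constant. Qed.

Lemma euler_lift2 P : euler (lift2 P) = lift2 (euler P).
Proof.
apply/polyP => j; apply/polyP => l.
by rewrite coef_lift2 !coef_euler !coefMn coef_lift2 to_constantMn.
Qed.

Lemma eulerX_lift2 P : eulerX (lift2 P) = lift2 (eulerX P).
Proof.
apply/polyP => j; apply/polyP => l.
by rewrite coef_lift2 !coef_eulerX !coef_euler coef_lift2 to_constantMn.
Qed.

Lemma transcendental_nalg x : transcendental i x <-> ~ algebraicOver i x.
Proof.
split=> [tx [p p0 /rootP h]|na f h].
  by move/eqP: p0; apply; apply: tx.
by apply: contrapT => /eqP f0; apply: na; exists f => //; apply/rootP.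
Qed.

Lemma transcendental_constant x : transcendental i x -> transcendental v x.
Proof.
move=> /transcendental_nalg na f h; apply: contrapT => /eqP f0; apply: na.
apply/integral_algebraic; apply: (@integral_root _ _ i (map_poly v f)).
- by rewrite map_poly_eq0.
- exact/rootP.
move=> c /(nthP 0) [j _ <-]; rewrite coef_map; apply/integral_algebraic.
by have := valP f`_j; rewrite algebraic_elementsE => /asboolP.
Qed.

Hypothesis char0 : forall n, (0 < n)%N -> n%:R != 0 :> k.

Lemma transcendental_log_ratio x y : transcendental i x -> y != 0 ->
  (exists2 P, P != 0 & ev2 i x y P = 0) ->
  (forall (a : int) (b : nat), (0 < b)%N -> transcendental i (x ^ a * y ^+ b)) ->
  exists2 r, log_ratio i x y r & transcendental i r.
Proof.
move=> tx y0 [P P0 Pxy] indep_xy; have tvx := transcendental_constant tx.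
have char0v n : (0 < n)%N -> n%:R != 0 :> constant_field.
  move=> n0; rewrite -(fmorph_eq0 v) rmorph_nat -(rmorph_nat i) fmorph_eq0; exact: char0.
have exv : exists2 P, P != 0 & ev2 v x y P = 0.
  by exists (lift2 P); rewrite ?lift2_eq0 // ev2_lift2.
have [Pv hPv] := relations_principal tvx exv.
have [r hr] := log_ratio_exists char0v tvx y0 hPv.
exists r.
  by move=> G Gxy; rewrite -!ev2_lift2 -euler_lift2 -eulerX_lift2; apply: hr; rewrite ev2_lift2.
apply/transcendental_nalg => ar.
have ar' : r \in algebraic_elements by rewrite algebraic_elementsE; apply/asboolP.
pose c : constant_field := Sub r ar'.
have [a [b [b0 [f f0 hf]]]] := @log_ratio_const _ _ v char0v x y c tvx y0 exv hr.
have := transcendental_constant (indep_xy a b b0) hf.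
by move=> e; rewrite e eqxx in f0.
Qed.

End AlgebraicElements.

(** * The degree norm on Z^s *)

Section DegreeNorm.
Variables (s : nat) (K : fieldType) (i : {rmorphism rat -> K}).
Variable chi : 'rV[int]_s -> K.
Local Notation V := 'rV[int]_s.
Hypothesis chiD : forall u v, chi (u + v) = chi u * chi v.
Hypothesis chi_transc : forall v, v != 0 -> transcendental i (chi v).
Hypothesis chi_dep : forall v w, v != 0 ->
  exists2 P, P != 0 & ev2 i (chi v) (chi w) P = 0.
Hypothesis chi_gen : forall F : K -> Prop, subfield F -> (forall v, F (chi v)) ->
  forall z, F z.
Hypothesis chi0 : chi 0 = 1.
Hypothesis s_gt1 : (1 < s)%N.

Implicit Types (C : 'M[int]_s) (F : K -> Prop) (l : seq (int * V)) (z w : K).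

Lemma chi_neq0 v : chi v != 0.
Proof.
apply/eqP => h; have := chiD v (- v); rewrite subrr chi0 h mul0r => /eqP.
by rewrite oner_eq0.
Qed.

Lemma chiN v : chi (- v) = (chi v)^-1.
Proof.
apply: (mulfI (chi_neq0 v)); rewrite -chiD subrr chi0 divff //; exact: chi_neq0.
Qed.

Lemma chiMn v n : chi (v *+ n) = chi v ^+ n.
Proof. by elim: n => [|n IH]; rewrite ?mulr0n ?chi0 ?expr0 // mulrS chiD IH exprS. Qed.

Lemma chiZ (a : int) v : chi (a *: v) = chi v ^ a.
Proof.
have e m : chi (Posz m *: v) = chi v ^+ m by rewrite -natz scaler_nat chiMn.
by case: a => n; [exact: e | rewrite NegzE scaleNr chiN e exprnN].
Qed.

Lemma subfield_rat F c : subfield F -> F (i c).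
Proof.
move=> hF; have Fn n : F n%:R.
  elim: n => [|n IH]; first exact: subfield0 hF.
  by rewrite mulrS; apply: (subfieldD hF) => //; apply: subfield1 hF.
have Fz (n : int) : F n%:~R.
  case: n => n; first exact: Fn.
  by rewrite NegzE mulrNz; apply: (subfieldN hF); apply: Fn.
rewrite -[c]divq_num_den fmorph_div !rmorph_int; exact: (subfield_div hF).
Qed.

(* [l] is an element of the integral group ring of Z^s, and [evl C] its image
   under v |-> chi (v C). *)
Definition evl C l : K := \sum_(p <- l) p.1%:~R * chi (p.2 *m C).

Definition mul_formal l l' : seq (int * V) :=
  [seq (p.1 * q.1, p.2 + q.2) | p <- l, q <- l'].

Definition opp_formal l : seq (int * V) := [seq (- p.1, p.2) | p <- l].

Lemma evlM C l l' : evl C (mul_formal l l') = evl C l * evl C l'.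
Proof.
rewrite /evl big_allpairs_dep mulr_suml; apply: eq_bigr => p _.
rewrite mulr_sumr; apply: eq_bigr => q _ /=.
by rewrite intrM mulmxDl chiD; ring.
Qed.

Lemma evl_cat C l l' : evl C (l ++ l') = evl C l + evl C l'.
Proof. exact: big_cat. Qed.

Lemma evl_opp C l : evl C (opp_formal l) = - evl C l.
Proof.
by rewrite /evl big_map -sumrN; apply: eq_bigr => p _; rewrite /= mulrNz mulNr.
Qed.

Lemma evl1 C n v : evl C [:: (n, v)] = n%:~R * chi (v *m C).
Proof. by rewrite /evl big_seq1. Qed.

Lemma evl_one C : evl C [:: (1, 0)] = 1.
Proof. by rewrite evl1 mul0mx chi0 mulr1. Qed.

Definition chi_field C z := exists l l', z = evl C l / evl C l'.

Lemma chi_field_nz C z : chi_field C z ->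
  exists l l', evl C l' != 0 /\ z = evl C l / evl C l'.
Proof.
case=> l [l' ->]; have [->|nz] := eqVneq (evl C l') 0; last by exists l, l'.
by exists [::], [:: (1, 0)]; rewrite evl_one oner_neq0 {2}/evl big_nil invr0 mulr0 mul0r.
Qed.

Lemma chi_field_subfield C : subfield (chi_field C).
Proof.
split=> [|z w /chi_field_nz [a [b [b0 ->]]] /chi_field_nz [c [d [d0 ->]]]|z w [a [b ->]] [c [d ->]]].
- by exists [:: (1, 0)], [:: (1, 0)]; rewrite evl_one divr1.
- exists (mul_formal a d ++ opp_formal (mul_formal c b)), (mul_formal b d).
  rewrite evl_cat evl_opp !evlM; field; by rewrite b0 d0.
- by exists (mul_formal a d), (mul_formal b c); rewrite !evlM !invfM invrK; ring.
Qed.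

Lemma chi_field_gen C v : chi_field C (chi (v *m C)).
Proof. by exists [:: (1, v)], [:: (1, 0)]; rewrite evl_one evl1 mul1r divr1. Qed.

Lemma subfield_int F (n : int) : subfield F -> F n%:~R.
Proof. by move=> hF; rewrite -(rmorph_int i); apply: subfield_rat. Qed.

Lemma chi_field_min C F : subfield F -> (forall v, F (chi (v *m C))) ->
  forall z, chi_field C z -> F z.
Proof.
move=> hF h z [l [l' ->]]; have Fl a : F (evl C a).
  by apply: (subfield_sum hF) => p; apply: (subfieldM hF) => //; apply: subfield_int.
exact: (subfield_div hF).
Qed.

Lemma chi_ratf F v : subfield F -> F (chi v) -> forall z, ratf i (chi v) z -> F z.
Proof. by move=> hF Fv; apply: ratf_min => // c; apply: subfield_rat. Qed.

Definition topK z := True.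
Lemma topK_subfield : subfield topK. Proof. by []. Qed.

Lemma adjoin_seq E (r : seq K) : subfield E -> (forall z, z \in r -> algebraic_over E z) ->
  exists F, [/\ subfield F, forall z, E z -> F z, forall z, z \in r -> F z & ffinite E F].
Proof.
move=> hE; elim: r => [|a r IH] alg.
  exists E; split=> //; apply: (@span_ffinite _ _ _ 'I_1 (fun=> 1)) => // z Ez.
  by exists (fun=> z); split=> //; rewrite big_ord1 mulr1.
have [|F [hF EF rF fF]] := IH; first by move=> z zr; apply: alg; rewrite inE zr orbT.
have aF : algebraic_over F a.
  have [p [p0 Ep pa]] := alg a (mem_head _ _); exists p; split=> // j; exact: EF.
have hA := adjoin_subfield hF aF.
have FA z : F z -> adjoin F a z by apply: adjoin_base.
exists (adjoin F a); split=> // [z Ez|z|]; first by apply: FA; apply: EF.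
  rewrite inE => /orP [/eqP ->|/rF]; [exact: adjoin_gen|exact: FA].
by apply: (ffinite_trans hE hF hA EF FA fF); apply: adjoin_ffinite.
Qed.

Lemma chi_span F : subfield F -> (forall j, F (chi (delta_mx 0 j))) -> forall v, F (chi v).
Proof.
move=> hF h v; rewrite [v]row_sum_delta.
apply: (big_ind (fun u => F (chi u))) => [|u w Fu Fw|j _].
- by rewrite chi0; apply: subfield1 hF.
- by rewrite chiD; apply: (subfieldM hF).
rewrite chiZ; case: (v 0 j) => n; first exact: (subfieldX hF).
by rewrite NegzE -exprnN; apply: (subfieldV hF); apply: (subfieldX hF).
Qed.

Lemma ffinite_chi v : v != 0 -> ffinite (ratf i (chi v)) topK.
Proof.
move=> v0; have hE := ratf_subfield i (chi v).
have [|F [hF EF rF fF]] := @adjoin_seq _ [seq chi (delta_mx 0 j) | j : 'I_s] hE.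
  move=> z /mapP [j _ ->]; have [P P0 h] := chi_dep (delta_mx 0 j) v0.
  exact: relation_algebraic (chi_transc v0) P0 h.
apply: ffinite_sub fF _ => z _; apply: chi_gen => // w; apply: chi_span => // j.
by apply: rF; apply: map_f; rewrite mem_enum.
Qed.

Lemma fdegree_top E : subfield E -> ffinite E topK -> exists2 n, (0 < n)%N & fdegree E topK n.
Proof. by move=> hE; apply: ffinite_fdegree. Qed.

Lemma ex_nonzero : exists v : V, v != 0.
Proof.
have s0 : (0 < s)%N by apply: ltn_trans s_gt1.
exists (delta_mx 0 (Ordinal s0)); apply/eqP => /rowP /(_ (Ordinal s0)).
by rewrite !mxE !eqxx.
Qed.

(** Transcendence degree one: a relation between x = chi v and z, read the other way, makes x
    algebraic over Q(z), and K is finite over Q(x). *)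
Lemma ffinite_transc z : transcendental i z -> ffinite (ratf i z) topK.
Proof.
move=> tz; have [v v0] := ex_nonzero; pose x := chi v.
have hx := ratf_subfield i x; have hz := ratf_subfield i z.
have [n _ d] := fdegree_top hx (ffinite_chi v0).
have [P [P0 _ Pxz]] := fdegree_relation topK_subfield d (I : topK z).
have ax : algebraic_over (ratf i z) x.
  by apply: (relation_algebraic (P := swapXY P) tz); rewrite ?swapXY_eq0 // ev2_swap.
have hA := adjoin_subfield hz ax.
apply: (ffinite_trans hz hA topK_subfield) => //; first by move=> w; apply: adjoin_base.
  exact: adjoin_ffinite.
apply: (ffinite_base (ffinite_chi v0)); apply: chi_ratf => //; exact: adjoin_gen.
Qed.

(** The intersection of the fields Q(chi(n Z^s)). It depends on no matrix and is preserved by the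
    isomorphisms chi(v C1) -> chi(v C2), so that indices in K can be compared. *)
Definition common_field z := forall n, (0 < n)%N -> chi_field n%:R%:M z.

Lemma common_subfield : subfield common_field.
Proof.
split=> [n _|z w hz hw n n0|z w hz hw n n0]; have h := chi_field_subfield n%:R%:M.
- exact: subfield1 h.
- by apply: (subfieldB h); [apply: hz | apply: hw].
- by apply: (subfield_div h); [apply: hz | apply: hw].
Qed.

(** By the adjugate matrix, n |det C| Z^s is contained in n Z^s C. *)
Lemma chi_field_scale n C : \det C != 0 ->
  forall z, chi_field (n * `|\det C|)%N%:R%:M z -> chi_field (n%:R *: C) z.
Proof.
move=> d0; apply: chi_field_min; first exact: chi_field_subfield.
move=> v; rewrite mul_mx_scalar.
have -> : (n * `|\det C|)%N%:R *: v = (sgz (\det C) *: (v *m \adj C)) *m (n%:R *: C).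
  rewrite -scalemxAl -scalemxAr -mulmxA mul_adj_mx mul_mx_scalar !scalerA.
  congr (_ *: _); rewrite natrM !natz abszEsg; ring.
exact: chi_field_gen.
Qed.

Lemma common_sub C : \det C != 0 -> forall z, common_field z -> chi_field C z.
Proof.
move=> d0 z hz; rewrite -[C]scale1r; apply: (@chi_field_scale 1) => //.
by apply: hz; rewrite mul1n absz_gt0.
Qed.

(** The logarithmic ratio for two distinct unit vectors; a product x^a y^b with b > 0 is chi of a
    non-zero vector, hence transcendental. *)
Lemma common_transcendental : exists2 r, common_field r & transcendental i r.
Proof.
have s0 : (0 < s)%N by apply: ltn_trans s_gt1.
pose j0 := Ordinal s0; pose j1 := Ordinal s_gt1.
pose x := chi (delta_mx 0 j0); pose y := chi (delta_mx 0 j1).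
have nz0 : delta_mx 0 j0 != 0 :> V.
  by apply/eqP => /rowP /(_ j0); rewrite !mxE !eqxx.
have char0 n : (0 < n)%N -> n%:R != 0 :> rat by move=> n0; rewrite pnatr_eq0 -lt0n.
have exP := chi_dep (delta_mx 0 j1) nz0.
have tx := chi_transc nz0.
have [|r hr tr] := @transcendental_log_ratio _ _ i char0 x y tx (chi_neq0 _) exP.
  move=> a b b0; suff -> : x ^ a * y ^+ b = chi (a *: delta_mx 0 j0 + delta_mx 0 j1 *+ b).
    apply: chi_transc; apply/eqP => /rowP /(_ j1); rewrite !mxE mulmxnE !mxE eqxx /=.
    by rewrite mulr0 add0r => /eqP; rewrite natz; move: b0; lia.
  by rewrite chiD chiMn chiZ.
exists r => // n n0; apply: (log_ratio_pow char0 (chi_field_subfield n%:R%:M) _ n0 _ _ tx (chi_neq0 _) _ hr).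
- by move=> c; apply: subfield_rat; apply: chi_field_subfield.
- by rewrite -chiMn -scaler_nat -mul_mx_scalar; apply: chi_field_gen.
- by rewrite -chiMn -scaler_nat -mul_mx_scalar; apply: chi_field_gen.
- rewrite -!chiMn; apply: chi_dep; apply: contra_neq nz0 => /rowP h.
  apply/rowP => j; have := h j; rewrite mulmxnE !mxE => /eqP.
  by rewrite mulrn_eq0 -leqn0 leqNgt n0 => /eqP.
Qed.

Lemma ffinite_common : ffinite common_field topK.
Proof.
have [r hr tr] := common_transcendental.
apply: (ffinite_base (ffinite_transc tr)); apply: ratf_min hr; first exact: common_subfield.
by move=> c; apply: subfield_rat; apply: common_subfield.
Qed.

Section Commensurable.
Variables C1 C2 : 'M[int]_s.
Hypothesis d1 : \det C1 != 0.
Hypothesis d2 : \det C2 != 0.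
Hypothesis equiv : forall l, evl C1 l = 0 <-> evl C2 l = 0.

(* Equivalence of the relations makes this the graph of the isomorphism
   chi (v C1) |-> chi (v C2) between the two subfields. *)
Definition transfer z w := exists l l',
  [/\ evl C1 l' != 0, z = evl C1 l / evl C1 l' & w = evl C2 l / evl C2 l'].

Lemma evl2_nz l : evl C1 l != 0 -> evl C2 l != 0.
Proof. by move=> h; apply/eqP => /equiv /eqP; apply/negP. Qed.

Lemma transferB z w z' w' : transfer z w -> transfer z' w' -> transfer (z - z') (w - w').
Proof.
move=> [a [b [b0 -> ->]]] [c [d [e0 -> ->]]].
exists (mul_formal a d ++ opp_formal (mul_formal c b)), (mul_formal b d).
rewrite !evl_cat !evl_opp !evlM mulf_neq0 //; have b2 := evl2_nz b0; have e2 := evl2_nz e0.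
by split=> //; field; rewrite ?b0 ?e0 ?b2 ?e2.
Qed.

Lemma transferM z w z' w' : transfer z w -> transfer z' w' -> transfer (z * z') (w * w').
Proof.
move=> [a [b [b0 -> ->]]] [c [d [e0 -> ->]]].
exists (mul_formal a c), (mul_formal b d).
rewrite !evlM mulf_neq0 //; have b2 := evl2_nz b0; have e2 := evl2_nz e0.
by split=> //; field; rewrite ?b0 ?e0 ?b2 ?e2.
Qed.

Lemma transfer0 z w : transfer z w -> z = 0 <-> w = 0.
Proof.
move=> [a [b [b0 -> ->]]]; have b2 := evl2_nz b0.
split=> /eqP; rewrite mulf_eq0 invr_eq0 ?(negPf b0) ?(negPf b2) orbF => /eqP /equiv ->;
by rewrite mul0r.
Qed.

Lemma transfer_ev f v : transfer (ev i (chi (v *m C1)) f) (ev i (chi (v *m C2)) f).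
Proof.
have int (n : int) : transfer n%:~R n%:~R.
  exists [:: (n, 0)], [:: (1, 0)]; rewrite !evl_one !evl1 !mul0mx chi0 !divr1 mulr1.
  by rewrite oner_neq0.
have T1 : transfer 1 1 by apply: (int 1).
have TD z w z' w' : transfer z w -> transfer z' w' -> transfer (z + z') (w + w').
  move=> h h'; rewrite -[z']opprK -[w']opprK -(sub0r z') -(sub0r w').
  by apply: transferB => //; apply: transferB => //; apply: (int 0).
rewrite !ev_sum; apply: (big_ind2 transfer) => [||j _]; [exact: (int 0)|exact: TD|].
apply: transferM.
  rewrite -[f`_j]divq_num_den fmorph_div !rmorph_int.
  exists [:: (numq f`_j, 0)], [:: (denq f`_j, 0)].
  rewrite !evl1 !mul0mx chi0 !mulr1; split=> //.
  by rewrite -(rmorph_int i) fmorph_eq0 intr_eq0 denq_eq0.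
have Tx : transfer (chi (v *m C1)) (chi (v *m C2)).
  by exists [:: (1, v)], [:: (1, 0)]; rewrite !evl_one !evl1 !mul1r !divr1 oner_neq0.
by elim: (nat_of_ord j) => [|n IH]; rewrite ?expr0 // !exprS; apply: transferM.
Qed.

Lemma transfer_inv z w : transfer z w -> transfer z^-1 w^-1.
Proof.
move=> h; have [z0|nz] := eqVneq z 0.
  by have /(transfer0 h) w0 := z0; rewrite z0 w0 !invr0 -[0 in X in transfer X _]z0 -[0 in X in transfer _ X]w0.
case: h nz => a [b [b0 -> ->]]; rewrite mulf_eq0 negb_or => /andP [a0 _].
by exists b, a; rewrite !invfM !invrK ![_^-1 * _]mulrC.
Qed.

Lemma transfer_fun z w w' : transfer z w -> transfer z w' -> w = w'.
Proof.
move=> h /(transferB h); rewrite subrr => /transfer0 [/(_ erefl) /eqP].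
by rewrite subr_eq0 => /eqP.
Qed.

Lemma transfer_left z : chi_field C1 z -> exists2 w, chi_field C2 w & transfer z w.
Proof.
move=> /chi_field_nz [a [b [b0 ->]]]; exists (evl C2 a / evl C2 b); first by exists a, b.
by exists a, b.
Qed.

Lemma transfer_ratf v z w : transfer z w ->
  ratf i (chi (v *m C1)) z -> ratf i (chi (v *m C2)) w.
Proof.
move=> h [f [g e]]; exists f, g; apply: (transfer_fun h); rewrite e.
by apply: transferM; [|apply: transfer_inv]; apply: transfer_ev.
Qed.

(** An element of Q(chi(n |det C1| Z^s)) is an expression in values chi(n v C1); its image is the
    same expression in the chi(n v C2), which lie in Q(chi(n Z^s)). *)
Lemma transfer_common z w : transfer z w -> common_field z -> common_field w.
Proof.
move=> h hz n n0.
have /(chi_field_scale (n := n) d1) : chi_field (n * `|\det C1|)%N%:R%:M z.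
  by apply: hz; rewrite muln_gt0 n0 absz_gt0.
pose sc l : seq (int * V) := [seq (p.1, p.2 *+ n) | p <- l].
have evs C l : evl (n%:R *: C) l = evl C (sc l).
  rewrite /evl big_map; apply: eq_bigr => p _ /=.
  by rewrite -scaler_nat -scalemxAl -scalemxAr.
case/chi_field_nz=> a [b]; rewrite !evs => -[b0 ez].
have -> : w = evl C2 (sc a) / evl C2 (sc b).
  by apply: (transfer_fun h); rewrite ez; exists (sc a), (sc b).
have hF := chi_field_subfield n%:R%:M.
have Fl l : chi_field n%:R%:M (evl C2 (sc l)).
  rewrite -evs; apply: (subfield_sum hF) => p; apply: (subfieldM hF).
    exact: subfield_int.
  by rewrite -scalemxAr -mul_mx_scalar; apply: chi_field_gen.
exact: (subfield_div hF).
Qed.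

End Commensurable.

Lemma transfer_sym C1 C2 z w : (forall l, evl C1 l = 0 <-> evl C2 l = 0) ->
  transfer C1 C2 z w -> transfer C2 C1 w z.
Proof. by move=> e [a [b [b0 -> ->]]]; exists a, b; split=> //; apply: (evl2_nz e). Qed.

(** The value 0 at v = 0 is a convention: there Q(chi v) = Q has infinite index in K. *)
Definition degree_at v n := if v == 0 then n = 0%N else fdegree (ratf i (chi v)) topK n.

(** With E_j = Q(chi(Z^s C_j)), the degree is [K : E_j] [E_j : Q(chi(v C_j))]. The isomorphism E1 ->
    E2 preserves the second factor. It also preserves the common subfield, hence the index of that
    subfield in E_j, which determines [K : E_j]. *)
Lemma degree_at_transfer C1 C2 v n : \det C1 != 0 -> \det C2 != 0 ->
  (forall l, evl C1 l = 0 <-> evl C2 l = 0) ->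
  degree_at (v *m C1) n -> degree_at (v *m C2) n.
Proof.
move=> d1 d2 e12.
have e21 l : evl C2 l = 0 <-> evl C1 l = 0 by split=> /e12.
have inj C : \det C != 0 -> (v *m C == 0) = (v == 0).
  move=> dC; apply/eqP/eqP => [h|->]; last by rewrite mul0mx.
  have : v *m C *m \adj C = 0 by rewrite h mul0mx.
  rewrite -mulmxA mul_mx_adj mul_mx_scalar => /eqP; rewrite scalemx_eq0 (negPf dC) /=.
  by move/eqP.
rewrite /degree_at !inj //; case: eqVneq => // v0.
pose E1 := chi_field C1; pose E2 := chi_field C2.
have hE1 : subfield E1 := chi_field_subfield C1.
have hE2 : subfield E2 := chi_field_subfield C2.
have transp (A1 A2 : K -> Prop) m : (forall z, A1 z -> E1 z) -> (forall z, A2 z -> E2 z) ->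
    (forall z w, transfer C1 C2 z w -> A1 z <-> A2 w) -> fdegree A1 E1 m -> fdegree A2 E2 m.
  move=> s1 s2 T; apply: (fdegree_transport (T := transfer C1 C2)) => //.
  - by move=> z /(transfer_left C2).
  - move=> w /(transfer_left C1) [z Ez Tz]; exists z => //; exact: transfer_sym Tz.
  - by move=> *; apply: transferB.
  - by move=> *; apply: transferM.
  - by move=> *; apply: transfer0.
have hK := common_subfield.
have [m m0 dm1] : exists2 m, (0 < m)%N & fdegree common_field E1 m.
  apply: ffinite_fdegree => //; first exact: common_sub.
  exact: ffinite_sub ffinite_common _.
have dm2 : fdegree common_field E2 m.
  apply: transp dm1; [exact: common_sub|exact: common_sub|].
  move=> z w Tzw; split; first exact: transfer_common Tzw.
  by apply: (transfer_common d2 e21); apply: transfer_sym.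
have top_fin E : \det E != 0 -> exists2 m', (0 < m')%N & fdegree (chi_field E) topK m'.
  move=> dE; apply: fdegree_top; first exact: chi_field_subfield.
  exact: ffinite_base ffinite_common (common_sub dE).
have [n1 _ dn1] := top_fin _ d1; have [n2 _ dn2] := top_fin _ d2.
have en : n1 = n2.
  apply/eqP; rewrite -(eqn_pmul2l m0); apply/eqP; apply: (@fdegree_unique _ common_field topK) => //.
    exact: (fdegree_tower hE1 (common_sub d1)).
  exact: (fdegree_tower hE2 (common_sub d2)).
have rsub C : forall z, ratf i (chi (v *m C)) z -> chi_field C z.
  by apply: chi_ratf; [apply: chi_field_subfield | apply: chi_field_gen].
move=> d; have hx1 := ratf_subfield i (chi (v *m C1)).
have [a [b [da db ->]]] := fdegree_split hx1 hE1 topK_subfield (rsub C1) (fun _ _ => I) d.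
rewrite (fdegree_unique hE1 db dn1) en.
have da2 : fdegree (ratf i (chi (v *m C2))) E2 a.
  apply: transp da; [exact: rsub|exact: rsub|].
  move=> z w Tzw; split; first exact: transfer_ratf Tzw.
  by apply: (transfer_ratf e21); apply: transfer_sym.
exact: (fdegree_tower hE2 (rsub C2)).
Qed.

(** The homomorphism chi(v C1) -> chi(v C2) is injective since it does not lower the transcendence
    degree: a non-zero element of the kernel is algebraic over Q(chi(u C1)), and the constant term
    of its equation would vanish at the transcendental chi(u C2). *)
Lemma relation_reflects C1 C2 (u : V) : \det C1 != 0 -> u *m C2 != 0 ->
  (forall l, evl C1 l = 0 -> evl C2 l = 0) ->
  forall l, evl C2 l = 0 -> evl C1 l = 0.
Proof.
move=> d1 uC2 pres.
have u0 : u != 0 by apply: contra_neq uC2 => ->; rewrite mul0mx.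
have iz (a : int) : a%:~R = 0 :> K -> a = 0.
  by rewrite -(rmorph_int i) => /eqP; rewrite fmorph_eq0 intr_eq0 => /eqP.
(* The homomorphism extended to rational coefficients, [a] being a common denominator. *)
pose T z w := exists (a : int) l, [/\ a != 0, a%:~R * z = evl C1 l & a%:~R * w = evl C2 l].
have T0 w : T 0 w -> w = 0.
  case=> a [l [a0 e1 e2]]; move: e1; rewrite mulr0 => /esym /pres h.
  by move/eqP: e2; rewrite h mulf_eq0 => /orP [/eqP /iz a00|/eqP //]; rewrite a00 eqxx in a0.
have Tl l : T (evl C1 l) (evl C2 l) by exists 1, l; rewrite !mul1r.
have TD z w z' w' : T z w -> T z' w' -> T (z + z') (w + w').
  move=> [a [l [a0 e1 e2]]] [b [l' [b0 e1' e2']]].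
  exists (a * b), (mul_formal [:: (b, 0)] l ++ mul_formal [:: (a, 0)] l').
  rewrite mulf_neq0 // (evl_cat C1) (evl_cat C2) !evlM !evl1 !mul0mx chi0 -e1 -e2 -e1' -e2' intrM.
  by split=> //; ring.
have TM z w z' w' : T z w -> T z' w' -> T (z * z') (w * w').
  move=> [a [l [a0 e1 e2]]] [b [l' [b0 e1' e2']]].
  exists (a * b), (mul_formal l l').
  rewrite mulf_neq0 // !evlM -e1 -e2 -e1' -e2' intrM.
  by split=> //; ring.
have Tc c : T (i c) (i c).
  exists (denq c), [:: (numq c, 0)]; rewrite denq_eq0 !evl1 !mul0mx chi0 mulr1.
  have e : (denq c)%:~R * c = (numq c)%:~R :> rat.
    by rewrite -{2}[c]divq_num_den mulrC divfK ?intr_eq0 ?denq_eq0.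
  by rewrite -!(rmorph_int i) -rmorphM e.
have T1 : T 1 1 by rewrite -(rmorph1 i); apply: Tc.
have T00 : T 0 0 by rewrite -(rmorph0 i); apply: Tc.
have TX z w n : T z w -> T (z ^+ n) (w ^+ n).
  by move=> h; elim: n => [|n IH]; rewrite ?expr0 // !exprS; apply: TM.
have Tev f z w : T z w -> T (ev i z f) (ev i w f).
  move=> h; rewrite !ev_sum; apply: (big_ind2 T) => // j _.
  by apply: TM => //; apply: TX.
have Tev2 P z w z' w' : T z w -> T z' w' -> T (ev2 i z z' P) (ev2 i w w' P).
  move=> h h'; rewrite !ev2_sum; apply: (big_ind2 T) => // j _.
  by apply: TM; [apply: Tev|apply: TX].
move=> l el2; apply: contrapT => /eqP nz.
pose x := chi (u *m C1).
have uC1 : u *m C1 != 0.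
  apply/eqP => h; have : u *m C1 *m \adj C1 = 0 by rewrite h mul0mx.
  by rewrite -mulmxA mul_mx_adj mul_mx_scalar => /eqP; rewrite scalemx_eq0 (negPf d1) (negPf u0).
have tx : transcendental i x := chi_transc uC1.
have [n _ d] := fdegree_top (ratf_subfield i x) (ffinite_transc tx).
have [P0 [P00 _ P0z]] := fdegree_relation topK_subfield d (I : topK (evl C1 l)).
have Txu : T x (chi (u *m C2)) by exists 1, [:: (1, u)]; rewrite !evl1 !mul1r.
(* Once the constant term is shown to be 0, the non-zero factor [evl C1 l] is cancelled and the next
   coefficient becomes the constant term. *)
elim/poly_ind: P0 P00 P0z => [|P c IH] P0; first by rewrite eqxx in P0.
move=> e; have Tz : T (evl C1 l) 0 by rewrite -el2.
have := Tev2 (P * 'X + c%:P) _ _ _ _ Txu Tz.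
rewrite e => /T0; rewrite ev2D ev2M ev2X ev2C mulr0 add0r => /(chi_transc uC2) c0.
move: e; rewrite c0 addr0 ev2M ev2X => /eqP; rewrite mulf_eq0 (negPf nz) orbF => /eqP.
by apply: IH; apply: contra_neq P0 => ->; rewrite c0 mul0r addr0.
Qed.

Theorem degree_norm : exists N : V -> nat,
  [/\ N 0 = 0%N, forall v, v != 0 -> (0 < N v)%N,
     forall v n, N (v *+ n) = (n * N v)%N,
     forall u v, (N (u + v)%R <= N u + N v)%N
   & forall C1 C2, \det C1 != 0 -> \det C2 != 0 ->
     (forall l, evl C1 l = 0 <-> evl C2 l = 0) ->
     forall v, N (v *m C1) = N (v *m C2)].
Proof.
have /choice [N hN] : forall v, exists n, degree_at v n /\ (v != 0 -> (0 < n)%N).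
  move=> v; rewrite /degree_at; case: eqVneq => [_|v0]; first by exists 0%N.
  have [n n0 d] := fdegree_top (ratf_subfield i (chi v)) (ffinite_chi v0).
  by exists n.
have N0 : N 0 = 0%N by have [] := hN 0; rewrite /degree_at eqxx.
have Nd v : v != 0 -> fdegree (ratf i (chi v)) topK (N v).
  by move=> v0; have [] := hN v; rewrite /degree_at (negPf v0).
exists N; split=> // [v v0|v n|u v|C1 C2 d1 d2 e v].
- by have [_] := hN v; apply.
- have [->|n0] := posnP n; first by rewrite mulr0n N0.
  have [->|v0] := eqVneq v 0; first by rewrite mul0rn N0 muln0.
  have vn0 : v *+ n != 0.
    apply: contra_neq v0 => /rowP h; apply/rowP => j; have := h j; rewrite mulmxnE !mxE => /eqP.
    by rewrite mulrn_eq0 -leqn0 leqNgt n0 => /eqP.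
  have hx := ratf_subfield i (chi v ^+ n).
  apply: (fdegree_unique hx); first by rewrite -chiMn; apply: Nd.
  apply: (fdegree_tower (ratf_subfield i (chi v))) => //; last exact: Nd.
    by apply: ratf_min; [apply: ratf_subfield|apply: ratf_const|apply: subfieldX; [apply: ratf_subfield|apply: ratf_gen]].
  by apply: fdegree_pow => //; apply: chi_transc.
- have [->|u0] := eqVneq u 0; first by rewrite add0r N0.
  have [->|v0] := eqVneq v 0; first by rewrite addr0 N0 addn0.
  have [->|uv0] := eqVneq (u + v) 0; first by rewrite N0.
  apply: (@fdegree_mul_gen _ _ i (chi u) (chi v) topK) => //; rewrite -?chiD; try exact: chi_transc.
  - exact: Nd.
  - exact: Nd.
  - exact: Nd.
have [h1 _] := hN (v *m C1); have [h2 _] := hN (v *m C2).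
have := degree_at_transfer d1 d2 e h1; move: h2; rewrite /degree_at.
case: eqP => [_ -> -> //|_ h2 h1']; exact: (fdegree_unique (ratf_subfield i _) h1' h2).
Qed.

End DegreeNorm.

(** * Invariant finite sets for an integral norm *)

Section Gauges.
Variable s : nat.
Local Notation V := 'rV[int]_s.
Implicit Types (q : V -> int) (a b u v : V) (l : seq V) (C : 'M[int]_s).

(** An integral sublinear function. No symmetry under v -> -v is asked, since directional
    derivatives of a norm lack it. *)
Definition gauge q := (forall u v, q (u + v) <= q u + q v) /\
  (forall v n, q (v *+ n) = q v *+ n).

Definition linear_along q b := forall v, q (v + b) = q v + q b.

Lemma gauge0 q : gauge q -> q 0 = 0.
Proof. by case=> _ /(_ 0 0%N). Qed.

Lemma eventually_const (f : nat -> int) (L : int) :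
  (forall n, f n.+1 <= f n) -> (forall n, L <= f n) ->
  exists n0, forall n, (n0 <= n)%N -> f n = f n0.
Proof.
move=> dec bnd; pose P k := `[< exists n, f n = L + k%:Z >].
have ex : exists k, P k.
  exists `|f 0%N - L|%N; apply/asboolP; exists 0%N; rewrite gez0_abs ?subr_ge0 //; ring.
case: (ex_minnP ex) => k /asboolP [n0 e] min; exists n0 => n le.
have decn : f n <= f n0.
  elim: n le => [|n IH]; first by rewrite leqn0 => /eqP ->.
  rewrite leq_eqVlt => /orP [/eqP -> //|]; rewrite ltnS => /IH; exact: le_trans.
apply: le_anti; rewrite decn /= e; have := bnd n.
have /min : P `|f n - L|%N.
  by apply/asboolP; exists n; rewrite gez0_abs ?subr_ge0 //; ring.
move: (f n) => x; lia.
Qed.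

(* q' (v) is the derivative of q at a in the direction v: by homogeneity
   q (n a + v) - n q a is nonincreasing in n, so that it is finally constant. *)
Definition gauge_deriv a q q' := forall v, exists n0, forall n, (n0 <= n)%N ->
  q (a *+ n + v) - q a *+ n = q' v.

Lemma gauge_deriv_exists q a : gauge q -> exists q', gauge_deriv a q q'.
Proof.
move=> h; have [sub hom] := h.
suff /choice [q' hq'] : forall v, exists x, exists n0, forall n, (n0 <= n)%N ->
    q (a *+ n + v) - q a *+ n = x by exists q'.
move=> v; have [||n0 hn0] := @eventually_const (fun n => q (a *+ n + v) - q a *+ n) (- q (- v)).
- move=> n; have := sub a (a *+ n + v); rewrite addrA -mulrS [q a *+ n.+1]mulrS; lra.
- by move=> n; have := sub (a *+ n + v) (- v); rewrite addrK hom; lra.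
by exists (q (a *+ n0 + v) - q a *+ n0), n0.
Qed.

Lemma gauge_deriv_gauge q q' a : gauge q -> gauge_deriv a q q' -> gauge q'.
Proof.
move=> [sub hom] D; split=> [u v|v n].
  have [n1 h1] := D u; have [n2 h2] := D v; have [n3 h3] := D (u + v).
  pose n := (n1 + n2 + n3)%N.
  rewrite -(h1 n) -?(h2 n) -?(h3 (n + n)%N) /n; try lia.
  have := sub (a *+ n + u) (a *+ n + v); rewrite addrACA -mulrnDr [_ *+ (_ + _)]mulrnDr -/n.
  rewrite mulrnDr; lra.
case: n => [|n].
  rewrite !mulr0n; have [n0 h0] := D 0; rewrite -(h0 n0) // addr0 hom; exact: subrr.
have [n1 h1] := D v; have [n2 h2] := D (v *+ n.+1).
pose m := (n1 + n2)%N.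
rewrite -(h1 m) -?(h2 (m * n.+1)%N) /m; try lia.
by rewrite !mulrnA -mulrnDl hom -mulrnBl.
Qed.

Lemma gauge_deriv_le q q' a v : gauge q -> gauge_deriv a q q' -> q' v <= q v.
Proof.
move=> [sub hom] D; have [n h] := D v; rewrite -(h n) //.
by have := sub (a *+ n) v; rewrite hom; lra.
Qed.

(** Linear directions are never lost, so derivation along all unit vectors ends with a linear
    form. *)
Lemma gauge_deriv_linear q q' a b : gauge q -> gauge_deriv a q q' ->
  linear_along q b -> linear_along q' b /\ q' b = q b.
Proof.
move=> hq D lin.
have e v : q' (v + b) = q' v + q b.
  have [n1 h1] := D v; have [n2 h2] := D (v + b); pose n := (n1 + n2)%N.
  rewrite -(h1 n) -?(h2 n) /n; try lia.
  by rewrite addrA lin; lra.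
have eb : q' b = q b.
  by rewrite -[b]add0r e (gauge0 (gauge_deriv_gauge hq D)) !add0r.
by split=> // v; rewrite e eb.
Qed.

(** Replacing v by v + a amounts to replacing n by n + 1 in the defining difference. *)
Lemma gauge_deriv_self q q' a : gauge q -> gauge_deriv a q q' ->
  linear_along q' a /\ q' a = q a.
Proof.
move=> hq D.
have e v : q' (v + a) = q' v + q a.
  have [n1 h1] := D v; have [n2 h2] := D (v + a); pose n := (n1 + n2)%N.
  rewrite -(h1 n.+1) -?(h2 n) /n; try lia.
  by rewrite [v + a]addrC addrA -mulrSr [q a *+ _.+1]mulrSr; lra.
have eb : q' a = q a.
  by rewrite -[a]add0r e (gauge0 (gauge_deriv_gauge hq D)) !add0r.
by split=> // v; rewrite e eb.
Qed.

Fixpoint gauge_derivs l q q' : Prop :=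
  if l is a :: l' then exists2 q1, gauge_deriv a q q1 & gauge_derivs l' q1 q'
  else forall v, q v = q' v.

Lemma gauge_eq q q' : (forall v, q v = q' v) -> gauge q -> gauge q'.
Proof. by move=> e [sub hom]; split=> *; rewrite -!e. Qed.

Lemma gauge_derivs_exists l q : gauge q -> exists q', gauge_derivs l q q'.
Proof.
elim: l q => [|a l IH] q hq; first by exists q.
have [q1 D] := gauge_deriv_exists a hq.
have [q' Dl] := IH _ (gauge_deriv_gauge hq D).
by exists q', q1.
Qed.

Lemma gauge_derivs_spec l q q' : gauge q -> gauge_derivs l q q' ->
  [/\ gauge q', forall v, q' v <= q v,
      forall b, linear_along q b -> linear_along q' b /\ q' b = q b
    & forall b, b \in l -> linear_along q' b].
Proof.
elim: l q => [|a l IH] q hq /=.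
  move=> e; split=> // [|v|b lin]; first exact: gauge_eq e hq.
  - by rewrite e.
  - by split=> // v; rewrite -!e.
case=> q1 D Dl; have hq1 := gauge_deriv_gauge hq D.
have [g' le lin mem] := IH _ hq1 Dl; split=> // [v|b lb|b].
- by apply: le_trans (le v) _; apply: gauge_deriv_le D.
- have [l1 e1] := gauge_deriv_linear hq D lb; have [l2 e2] := lin _ l1.
  by split=> //; rewrite e2.
- rewrite inE => /orP [/eqP ->|/mem //]; have [l1 _] := gauge_deriv_self hq D.
  by case: (lin _ l1).
Qed.

Definition unit_vectors : seq V := [seq delta_mx 0 j | j : 'I_s].

Lemma additive_matrix q : gauge q -> (forall u v, q (u + v) = q u + q v) ->
  exists c : 'cV[int]_s, forall v, q v = (v *m c) 0 0.
Proof.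
move=> hq add; have q0 := gauge0 hq.
have qN v : q (- v) = - q v by apply/eqP; rewrite -addr_eq0 -add addNr q0.
have qZ (z : int) v : q (z *: v) = z * q v.
  case: z => n; first by rewrite -[Posz n]natz scaler_nat hq.2 mulr_natl.
  by rewrite NegzE scaleNr -natz scaler_nat qN hq.2 mulNr mulr_natl.
exists (\col_j q (delta_mx 0 j)) => v; rewrite [in LHS](row_sum_delta v).
rewrite (big_morph q add q0) mxE; apply: eq_bigr => j _.
by rewrite qZ !mxE.
Qed.

Lemma linear_unit_additive q : gauge q -> (forall b, b \in unit_vectors -> linear_along q b) ->
  forall u v, q (u + v) = q u + q v.
Proof.
move=> hq lin.
have linj j : linear_along q (delta_mx 0 j).
  by apply: lin; apply: map_f; rewrite mem_enum.
have linS b b' : linear_along q b -> linear_along q b' -> linear_along q (b + b').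
  by move=> h h' v; rewrite addrA !h' h addrA.
have lin0 : linear_along q 0 by move=> v; rewrite addr0 (gauge0 hq) addr0.
have linN b : linear_along q b -> linear_along q (- b).
  move=> h v; have e w : q (w - b) = q w - q b.
    by have := h (w - b); rewrite subrK => ->; rewrite addrK.
  by rewrite e -[X in _ = _ + q X]add0r e (gauge0 hq) add0r.
move=> u v; suff : linear_along q v by apply.
rewrite [v]row_sum_delta; apply: (big_ind (linear_along q)) => // j _.
have linn n : linear_along q (delta_mx 0 j *+ n).
  by elim: n => [|n IH]; rewrite ?mulr0n // mulrS; apply: linS.
case: (v 0 j) => n; first by rewrite -natz scaler_nat.
by rewrite NegzE scaleNr -natz scaler_nat; apply: linN.
Qed.

Lemma gauge_derivs_transport C M l q q2 q' : (0 < M)%N -> gauge q -> gauge q2 ->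
  (forall v, q2 (v *m C) = q v *+ M) -> gauge_derivs l q q' ->
  exists2 q2', gauge_derivs [seq b *m C | b <- l] q2 q2' &
    forall v, q2' (v *m C) = q' v *+ M.
Proof.
move=> M0; elim: l q q2 => [|a l IH] q q2 hq hq2 e /=.
  by move=> e'; exists q2 => // v; rewrite e e'.
case=> q1 D Dl; have [q3 D3] := gauge_deriv_exists (a *m C) hq2.
have [|q2' D2' e2'] := IH _ _ (gauge_deriv_gauge hq D) (gauge_deriv_gauge hq2 D3) _ Dl.
  move=> v; have [n1 h1] := D v; have [n2 h2] := D3 (v *m C); pose n := (n1 + n2)%N.
  rewrite -(h1 n) -?(h2 n) /n; try lia.
  have mulmxMn m : (a *m C) *+ m = (a *+ m) *m C by rewrite -!scaler_nat scalemxAl.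
  by rewrite mulmxMn -mulmxDl !e mulrnBl -!mulrnA [(M * _)%N]mulnC.
by exists q2' => //; exists q3.
Qed.

End Gauges.

Lemma int_mulrnI m : (0 < m)%N -> injective (fun x : int => x *+ m).
Proof.
by move=> m0 x y /=; rewrite -[x *+ m]mulr_natr -[y *+ m]mulr_natr; apply: mulIf; rewrite pnatr_eq0 -lt0n.
Qed.

Lemma intmx_mulrnI p n m : (0 < m)%N -> injective (fun A : 'M[int]_(p, n) => A *+ m).
Proof.
move=> m0 A1 A2 /matrixP h; apply/matrixP => a b; have := h a b; rewrite !mulmxnE.
exact: int_mulrnI.
Qed.

(** * Linear forms exposed by the norm, and invariant sets of vectors *)

Section InvariantOrbits.
Variables (s : nat) (N : 'rV[int]_s -> nat).
Local Notation V := 'rV[int]_s.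
Implicit Types (u v w : V) (C : 'M[int]_s) (c : 'cV[int]_s).
Hypothesis N_pos : forall v, v != 0 -> (0 < N v)%N.
Hypothesis N_scale : forall v n, N (v *+ n) = (n * N v)%N.
Hypothesis N_sub : forall u v, (N (u + v)%R <= N u + N v)%N.

Let NZ v : int := (N v)%:Z.

Lemma norm_gauge : gauge NZ.
Proof.
split=> [u v|v n]; first by rewrite /NZ -PoszD lez_nat.
by rewrite /NZ N_scale PoszM -mulr_natl natz.
Qed.

(** Linear forms bounded above by N, obtained from N alone: a matrix that multiplies N by M must
    therefore permute them up to M. *)
Definition exposed c := exists l q, gauge_derivs l NZ q /\ forall v, q v = (v *m c) 0 0.

Lemma exposed_transport C M c : (0 < M)%N -> \det C != 0 ->
  (forall v, N (v *m C) = (M * N v)%N) -> exposed c ->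
  exists2 c', exposed c' & C *m c' = c *+ M.
Proof.
move=> M0 dC e [l [q [D qc]]].
have [|q2 D2 e2] := gauge_derivs_transport (C := C) M0 norm_gauge norm_gauge _ D.
  by move=> v; rewrite /NZ e PoszM -mulr_natl natz.
have [g2 _ _ _] := gauge_derivs_spec norm_gauge D2.
(* The values of [q2] are known on Z^s C only; multiplication by |det C| leads into this
   sublattice. *)
have add2 u v : q2 (u + v) = q2 u + q2 v.
  pose d := `|\det C|%N; have d0 : (0 < d)%N by rewrite absz_gt0.
  have div w : exists w', w *+ d = w' *m C.
    exists (sgz (\det C) *: (w *m \adj C)).
    rewrite -scalemxAl -mulmxA mul_adj_mx mul_mx_scalar scalerA -scaler_nat; congr (_ *: _).
    by rewrite natz abszEsg.
  apply: (int_mulrnI d0); rewrite /= mulrnDl -!g2.2 mulrnDl.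
  have [u' ->] := div u; have [v' ->] := div v.
  by rewrite -mulmxDl !e2 -mulrnDl !qc mulmxDl mxE.
have [c' hc'] := additive_matrix g2 add2.
exists c'; first by exists [seq b *m C | b <- l], q2.
apply/matrixP => i j; rewrite [j]ord1.
have := e2 (delta_mx 0 i); rewrite hc' qc -mulmxA -!rowE !mxE => ->.
by rewrite mulmxnE.
Qed.

(** The first derivation is taken along [v]: it makes the function linear along [v] with value N v >
    0 there, and later derivations keep this value. *)
Lemma exposed_separates v : v != 0 -> exists2 c, exposed c & (v *m c) 0 0 != 0.
Proof.
move=> v0; have [q1 D] := gauge_deriv_exists v norm_gauge.
have hq1 := gauge_deriv_gauge norm_gauge D.
have [q Dl] := gauge_derivs_exists (unit_vectors s) hq1.
have [hq _ lin mem] := gauge_derivs_spec hq1 Dl.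
have [c hc] := additive_matrix hq (linear_unit_additive hq mem).
exists c; first by exists (v :: unit_vectors s), q; split=> //; exists q1.
rewrite -hc; have [l1 e1] := gauge_deriv_self norm_gauge D.
have [_ ->] := lin _ l1; rewrite e1 /NZ; have := N_pos v0; lia.
Qed.

(** The j-th coordinate lies between -N(-e_j) and N(e_j). *)
Lemma exposed_finite : exists l : seq 'cV[int]_s, forall c, exposed c -> c \in l.
Proof.
pose B := (\sum_(j < s) (N (delta_mx 0 j)%R + N (- delta_mx 0 j)%R))%N.
pose val_of (f : {ffun 'I_s -> 'I_(B + B).+1}) : 'cV[int]_s := \col_j ((f j)%:Z - B%:Z).
exists [seq val_of f | f <- enum {ffun 'I_s -> 'I_(B + B).+1}] => c [l [q [D qc]]].
have [hq le _ _] := gauge_derivs_spec norm_gauge D.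
have bnd j : - B%:Z <= c j 0 <= B%:Z.
  have leB : (N (delta_mx 0 j)%R + N (- delta_mx 0 j)%R <= B)%N.
    by rewrite /B (bigD1 j) //= leq_addr.
  have h1 := le (delta_mx 0 j); have h2 := le (- delta_mx 0 j).
  rewrite !qc mulNmx -!rowE !mxE /NZ in h1 h2.
  by move: leB h1 h2; move: (c j 0) => x; lia.
apply/mapP; exists [ffun j => inord (absz (c j 0 + B%:Z))]; first by rewrite mem_enum.
apply/matrixP => j z; rewrite [z]ord1 mxE ffunE inordK.
  have := bnd j; move: (c j 0) => x; lia.
by have := bnd j; move: (c j 0) => x; lia.
Qed.

(** The exposed forms embed Z^s in Z^n, and in these coordinates every C is M times a permutation.
    [O] collects the vectors whose coordinates are, up to one fixed factor, a permutation of those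
    of [v]. *)
Theorem invariant_orbit M (Cs : seq 'M[int]_s) : (0 < M)%N ->
  (forall C, C \in Cs -> \det C != 0) ->
  (forall C, C \in Cs -> forall v, N (v *m C) = (M * N v)%N) ->
  forall v, exists (k : nat) (O : seq V), [/\ (0 < k)%N, uniq O,
    exists2 w, w \in O & w *+ M = v *+ k
  & forall C, C \in Cs -> perm_eq [seq w *m C | w <- O] [seq w *+ M | w <- O]].
Proof.
move=> M0 dC NC v.
have [l0 hl0] := exposed_finite.
pose Phi := undup [seq c <- l0 | `[< exposed c >]].
have memPhi c : (c \in Phi) = `[< exposed c >].
  rewrite mem_undup mem_filter; case: asboolP => // /hl0 ->; by [].
pose n := size Phi.
pose col_at (j : 'I_n) := nth 0 Phi j.
have col_exposed j : exposed (col_at j).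
  by apply/asboolP; rewrite -memPhi mem_nth.
pose E : 'M[int]_(s, n) := \matrix_(i, j) col_at j i 0.
have mulE w j : (w *m E) 0 j = (w *m col_at j) 0 0.
  by rewrite !mxE; apply: eq_bigr => i _; rewrite mxE.
have Einj w : w *m E = 0 -> w = 0.
  move=> h; apply: contrapT => /eqP /exposed_separates [c]; rewrite -(asboolE (exposed c)) -memPhi => cP.
  have lt : (index c Phi < n)%N by rewrite index_mem.
  have := mulE w (Ordinal lt); rewrite h mxE /col_at nth_index // => <-.
  by rewrite eqxx.
have Gram : \det (E *m E^T) != 0.
  apply/negP => /det0P [w w0 h]; case/eqP: w0; apply: Einj.
  have : (w *m E) *m (w *m E)^T = 0 by rewrite trmx_mul mulmxA -[w *m E *m _]mulmxA h mul0mx.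
  move/matrixP => /(_ 0 0); rewrite !mxE => /eqP.
  rewrite psumr_eq0 => [/allP z|j _]; last by rewrite !mxE -expr2 sqr_ge0.
  apply/rowP => j; have := z j (mem_index_enum _); rewrite [X in _ * X]mxE -expr2 sqrf_eq0 => /eqP ->.
  by rewrite mxE.
pose d := \det (E *m E^T).
pose K0 := `|d ^+ 2|%N.
have eK0 : K0%:Z = d ^+ 2 by rewrite gez0_abs // sqr_ge0.
have K0pos : (0 < K0)%N by rewrite absz_gt0 expf_neq0.
(* A right inverse of [E] up to the factor [K0]; squaring the determinant makes this factor
   positive. *)
pose T : 'M[int]_(n, s) := d *: (E^T *m \adj (E *m E^T)).
have ET w : w *m E *m T = w *+ K0.
  rewrite -mulmxA /T -scalemxAr mulmxA mul_mx_adj -/d scale_scalar_mx mul_mx_scalar.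
  by rewrite -scaler_nat natz eK0 expr2.
(* Because of the factor M, an integral vector whose coordinates are k times a permutation of those
   of [v] is M times some [W p]. *)
pose k := (K0 * M)%N.
pose W (p : 'S_n) : V := col_perm p (v *m E) *m T.
(* A permuted coordinate vector may fall outside the rational span of the image of Z^s; only the
   other permutations are kept. *)
pose ok (p : 'S_n) := W p *+ M *m E == col_perm p (v *m E) *+ k.
have mulmxMn (m1 m2 m3 : nat) (A1 : 'M[int]_(m1, m2)) (A2 : 'M[int]_(m2, m3)) m :
   (A1 *+ m) *m A2 = (A1 *m A2) *+ m by rewrite -!scaler_nat scalemxAl.
have okP p u : u *m E = col_perm p (v *m E) *+ k -> u = W p *+ M /\ ok p.
  move=> h; have eu : u = W p *+ M.
    apply: (intmx_mulrnI K0pos); rewrite /= -ET h mulmxMn /W /k.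
    by rewrite -mulrnA mulnC.
  by split=> //; rewrite /ok -eu h.
exists k, (undup [seq W p | p in ok]).
have memO u : (u \in undup [seq W p | p in ok]) -> exists p, u *+ M *m E = col_perm p (v *m E) *+ k.
  by rewrite mem_undup => /imageP [p okp ->]; exists p; apply/eqP.
have inO p : ok p -> W p \in undup [seq W p | p in ok].
  by move=> okp; rewrite mem_undup; apply: image_f.
split; rewrite ?undup_uniq ?muln_gt0 ?K0pos //.
  have [|e ok1] := @okP 1%g (v *+ k); first by rewrite mulmxMn col_perm1.
  by exists (W 1%g); [apply: inO | rewrite e].
move=> C CC.
have /choice [tau htau] : forall j : 'I_n, exists j' : 'I_n, C *m col_at j' = col_at j *+ M.
  move=> j; have [c'] := exposed_transport M0 (dC _ CC) (NC _ CC) (col_exposed j).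
  rewrite -(asboolE (exposed c')) -memPhi => cP e.
  have lt : (index c' Phi < n)%N by rewrite index_mem.
  by exists (Ordinal lt); rewrite /col_at nth_index.
have tauI : injective tau.
  move=> j1 j2 e; have := htau j1; rewrite e htau => /(intmx_mulrnI M0) h.
  apply/val_inj/eqP; rewrite -(nth_uniq 0 (ltn_ord j1) (ltn_ord j2) (undup_uniq _)).
  by apply/eqP; rewrite -[nth _ _ _]/(col_at j1) -h.
pose t := perm tauI.
have Cinj : injective (fun w => w *m C).
  move=> w1 w2 /eqP; rewrite -subr_eq0 -mulmxBl => /eqP h.
  apply/eqP; rewrite -subr_eq0; apply/negP => /negP nz.
  by case/negP: (dC _ CC); apply/det0P; exists (w1 - w2).
have sub : {subset [seq w *m C | w <- undup [seq W p | p in ok]]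
             <= [seq w *+ M | w <- undup [seq W p | p in ok]]}.
  move=> _ /mapP [w /memO [p ep] ->].
  have e : w *m C *m E = col_perm (t^-1 * p)%g (v *m E) *+ k.
    rewrite col_permM.
    apply/matrixP => a j; rewrite [a]ord1; pose j' := (t^-1%g) j.
    have ej : j = tau j' by rewrite /j' -permE permKV.
    transitivity ((w *+ M *m E) 0 j'); last first.
      by rewrite ep mulmxnE [in RHS]mulmxnE [in RHS]mxE.
    rewrite {1}ej mulE -mulmxA htau -[col_at j' *+ M]scaler_nat -scalemxAr scaler_nat.
    by rewrite mulmxMn [in RHS]mulmxnE mulE [in LHS]mulmxnE.
  have [-> okp] := okP _ _ e.
  by apply: map_f; apply: inO.
apply: uniq_perm; rewrite ?map_inj_uniq ?undup_uniq //; first exact: intmx_mulrnI.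
have [] := uniq_min_size _ sub; rewrite ?map_inj_uniq ?undup_uniq ?size_map //.
Qed.

End InvariantOrbits.

(** * Extension of homomorphisms and chains of primes *)

Definition subring (K : nzRingType) (B : K -> Prop) : Prop :=
  [/\ B 1, forall x y, B x -> B y -> B (x - y)
         & forall x y, B x -> B y -> B (x * y)].

(** Only the restriction of [phi] to [B] matters; with total functions, a homomorphism is extended
    to a larger subring without a change of type. *)
Definition hom_on (K L : nzRingType) (B : K -> Prop) (phi : K -> L) : Prop :=
  [/\ phi 1 = 1, forall x y, B x -> B y -> phi (x - y) = phi x - phi y
         & forall x y, B x -> B y -> phi (x * y) = phi x * phi y].

Section HomOn.
Variables (K L : nzRingType) (B : K -> Prop) (phi : K -> L).
Hypotheses (hB : subring B) (hphi : hom_on B phi).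

Lemma subring1 : B 1. Proof. by case: hB. Qed.
Lemma subringB x y : B x -> B y -> B (x - y). Proof. by case: hB => _ h _; apply: h. Qed.
Lemma subringM x y : B x -> B y -> B (x * y). Proof. by case: hB => _ _; apply. Qed.
Lemma subring0 : B 0.
Proof. by rewrite -(subrr 1); apply: subringB; apply: subring1. Qed.
Lemma subringD x y : B x -> B y -> B (x + y).
Proof.
move=> Bx By; rewrite -[y]opprK; apply: subringB => //.
by rewrite -sub0r; apply: subringB => //; apply: subring0.
Qed.
Lemma subringN x : B x -> B (- x).
Proof. by move=> Bx; rewrite -sub0r; apply: subringB => //; apply: subring0. Qed.
Lemma subring_nat n : B n%:R.
Proof.
elim: n => [|n IH]; first exact: subring0.
by rewrite mulrS; apply: subringD => //; apply: subring1.
Qed.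
Lemma subringX x n : B x -> B (x ^+ n).
Proof. by move=> Bx; elim: n => [|n IH]; rewrite ?exprS; [exact: subring1 | exact: subringM]. Qed.
Lemma subring_sum (I : Type) (r : seq I) (P : pred I) (f : I -> K) :
  (forall i, B (f i)) -> B (\sum_(i <- r | P i) f i).
Proof. by move=> Ef; apply: big_ind => //; [exact: subring0 | exact: subringD]. Qed.

Lemma hom1 : phi 1 = 1. Proof. by case: hphi. Qed.
Lemma homB x y : B x -> B y -> phi (x - y) = phi x - phi y.
Proof. by case: hphi => _ h _; apply: h. Qed.
Lemma homM x y : B x -> B y -> phi (x * y) = phi x * phi y.
Proof. by case: hphi => _ _; apply. Qed.
Lemma hom0 : phi 0 = 0.
Proof. by rewrite -(subrr 1) homB ?subrr //; apply: subring1. Qed.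
Lemma homN x : B x -> phi (- x) = - phi x.
Proof. by move=> Bx; rewrite -sub0r homB ?hom0 ?sub0r //; apply: subring0. Qed.
Lemma homD x y : B x -> B y -> phi (x + y) = phi x + phi y.
Proof.
by move=> Bx By; rewrite -[y]opprK homB ?[phi (- _)]homN ?opprK //; apply: subringN.
Qed.
Lemma hom_nat n : phi n%:R = n%:R.
Proof.
elim: n => [|n IH]; first exact: hom0.
rewrite !mulrS homD ?IH ?hom1 //; [exact: subring1 | exact: subring_nat].
Qed.
Lemma hom_sum (I : Type) (r : seq I) (f : I -> K) :
  (forall i, B (f i)) -> phi (\sum_(i <- r) f i) = \sum_(i <- r) phi (f i).
Proof.
move=> Bf; elim: r => [|i r IH]; rewrite ?big_nil ?big_cons ?hom0 //.
by rewrite homD ?IH //; apply: subring_sum.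
Qed.

Lemma hom_coef (p : {poly K}) j : (map_poly phi p)`_j = phi p`_j.
Proof. by rewrite coef_map_id0 ?hom0. Qed.

Lemma hom_polyB (p q : {poly K}) : (forall j, B p`_j) -> (forall j, B q`_j) ->
  map_poly phi (p - q) = map_poly phi p - map_poly phi q.
Proof.
by move=> Bp Bq; apply/polyP => j; rewrite coefB !hom_coef coefB homB.
Qed.

Lemma hom_polyM (p q : {poly K}) : (forall j, B p`_j) -> (forall j, B q`_j) ->
  map_poly phi (p * q) = map_poly phi p * map_poly phi q.
Proof.
move=> Bp Bq; apply/polyP => j; rewrite coefM hom_coef coefM hom_sum.
  by apply: eq_bigr => l _; rewrite homM // !hom_coef.
by move=> l; apply: subringM.
Qed.

End HomOn.

Section PseudoDivision.
Variable K : comNzRingType.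
Implicit Types (B : K -> Prop) (p q r : {poly K}).

Lemma coefs_in_scale B c p : subring B -> B c -> coefs_in B p -> coefs_in B (c *: p).
Proof. by move=> hB Bc Bp j; rewrite coefZ; apply: (subringM hB). Qed.

Lemma pseudo_division B p : subring B -> p != 0 -> coefs_in B p ->
  forall q, coefs_in B q -> exists n q1 r, [/\ coefs_in B q1, coefs_in B r,
    lead_coef p ^+ n *: q = p * q1 + r & (size r < size p)%N].
Proof.
move=> hB p0 Bp q; have [m] := ubnP (size q); elim: m q => // m IH q szq Bq.
have B0 := subring0 hB.
have [lt|le] := ltnP (size q) (size p).
  by exists 0%N, 0, q; split=> //; [move=> j; rewrite coef0|rewrite expr0 scale1r mulr0 add0r].
have sp : (0 < size p)%N by rewrite size_poly_gt0.
have q0 : q != 0 by rewrite -size_poly_gt0 (leq_trans sp).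
pose c := lead_coef p; pose d := (size q - size p)%N.
have Bc : B c by apply: Bp.
have Blq : B (lead_coef q) by apply: Bq.
pose q2 := c *: q - p * (lead_coef q *: 'X^d).
have Bm : coefs_in B (lead_coef q *: 'X^d).
  apply: coefs_in_scale => // j; rewrite coefXn.
  by case: (_ == _) => //; apply: subring1 hB.
have Bq2 : coefs_in B q2.
  move=> j; rewrite coefB; apply: (subringB hB); first exact: coefs_in_scale.
  by rewrite coefM; apply: (subring_sum hB) => l; apply: (subringM hB).
have sq2 : (size q2 < size q)%N.
  rewrite -(prednK (n := size q)) ?size_poly_gt0 // ltnS.
  apply/leq_sizeP => j lej; rewrite coefB coefZ -scalerAr coefZ coefMXn.
  case: ltnP => [lt|ge]; first by move: lt lej; rewrite /d; move: sp le; lia.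
  have [ej|nej] := eqVneq j (size q).-1.
    rewrite ej -[q`_ _]/(lead_coef q).
    have -> : ((size q).-1 - d = (size p).-1)%N by rewrite /d; move: sp le; lia.
    by rewrite -[p`_ _]/c mulrC subrr.
  rewrite !nth_default ?mulr0 ?subrr //; move: nej lej ge sp le; rewrite /d; move: (size q) (size p) => u v; lia.
have [n [q1 [r [Bq1 Br e szr]]]] := IH q2 (leq_trans sq2 szq) Bq2.
exists n.+1, (q1 + lead_coef p ^+ n *: (lead_coef q *: 'X^d)), r; split=> //.
  move=> j; rewrite coefD; apply: (subringD hB) => //.
  by apply: coefs_in_scale => //; apply: (subringX hB).
rewrite exprSr -scalerA -/c.
have -> : c *: q = q2 + p * (lead_coef q *: 'X^d) by rewrite subrK.
by rewrite scalerDr e mulrDr -[p * (_ ^+ n *: _)]scalerAr addrAC.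
Qed.

End PseudoDivision.

(** * Extension of homomorphisms to finitely generated rings *)

Section Specialisation.
Variable K : fieldType.
Implicit Types (B : K -> Prop) (p q r : {poly K}) (a x y z : K).

Lemma adjoin_ring B a : subring B ->
  [/\ subring (adjoin B a), forall z, B z -> adjoin B a z & adjoin B a a].
Proof.
move=> hB; have base z : B z -> adjoin B a z.
  move=> Bz; exists z%:P; rewrite hornerC; split=> // j; rewrite coefC.
  by case: ifP => // _; apply: subring0 hB.
split=> //; last first.
  exists 'X; rewrite hornerX; split=> // j; rewrite coefX.
  by case: (_ == _); [apply: subring1 hB | apply: subring0 hB].
split=> [|x y [p [Bp ->]] [q [Bq ->]]|x y [p [Bp ->]] [q [Bq ->]]].
- by apply: base; apply: subring1 hB.
- exists (p - q); rewrite hornerD hornerN; split=> // j.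
  by rewrite coefB; apply: (subringB hB).
- exists (p * q); rewrite hornerM; split=> // j.
  by rewrite coefM; apply: (subring_sum hB) => l; apply: (subringM hB).
Qed.

(** The value at z is computed on a chosen polynomial expression of z in [a]; the hypothesis on
    equations of [a] makes it independent of the choice. *)
Lemma hom_on_adjoin (L : fieldType) B (phi : K -> L) a w : subring B -> hom_on B phi ->
  (forall q, coefs_in B q -> q.[a] = 0 -> (map_poly phi q).[w] = 0) ->
  exists2 phi', hom_on (adjoin B a) phi' &
    forall q, coefs_in B q -> phi' q.[a] = (map_poly phi q).[w].
Proof.
move=> hB hphi ker.
have /choice [Q hQ] : forall z, exists q, adjoin B a z -> coefs_in B q /\ z = q.[a].
  move=> z; have [[q hq]|n] := pselect (adjoin B a z); first by exists q.
  by exists 0.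
pose phi' z := (map_poly phi (Q z)).[w].
have e q : coefs_in B q -> phi' q.[a] = (map_poly phi q).[w].
  move=> Bq; have [|BQ eQ] := hQ q.[a]; first by exists q.
  apply/eqP; rewrite -subr_eq0 /phi' -hornerN -hornerD -(hom_polyB hB hphi) //.
  apply/eqP/ker; first by move=> j; rewrite coefB; apply: (subringB hB).
  by rewrite hornerD hornerN -eQ subrr.
exists phi' => //; split=> [|x y [p [Bp ->]] [q [Bq ->]]|x y [p [Bp ->]] [q [Bq ->]]].
- have B1 : coefs_in B 1%:P.
    by move=> j; rewrite coefC; case: ifP => _; [apply: subring1 hB | apply: subring0 hB].
  rewrite -(hornerC 1 a) e //.
  have -> : map_poly phi 1%:P = 1%:P.
    apply/polyP => j; rewrite (hom_coef hB hphi) !coefC.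
    by case: ifP => _; rewrite ?(hom1 hphi) ?(hom0 hB hphi).
  by rewrite hornerC.
- rewrite !e // -hornerN -hornerD e; first by rewrite (hom_polyB hB hphi) // hornerD hornerN.
  by move=> j; rewrite coefB; apply: (subringB hB).
- rewrite !e // -hornerM e; first by rewrite (hom_polyM hB hphi) // hornerM.
  by move=> j; rewrite coefM; apply: (subring_sum hB) => l; apply: (subringM hB).
Qed.

Definition fraction_of B z := exists u v, [/\ B u, B v & z = u / v].

Lemma fraction_of_subfield B : subring B -> subfield (fraction_of B).
Proof.
move=> hB; have B0 := subring0 hB; have B1 := subring1 hB.
have nz z : fraction_of B z -> exists u v, [/\ B u, B v, v != 0 & z = u / v].
  case=> u [v [Bu Bv ->]]; have [->|v0] := eqVneq v 0; last by exists u, v.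
  by exists 0, 1; split; rewrite ?oner_neq0 // invr0 mulr0 mul0r.
split=> [|z z' /nz [u [v [Bu Bv v0 ->]]] /nz [u' [v' [Bu' Bv' v0' ->]]]|
          z z' [u [v [Bu Bv ->]]] [u' [v' [Bu' Bv' ->]]]].
- by exists 1, 1; rewrite divr1.
- exists (u * v' - u' * v), (v * v'); split.
  + by apply: (subringB hB); apply: (subringM hB).
  + exact: (subringM hB).
  + by field; rewrite v0 v0'.
- exists (u * v'), (v * u'); split; try exact: (subringM hB).
  by rewrite !invfM invrK; ring.
Qed.

Lemma clear_denominators B p : subring B -> coefs_in (fraction_of B) p ->
  exists d, [/\ d != 0, B d & coefs_in B (d *: p)].
Proof.
move=> hB; elim/poly_ind: p => [|p c IH] h.
  exists 1; split; rewrite ?oner_neq0 //; first exact: subring1 hB.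
  by move=> j; rewrite scaler0 coef0; apply: subring0 hB.
have [|d [d0 Bd Bdp]] := IH; first by move=> j; have := h j.+1; rewrite coefD coefMX coefC addr0.
have [u [v [Bu Bv ec]]] : fraction_of B c by have := h 0%N; rewrite coefD coefMX coefC add0r.
have [v' [v0' Bv' Bcv]] : exists v', [/\ v' != 0, B v' & B (c * v')].
  have [v0|v0] := eqVneq v 0.
    exists 1; rewrite ec v0 invr0 mulr0 mul0r oner_neq0.
    by split=> //; [apply: subring1 hB|apply: subring0 hB].
  by exists v; rewrite ec divfK.
exists (v' * d); split; rewrite ?mulf_neq0 //; first exact: (subringM hB).
move=> j; rewrite coefZ coefD coefMX coefC; case: j => [|j] /=.
  by rewrite add0r [v' * d]mulrC -mulrA [v' * c]mulrC; apply: (subringM hB).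
by rewrite addr0 -mulrA; apply: (subringM hB) => //; have := Bdp j; rewrite coefZ.
Qed.

(** [r] is algebraic over the fractions of [B]; an equation h(r) r + c = 0 over [B] with c != 0
    yields r h(r) = -c. *)
Lemma adjoin_divides_base B a p (r : K) : subring B -> p != 0 -> coefs_in B p -> p.[a] = 0 ->
  adjoin B a r -> r != 0 -> exists2 r', adjoin B a r' & B (r * r') /\ r * r' != 0.
Proof.
move=> hB p0 Bp pa Ar r0.
have [hA base _] := adjoin_ring a hB.
pose E := fraction_of B; have hE : subfield E := fraction_of_subfield hB.
have BE z : B z -> E z by move=> Bz; exists z, 1; rewrite divr1; split=> //; apply: subring1 hB.
have aE : algebraic_over E a by exists p; split=> // j; apply: BE.
have hL := adjoin_subfield hE aE.
have EL z : E z -> adjoin E a z by apply: adjoin_base.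
have Lr : adjoin E a r by case: Ar => q [Bq ->]; exists q; split=> // j; apply: BE.
have [n _ d] := ffinite_fdegree hE EL hL (adjoin_ffinite hE aE).
have [h [h0 Eh _ hr]] := fdegree_annul hE hL d Lr.
have [e [e0 Be Beh]] := clear_denominators hB Eh.
have : exists h', [/\ h' != 0, coefs_in B h' & h'.[r] = 0].
  by exists (e *: h); rewrite scaler_eq0 negb_or e0 h0 hornerZ hr mulr0.
case=> h' [{h h0 Eh hr d e e0 Be Beh} h0 Bh hr].
elim/poly_ind: h' h0 Bh hr => [|h c IH]; first by rewrite eqxx.
move=> nz Bh; rewrite hornerMXaddC.
have Bh' : coefs_in B h by move=> j; have := Bh j.+1; rewrite coefD coefMX coefC addr0.
have Bc : B c by have := Bh 0%N; rewrite coefD coefMX coefC add0r.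
have [c0|c0] := eqVneq c 0.
  rewrite c0 addr0 => /eqP; rewrite mulf_eq0 (negPf r0) orbF => /eqP; apply: IH => //.
  by apply: contra_neq nz => ->; rewrite c0 mul0r addr0.
move/eqP; rewrite addr_eq0 => /eqP ehr; exists h.[r]; last first.
  by rewrite mulrC ehr oppr_eq0; split=> //; apply: (subringN hB).
rewrite horner_coef; apply: (subring_sum hA) => j.
by apply: (subringM hA); [apply: base | apply: (subringX hA)].
Qed.

(* Going up in the form of extension of homomorphisms into closed fields, away
   from the zero locus of one element b. *)
Lemma extend_hom_step B a (r : K) : subring B -> adjoin B a r -> r != 0 ->
  exists b, [/\ B b, b != 0 & forall (L : closedFieldType) (phi : K -> L),
    hom_on B phi -> phi b != 0 -> exists phi', [/\ hom_on (adjoin B a) phi',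
      forall z, B z -> phi' z = phi z & phi' r != 0]].
Proof.
move=> hB [q [Bq er]] r0.
have [hA baseA _] := adjoin_ring a hB.
have restrict (L : closedFieldType) (phi phi' : K -> L) w : hom_on B phi ->
    (forall q, coefs_in B q -> phi' q.[a] = (map_poly phi q).[w]) ->
    forall z, B z -> phi' z = phi z.
  move=> hphi e z Bz; rewrite -{1}(hornerC z a) e.
    have -> : map_poly phi z%:P = (phi z)%:P.
      apply/polyP => j; rewrite (hom_coef hB hphi) !coefC.
      by case: ifP => // _; rewrite (hom0 hB hphi).
    by rewrite hornerC.
  by move=> j; rewrite coefC; case: ifP => // _; apply: subring0 hB.
have [alg|tr] := pselect (exists p, [/\ p != 0, coefs_in B p & p.[a] = 0]); last first.
  have q0 : q != 0 by apply: contra_neq r0 => q0; rewrite er q0 horner0.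
  (* For [a] transcendental, the image of [q] stays non-zero when its leading coefficient does, and
     [a] is sent to a point that is not a root. *)
  exists (lead_coef q); split; rewrite ?lead_coef_eq0 //; first exact: Bq.
  move=> L phi hphi nz.
  have nzq : map_poly phi q != 0.
    apply: contra_neq nz => /(congr1 (fun p : {poly L} => p`_(size q).-1)).
    by rewrite (hom_coef hB hphi) coef0.
  have /closed_nonrootP [w nr] := nzq.
  have [|phi' hphi' e] := @hom_on_adjoin L B phi a w hB hphi.
    move=> p Bp pa; have -> : p = 0 by apply: contrapT => /eqP p0; apply: tr; exists p.
    by rewrite map_poly0 horner0.
  exists phi'; split=> //; first exact: restrict e.
  by rewrite er e.
(* By minimality of its degree, [p] divides every equation of [a] up to a power of its leading
   coefficient. *)
have [p [p0 Bp pa pmin]] : exists p, [/\ p != 0, coefs_in B p, p.[a] = 0 &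
    forall h, coefs_in B h -> h.[a] = 0 -> (size h < size p)%N -> h = 0].
  pose P n := `[< exists p, [/\ p != 0, coefs_in B p, p.[a] = 0 & size p = n] >].
  have ex : exists n, P n by case: alg => p [p0 Bp pa]; exists (size p); apply/asboolP; exists p.
  case: (ex_minnP ex) => n /asboolP [p [p0 Bp pa sp]] min; exists p; split=> // h Bh ha lt.
  apply: contrapT => /eqP h0; have /min : P (size h) by apply/asboolP; exists h.
  by rewrite -sp leqNgt lt.
have [|r' Ar' [Brr nzrr]] := adjoin_divides_base hB p0 Bp pa _ r0; first by exists q.
have Bc : B (lead_coef p) by apply: Bp.
(* The first factor keeps the image of [p] non-constant, so that it has a root; the second is a
   multiple of [r] in [B], so that the image of [r] is not 0. *)
exists (lead_coef p * (r * r')); split.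
- exact: (subringM hB).
- by rewrite mulf_neq0 // lead_coef_eq0.
move=> L phi hphi; rewrite (homM hphi) // mulf_eq0 negb_or => /andP [nzc nzr].
have szp : (1 < size p)%N.
  rewrite ltnNge; apply/negP => le; move: pa p0.
  by rewrite (size1_polyC le) hornerC => ->; rewrite polyC0 eqxx.
have /closed_rootP [w rw] : size (map_poly phi p) != 1%N.
  suff : (size p <= size (map_poly phi p))%N by move: szp; move: (size _) (size p) => u v; lia.
  rewrite leqNgt; apply: contra nzc => lt.
  rewrite /lead_coef -(hom_coef hB hphi) nth_default //.
  by move: lt; case: (size p).
have [|phi' hphi' e] := @hom_on_adjoin L B phi a w hB hphi.
  move=> h Bh ha; have [n [h1 [rr [Bh1 Br eh szr]]]] := pseudo_division hB p0 Bp Bh.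
  have rr0 : rr = 0.
    apply: pmin => //; have := congr1 (fun f => f.[a]) eh.
    by rewrite hornerZ ha mulr0 hornerD hornerM pa mul0r add0r => <-.
  have := congr1 (fun f => (map_poly phi f).[w]) eh.
  rewrite rr0 addr0 (hom_polyM hB hphi) // hornerM (rootP rw) mul0r.
  have -> : map_poly phi (lead_coef p ^+ n *: h) = phi (lead_coef p ^+ n) *: map_poly phi h.
    apply/polyP => j; rewrite coefZ !(hom_coef hB hphi) coefZ (homM hphi) //.
    exact: (subringX hB).
  rewrite hornerZ => /eqP; rewrite mulf_eq0 => /orP [|/eqP //].
  have -> : phi (lead_coef p ^+ n) = phi (lead_coef p) ^+ n.
    elim: n {eh} => [|n IH]; first exact: (hom1 hphi).
    by rewrite !exprS (homM hphi) ?IH //; apply: (subringX hB).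
  by rewrite expf_eq0 (negPf nzc) andbF.
have rs := restrict _ _ _ _ hphi e.
exists phi'; split=> //; apply: contraNneq nzr => h.
rewrite -(rs _ Brr) (homM hphi') ?h ?mul0r //; by exists q.
Qed.

Fixpoint adjoin_list B (g : seq K) : K -> Prop :=
  if g is a :: g' then adjoin_list (adjoin B a) g' else B.

Lemma adjoin_list_ring B g : subring B ->
  [/\ subring (adjoin_list B g), forall z, B z -> adjoin_list B g z
    & forall a, a \in g -> adjoin_list B g a].
Proof.
elim: g B => [|a g IH] B hB //=.
have [hA bA gA] := adjoin_ring a hB; have [h b m] := IH _ hA.
split=> // [z /bA /b //|c]; rewrite inE => /orP [/eqP ->|/m //]; exact: b.
Qed.

Lemma extend_hom B g : subring B ->
  forall r : K, adjoin_list B g r -> r != 0 ->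
  exists b, [/\ B b, b != 0 & forall (L : closedFieldType) (phi : K -> L),
    hom_on B phi -> phi b != 0 -> exists phi', [/\ hom_on (adjoin_list B g) phi',
      forall z, B z -> phi' z = phi z & phi' r != 0]].
Proof.
elim: g B => [|a g IH] B hB r /= Br r0.
  by exists r; split=> // L phi hphi nz; exists phi.
have [hA bA gA] := adjoin_ring a hB.
have [b1 [Ab1 nz1 ext1]] := IH _ hA r Br r0.
have [b [Bb nzb ext]] := extend_hom_step hB Ab1 nz1.
exists b; split=> // L phi hphi nz.
have [phi1 [h1 e1 n1]] := ext L phi hphi nz.
have [phi2 [h2 e2 n2]] := ext1 L phi1 h1 n1.
exists phi2; split=> // z Bz; rewrite e2 ?e1 //; exact: bA.
Qed.

End Specialisation.

Section RationalFunctionClosure.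

(** The field Q(t). Countability, obtained from representatives of fractions, is what
    [countable_algebraic_closure] requires. *)
Definition Qt : Type := {fraction {poly rat}}.
HB.instance Definition _ := GRing.Field.on Qt.
Definition Qt_ratio : Type := ratio {poly rat}.
HB.instance Definition _ := [isSub of Qt_ratio for (@frac {poly rat})].
HB.instance Definition _ := [Countable of Qt_ratio by <:].
Fact Qt_reprK : cancel (repr : Qt -> Qt_ratio) (\pi_(Qt)%qT : Qt_ratio -> Qt).
Proof. exact: reprK. Qed.
HB.instance Definition _ := CanIsCountable Qt_reprK.

End RationalFunctionClosure.

Definition int_sub (K : nzRingType) (z : K) : Prop := exists n : int, z = n%:~R.

Lemma int_sub_ring (K : nzRingType) : subring (@int_sub K).
Proof.
split=> [|x y [n ->] [m ->]|x y [n ->] [m ->]]; first by exists 1.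
- by exists (n - m); rewrite rmorphB.
- by exists (n * m); rewrite rmorphM.
Qed.

Definition char_zero (K : nzRingType) := forall n, (0 < n)%N -> n%:R != 0 :> K.

Lemma char_zero_int (K : nzRingType) (n : int) : char_zero K -> n%:~R = 0 :> K -> n = 0.
Proof.
move=> cK; case: (intP n) => // m.
  by move/eqP; rewrite -[_%:~R]/(m.+1%:R) (negPf (cK _ _)).
by rewrite rmorphN /= => /eqP; rewrite oppr_eq0 -[_%:~R]/(m.+1%:R) (negPf (cK _ _)).
Qed.

Lemma int_hom (K L : nzRingType) : char_zero K ->
  exists2 phi : K -> L, hom_on (@int_sub K) phi & forall n : int, phi n%:~R = n%:~R.
Proof.
move=> cK; have /choice [c hc] : forall z : K, exists n : int, int_sub z -> z = n%:~R.
  by move=> z; have [[n e]|no] := pselect (int_sub z); [exists n | exists 0].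
have e n : (c n%:~R)%:~R = n%:~R :> L.
  congr (_%:~R); apply/eqP; rewrite eq_sym -subr_eq0; apply/eqP.
  apply: (char_zero_int cK); rewrite rmorphB /= -hc ?subrr //; by exists n.
exists (fun z => (c z)%:~R) => //; split=> [|x y [n ->] [m ->]|x y [n ->] [m ->]].
- exact: (e 1).
- by rewrite -rmorphB !e rmorphB.
- by rewrite -rmorphM !e rmorphM.
Qed.

Lemma nat_nonroot (K : fieldType) (p : {poly K}) : char_zero K -> p != 0 ->
  exists n : nat, p.[n%:R] != 0.
Proof.
move=> cK p0; apply: contrapT => none.
have inj : injective (fun n : nat => n%:R : K).
  have lemma m n : (m < n)%N -> m%:R != n%:R :> K.
    by move=> lt; rewrite eq_sym -subr_eq0 -natrB ?(ltnW lt) // cK // subn_gt0.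
  by move=> m n e; case: (ltngtP m n) => // lt; have := lemma _ _ lt; rewrite e eqxx.
pose r := [seq n%:R : K | n <- iota 0 (size p)].
have : (size r < size p)%N.
  apply: max_poly_roots => //; last by rewrite map_inj_uniq ?iota_uniq.
  apply/allP => z /mapP [n _ ->]; apply/rootP/eqP/negP => /negP h.
  by apply: none; exists n.
by rewrite size_map size_iota ltnn.
Qed.

(** * A chain of four primes from two independent elements *)

Section PrimeChain.
Variables (R : idomainType) (gens : seq R).
Hypothesis gensP : forall S : R -> Prop, subring S -> (forall a, a \in gens -> S a) ->
  forall r, S r.

Definition ring_hom (L : nzRingType) (f : R -> L) := hom_on (fun _ => True) f.

(** The image of [f] lies in the ring generated over [B] by the images of the generators of R, to
    which homomorphisms of [B] extend. *)
Lemma specialise (L : fieldType) (f : R -> L) (B : L -> Prop) : ring_hom f -> subring B ->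
  exists b, [/\ B b, b != 0 & forall (M : closedFieldType) (phi : L -> M),
   hom_on B phi -> phi b != 0 -> exists F : R -> M, [/\ ring_hom F,
     forall r, B (f r) -> F r = phi (f r) & forall r, f r = 0 -> F r = 0]].
Proof.
move=> hf hB; pose g := map f gens.
have [hS BS gS] := adjoin_list_ring g hB.
have Sf r : adjoin_list B g (f r).
  apply: (gensP (S := fun r => adjoin_list B g (f r))) => [|a ag]; last exact/gS/map_f.
  split=> [|x y hx hy|x y hx hy].
  - by rewrite (hom1 hf); apply: subring1 hS.
  - by rewrite (homB hf) //; apply: (subringB hS).
  - by rewrite (homM hf) //; apply: (subringM hS).
have [b [Bb b0 ext]] := extend_hom hB (subring1 hS) (oner_neq0 _).
exists b; split=> // M phi hphi nz; have [phi' [h' e' _]] := ext M phi hphi nz.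
exists (phi' \o f); split=> [|r Br|r fr] /=; last by rewrite fr (hom0 hS h').
  split=> [|x y _ _|x y _ _] /=.
  - by rewrite (hom1 hf) (hom1 h').
  - by rewrite (homB hf) // (homB h').
  - by rewrite (homM hf) // (homM h').
exact: e'.
Qed.

Lemma kernel_prime (L : idomainType) (f : R -> L) : ring_hom f ->
  prime_ideal (fun r => f r == 0).
Proof.
have hT : subring (fun _ : R => True) by [].
move=> hf; split; first split.
- by rewrite unfold_in (hom0 hT hf).
- by rewrite unfold_in (hom1 hf) oner_eq0.
- move=> a u v; rewrite !unfold_in => /eqP u0 /eqP v0.
  by rewrite (homD hT hf) // (homM hf) // u0 v0 mulr0 addr0.
by move=> u v; rewrite !unfold_in (homM hf) // mulf_eq0.
Qed.

(** The primes are the kernels of successive specialisations: [x0] becomes a natural number, then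
    [y0] does, then a prime number becomes 0. Each value is chosen so that the element [b] of
    [specialise] survives. *)
Lemma long_prime_chain (K : fieldType) (f : R -> K) (x0 y0 : R) :
  char_zero K -> ring_hom f -> injective f ->
  (forall q, coefs_in (@int_sub K) q -> q.[f y0] = 0 -> q = 0) ->
  (forall q, coefs_in (adjoin (@int_sub K) (f y0)) q -> q.[f x0] = 0 -> q = 0) ->
  exists P : nat -> {pred R}, prime_chain 3 P.
Proof.
move=> cK hf fI trY trX; set y := f y0; set x := f x0.
have hT : subring (fun _ : R => True) by [].
(* The first specialisation [F1] sends [x0] to a natural number and [y0] to the transcendental [t]
   of this closed field. *)
have [M1 [toM1 _]] := countable_algebraic_closure Qt.
pose tau : {rmorphism {poly rat} -> M1} := toM1 \o (@tofrac {poly rat} : {rmorphism {poly rat} -> Qt}).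
have tau0 p : tau p = 0 -> p = 0.
  by move=> /eqP; rewrite /= fmorph_eq0 => h; apply/eqP; rewrite -tofrac_eq0.
pose t : M1 := tau 'X.
have cM1 : char_zero M1.
  move=> n n0; apply/eqP; rewrite -(rmorph_nat tau) => /tau0 /eqP.
  by rewrite -polyC_natr polyC_eq0 pnatr_eq0 -leqn0 leqNgt n0.
have trt q : coefs_in (@int_sub M1) q -> q.[t] = 0 -> q = 0.
  move=> /choice [c hc] qt; pose q' : {poly rat} := \poly_(j < size q) (c j)%:~R.
  have e : tau q' = q.[t].
    rewrite horner_coef /q' poly_def rmorph_sum; apply: eq_bigr => j _.
    rewrite -mul_polyC rmorphM rmorphXn -/t hc; congr (_ * _).
    by rewrite rmorph_int rmorph_int.
  have q'0 : q' = 0 by apply: tau0; rewrite e.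
  apply/polyP => j; rewrite coef0; have [lt|le] := ltnP j (size q); last by rewrite nth_default.
  have := congr1 (fun r : {poly rat} => r`_j) q'0; rewrite coef0 coef_poly lt hc => h.
  by have -> : c j = 0 by apply/eqP; rewrite -(intr_eq0 rat) h.
have hZK := int_sub_ring K; have hZ1 := int_sub_ring M1.
have [phi0 hphi0 ephi0] := @int_hom K M1 cK.
have map0 (L : fieldType) (phi : K -> L) q : hom_on (@int_sub K) phi -> (forall n : int, phi n%:~R = n%:~R) ->
    coefs_in (@int_sub K) q -> coefs_in (@int_sub L) (map_poly phi q).
  by move=> hphi e Bq j; rewrite (hom_coef hZK hphi); have [n ->] := Bq j; exists n; rewrite e.
pose B1 := adjoin (@int_sub K) y.
have [hB1 ZB1 B1y] := adjoin_ring y hZK.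
have [|phi1 hphi1 ephi1] := @hom_on_adjoin _ M1 _ phi0 y t hZK hphi0.
  by move=> q Bq /trY -> //; rewrite map_poly0 horner0.
have phi1_inj z : B1 z -> phi1 z = 0 -> z = 0.
  case=> q [Bq ->]; rewrite ephi1 // => /trt h.
  have q0 : map_poly phi0 q = 0 by apply: h; apply: map0.
  suff -> : q = 0 by rewrite horner0.
  apply/polyP => j; have := congr1 (fun r : {poly M1} => r`_j) q0.
  rewrite (hom_coef hZK hphi0) !coef0; have [n ->] := Bq j.
  by rewrite ephi0 => /(char_zero_int cM1) ->.
pose B2 := adjoin B1 x.
have [hB2 B12 B2x] := adjoin_ring x hB1.
have [b [[p [Bp eb]] b0 ext1]] := specialise hf hB2.
have p0 : map_poly phi1 p != 0.
  have pn : p != 0 by apply: contra_neq b0 => p0; rewrite eb p0 horner0.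
  have : lead_coef p != 0 by rewrite lead_coef_eq0.
  apply: contra_neq => /(congr1 (fun r : {poly M1} => r`_(size p).-1)).
  by rewrite (hom_coef hB1 hphi1) coef0 => /phi1_inj h; apply: h; apply: Bp.
have [c nc] := nat_nonroot cM1 p0.
have [|phi2 hphi2 ephi2] := @hom_on_adjoin _ M1 _ phi1 x c%:R hB1 hphi1.
  by move=> q Bq /trX -> //; rewrite map_poly0 horner0.
have [|F1 [hF1 eF1 kF1]] := ext1 M1 phi2 hphi2; first by rewrite eb ephi2.
have gen_val (L M : fieldType) (S : L -> Prop) (psi psi' : L -> M) (a : L) w :
    subring S -> hom_on S psi ->
    (forall q, coefs_in S q -> psi' q.[a] = (map_poly psi q).[w]) ->
    psi' a = w /\ forall z, S z -> psi' z = psi z.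
  move=> hS hpsi e; have S0 := subring0 hS; have S1 := subring1 hS; split.
    rewrite -{1}[a]hornerX e; last by move=> j; rewrite coefX; case: (_ == _).
    have -> : map_poly psi 'X = 'X.
      apply/polyP => j; rewrite (hom_coef hS hpsi) !coefX.
      by case: (_ == _); rewrite ?(hom1 hpsi) ?(hom0 hS hpsi).
    by rewrite hornerX.
  move=> z Sz; rewrite -{1}(hornerC z a) e; last first.
    by move=> j; rewrite coefC; case: ifP.
  have -> : map_poly psi z%:P = (psi z)%:P.
    apply/polyP => j; rewrite (hom_coef hS hpsi) !coefC.
    by case: ifP => // _; rewrite (hom0 hS hpsi).
  by rewrite hornerC.
have [phi1y phi1Z] := gen_val _ _ _ _ _ _ _ hZK hphi0 ephi1.
have [phi2x phi2B] := gen_val _ _ _ _ _ _ _ hB1 hphi1 ephi2.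
have F1x : F1 x0 = c%:R by rewrite eF1.
have F1y : F1 y0 = t by rewrite eF1 ?phi2B //; apply: B12.
have [hBt ZBt Btt] := adjoin_ring t hZ1.
have {ext1} [b1 [[p1 [Bp1 eb1]] b10 ext2]] := specialise hF1 hBt.
have cC : char_zero algC by move=> n n0; rewrite pnatr_eq0 -lt0n.
have [psi0 hpsi0 epsi0] := @int_hom M1 algC cM1.
have p10 : map_poly psi0 p1 != 0.
  have pn : p1 != 0 by apply: contra_neq b10 => p10; rewrite eb1 p10 horner0.
  have : lead_coef p1 != 0 by rewrite lead_coef_eq0.
  apply: contra_neq => /(congr1 (fun r : {poly algC} => r`_(size p1).-1)).
  rewrite (hom_coef hZ1 hpsi0) coef0 /lead_coef; have [n ->] := Bp1 (size p1).-1.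
  by rewrite epsi0 => /(char_zero_int cC) ->.
have [c' nc'] := nat_nonroot cC p10.
have [|psi1 hpsi1 epsi1] := @hom_on_adjoin _ algC _ psi0 t c'%:R hZ1 hpsi0.
  by move=> q Bq /trt -> //; rewrite map_poly0 horner0.
have [psi1t psi1Z] := gen_val _ _ _ _ _ _ _ hZ1 hpsi0 epsi1.
have [|F2 [hF2 eF2 kF2]] := ext2 algC psi1 hpsi1; first by rewrite eb1 epsi1.
have F2y : F2 y0 = c'%:R by rewrite eF2 F1y.
have [b2 [[n eb2] b20 ext3]] := specialise hF2 (int_sub_ring algC).
(* A prime above the absolute value of the non-zero integer [b2] does not divide it. *)
have [p' ltp p'_pr] := prime_above `|n|.
have [M3 [toM3 _]] := countable_algebraic_closure 'F_p'.
have [chi0 hchi0 echi0] := @int_hom algC M3 cC.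
have [|F3 [hF3 eF3 kF3]] := ext3 M3 chi0 hchi0.
  have nn0 : n != 0 by apply: contra_neq b20 => n0; rewrite eb2 n0.
  have ndvd : ~~ (p' %| `|n|)%N.
    by apply/negP => /dvdn_leq; rewrite absz_gt0 nn0 leqNgt ltp => /(_ isT).
  have nz : (`|n|%N)%:R != 0 :> M3.
    by rewrite -(rmorph_nat toM3) fmorph_eq0 -(dvdn_pcharf (pchar_Fp p'_pr)).
  rewrite eb2 echi0; case: (intP n) nz => // m; rewrite ?abszN absz_nat => nz //.
  by rewrite rmorphN oppr_eq0.
have F3p : F3 p'%:R = 0.
  by rewrite (hom_nat hT hF3) -(rmorph_nat toM3) (pchar_Fp_0 p'_pr) rmorph0.
pose P (j : nat) : {pred R} := match j with
  0 => fun r => f r == 0 | 1 => fun r => F1 r == 0 | 2 => fun r => F2 r == 0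
  | _ => fun r => F3 r == 0 end.
exists P; split=> [[|[|[|j]]] _|].
- exact: kernel_prime hf.
- exact: kernel_prime hF1.
- exact: kernel_prime hF2.
- exact: kernel_prime hF3.
have hsub (L M : fieldType) (G : R -> L) (G' : R -> M) (r : R) : ring_hom G -> ring_hom G' ->
  forall n : nat, G' r = n%:R -> G r != n%:R ->
  (r - n%:R \in (fun r => G' r == 0)) && (r - n%:R \notin (fun r => G r == 0)).
  move=> hG hG' m e ne; rewrite !unfold_in (homB hG') // (homB hG) // (hom_nat hT hG') (hom_nat hT hG) e subrr eqxx.
  by rewrite subr_eq0.
case=> [|[|[|//]]] _; split.
- by move=> r; rewrite !unfold_in => /eqP /kF1 ->.
- exists (x0 - c%:R); apply: hsub => //; apply/negP => /eqP e.
  have q0 : 'X - c%:R%:P = 0 :> {poly K}.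
    apply: trX; last by rewrite hornerD hornerN hornerX hornerC /x e subrr.
    move=> j; rewrite coefB coefX coefC; apply: (subringB hB1); first by case: (_ == _); [exact: subring1 hB1|exact: subring0 hB1].
    by case: (_ == _) => /=; [exact: (subring_nat hB1 c)|exact: subring0 hB1].
  by have /eqP := q0; rewrite polyXsubC_eq0.
- by move=> r; rewrite !unfold_in => /eqP /kF2 ->.
- exists (y0 - c'%:R); apply: hsub => //; rewrite F1y; apply/negP => /eqP e.
  have q0 : 'X - c'%:R%:P = 0 :> {poly M1}.
    apply: trt; last by rewrite hornerD hornerN hornerX hornerC e subrr.
    move=> j; rewrite coefB coefX coefC; apply: (subringB hZ1); first by case: (_ == _); [exact: subring1 hZ1|exact: subring0 hZ1].
    by case: (_ == _) => /=; [exact: (subring_nat hZ1 c')|exact: subring0 hZ1].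
  by have /eqP := q0; rewrite polyXsubC_eq0.
- by move=> r; rewrite !unfold_in => /eqP /kF3 ->.
- exists p'%:R; rewrite !unfold_in F3p eqxx (hom_nat hT hF2) /=.
  by rewrite pnatr_eq0 -lt0n prime_gt0.
Qed.
End PrimeChain.

Section RatCharZero.
Variable K : fieldType.
Hypothesis cK : char_zero K.

Lemma intr_char_zero_eq0 (n : int) : (n%:~R == 0 :> K) = (n == 0).
Proof. by apply/eqP/eqP => [/(char_zero_int cK)|->]. Qed.

Lemma ratr_frac (a b : int) : b != 0 -> ratr (a%:~R / b%:~R : rat) = a%:~R / b%:~R :> K.
Proof.
move=> b0; set x := (_ / _ : rat).
have e : numq x * b = a * denq x.
  apply: (@intr_inj rat); rewrite !rmorphM /=.
  have d0 : (denq x)%:~R != 0 :> rat by rewrite intr_eq0 denq_eq0.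
  have b0' : b%:~R != 0 :> rat by rewrite intr_eq0.
  have nx : (numq x)%:~R = x * (denq x)%:~R :> rat.
    by rewrite -{2}[x]divq_num_den divfK.
  by rewrite nx mulrAC /x divfK.
rewrite /ratr; apply/eqP; rewrite eqr_div ?intr_char_zero_eq0 ?denq_eq0 //.
by rewrite -!intrM e.
Qed.

Lemma rat_embedding : exists i : {rmorphism rat -> K}, forall r, i r = ratr r.
Proof.
have d0 (x : rat) : (denq x)%:~R != 0 :> K by rewrite intr_char_zero_eq0 denq_eq0.
have d0' (x : rat) : (denq x)%:~R != 0 :> rat by rewrite intr_eq0 denq_eq0.
have add : zmod_morphism (@ratr K).
  move=> x y; have -> : x - y = (numq x * denq y - numq y * denq x)%:~R / (denq x * denq y)%:~R.
    rewrite -{1}[x]divq_num_den -{1}[y]divq_num_den !rmorphB !rmorphM /=.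
    by field; rewrite !d0'.
  rewrite ratr_frac ?mulf_neq0 ?denq_eq0 // /ratr !rmorphB !rmorphM /=.
  by field; rewrite !d0.
have mul : monoid_morphism (@ratr K).
  split=> [|x y]; first by rewrite -[1]divr1 -[1 / 1]/(1%:~R / 1%:~R) ratr_frac // divr1.
  have -> : x * y = (numq x * numq y)%:~R / (denq x * denq y)%:~R.
    rewrite -{1}[x]divq_num_den -{1}[y]divq_num_den !rmorphM /=.
    by field; rewrite !d0'.
  rewrite ratr_frac ?mulf_neq0 ?denq_eq0 // /ratr !rmorphM /=.
  by field; rewrite !d0.
pose M1 := GRing.isZmodMorphism.Build _ _ _ add.
pose M2 := GRing.isMonoidMorphism.Build _ _ _ mul.
by exists (HB.pack (@ratr K) M1 M2 : {rmorphism rat -> K}).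
Qed.
End RatCharZero.

Lemma fraction_ratio (R : idomainType) (z : {fraction R}) : exists a b : R, z = tofrac a / tofrac b.
Proof.
elim/quotW: z => x; exists (\n_x), (\d_x).
have d0 : tofrac (\d_x) != 0 :> {fraction R} by rewrite tofrac_eq0 denom_ratioP.
apply: (mulIf d0); rewrite divfK //.
transitivity (FracField.mul (\pi_(FracField.type R)%qT x) (FracField.tofrac (\d_x))); first by [].
unlock FracField.tofrac; rewrite -FracField.pi_mul.
apply/eqmodP; rewrite /= FracField.equivfE /FracField.mulf.
rewrite !numden_Ratio ?(oner_eq0, mulf_neq0, denom_ratioP) //.
by rewrite !mulr1 mulrC.
Qed.

(** * Orbits of units under semilinear maps *)

Section UnitLattice.
Variables (s : nat) (R : idomainType) (chi : 'rV[int]_s -> R).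
Local Notation V := 'rV[int]_s.
Local Notation K := {fraction R}.
Hypothesis s_gt1 : (1 < s)%N.
Hypothesis R0 : Z_torsion_free R.
Hypothesis chiD : forall u v, chi (u + v) = chi u * chi v.
Hypothesis chi0 : chi 0 = 1.
Hypothesis chi_span : forall S : R -> Prop, S 0 -> (forall x y, S x -> S y -> S (x - y)) ->
  (forall v, S (chi v)) -> forall r, S r.
Hypothesis krull : forall l (P : nat -> {pred R}), prime_chain l P -> (l <= 2)%N.
Hypothesis chi_nalg : forall v, v != 0 ->
  ~ algebraicOver (ratr : rat -> K) (tofrac (chi v)).

Let chiK v : K := tofrac (chi v).

Lemma fraction_char_zero : char_zero K.
Proof.
move=> n n0; rewrite -(rmorph_nat (@tofrac R)) tofrac_eq0; apply/eqP => h.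
have [|e|/eqP] := R0 (n := n) (x := 1); first by rewrite h.
  by rewrite e in n0.
by rewrite oner_eq0.
Qed.

Lemma tofrac_hom : ring_hom (@tofrac R).
Proof. by split=> [|x y _ _|x y _ _]; rewrite ?rmorph1 ?rmorphB ?rmorphM. Qed.

Variable i : {rmorphism rat -> K}.
Hypothesis iE : forall r, i r = ratr r.

Lemma chi_transcendental v : v != 0 -> transcendental i (chiK v).
Proof.
move=> v0; apply/transcendental_nalg => -[p p0 h]; apply: (chi_nalg v0); exists p; first exact: p0.
have -> : map_poly ratr p = map_poly i p by apply: eq_map_poly => r; rewrite iE.
exact: h.
Qed.

Lemma int_coefs_rat (L : fieldType) (j : {rmorphism rat -> L}) (q : {poly L}) :
  coefs_in (@int_sub L) q -> exists f : {poly rat}, map_poly j f = q.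
Proof.
move=> /choice [c hc]; exists (\poly_(l < size q) (c l)%:~R).
apply/polyP => l; rewrite coef_map /= coef_poly; case: ltnP => [_|le].
  by rewrite rmorph_int -hc.
by rewrite rmorph0 nth_default.
Qed.

Lemma tofrac_injective : injective (@tofrac R).
Proof.
by move=> x y /eqP; rewrite -subr_eq0 -rmorphB tofrac_eq0 subr_eq0 => /eqP.
Qed.

(** The inverses are listed too, as a subring need not contain them. *)
Definition lattice_generators : seq R :=
  [seq chi (delta_mx 0 j) | j : 'I_s] ++ [seq chi (- delta_mx 0 j) | j : 'I_s].

Lemma lattice_generate (S : R -> Prop) : subring S ->
  (forall a, a \in lattice_generators -> S a) -> forall r, S r.
Proof.
move=> hS gS; apply: chi_span; first exact: subring0 hS.
  exact: (subringB hS).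
move=> v; rewrite [v]row_sum_delta.
apply: (big_ind (fun u => S (chi u))) => [|u w Su Sw|j _].
- by rewrite chi0; apply: subring1 hS.
- by rewrite chiD; apply: (subringM hS).
have step u : S (chi u) -> forall n, S (chi (u *+ n)).
  move=> Su; elim=> [|n IH]; first by rewrite mulr0n chi0; apply: subring1 hS.
  by rewrite mulrS chiD; apply: (subringM hS).
case: (v 0 j) => n.
  rewrite -natz scaler_nat; apply: step; apply: gS.
  by rewrite mem_cat map_f ?mem_enum.
rewrite NegzE scaleNr -natz scaler_nat -mulNrn; apply: step; apply: gS.
by rewrite mem_cat [X in _ || X]map_f ?mem_enum ?orbT.
Qed.

(** Two algebraically independent values would yield a chain of primes of length 3. *)
Lemma chi_dependent v w : v != 0 -> exists2 P, P != 0 & ev2 i (chiK v) (chiK w) P = 0.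
Proof.
move=> v0; apply: contrapT => indep_vw.
have ty := chi_transcendental v0.
have [||P /krull //] := long_prime_chain lattice_generate (x0 := chi w) (y0 := chi v)
    fraction_char_zero tofrac_hom tofrac_injective.
- move=> q /(int_coefs_rat i) [f ef] h; rewrite -ef.
  by have -> : f = 0; rewrite ?map_poly0 //; apply: ty; rewrite /ev ef.
move=> q Bq h.
have /choice [f hf] : forall j, exists f : {poly rat}, q`_j = ev i (chiK v) f.
  move=> j; have [g [/(int_coefs_rat i) [f ef] ->]] := Bq j.
  by exists f; rewrite /ev ef.
pose P := \poly_(j < size q) f j.
have eP : map_poly (ev i (chiK v)) P = q.
  apply/polyP => j; rewrite coef_map_id0 ?ev0 // coef_poly; case: ltnP => [_|le].
    by rewrite -hf.
  by rewrite ev0 nth_default.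
have P0 : P = 0.
  by apply: contrapT => /eqP P0; apply: indep_vw; exists P => //; rewrite /ev2 eP.
by rewrite -eP P0 map_poly0.
Qed.

Lemma chiK_gen (F : K -> Prop) : subfield F -> (forall v, F (chiK v)) -> forall z, F z.
Proof.
move=> hF Fchi.
have FR r : F (tofrac r).
  apply: (chi_span (S := fun r => F (tofrac r))) => // [|x y Fx Fy].
    by rewrite rmorph0; apply: subfield0 hF.
  by rewrite rmorphB; apply: (subfieldB hF).
by move=> z; have [a [b ->]] := fraction_ratio z; apply: (subfield_div hF).
Qed.

Definition lattice_sum (C : 'M[int]_s) (l : seq (int * V)) : R :=
  \sum_(p <- l) p.1%:~R * chi (p.2 *m C).

Lemma tofrac_lattice_sum C l : tofrac (lattice_sum C l) = evl chiK C l.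
Proof.
rewrite /lattice_sum rmorph_sum; apply: eq_bigr => p _.
by rewrite rmorphM rmorph_int.
Qed.

Lemma lattice_sum_eq0 C l : lattice_sum C l = 0 <-> evl chiK C l = 0.
Proof.
rewrite -tofrac_lattice_sum; split=> [->|/eqP]; first by rewrite rmorph0.
by rewrite tofrac_eq0 => /eqP.
Qed.

Lemma lattice_orbits_embedded M (Cs : seq 'M[int]_s) : (0 < M)%N ->
  (forall C, C \in Cs -> C != 0) ->
  (forall C, C \in Cs -> forall l, lattice_sum M%:R%:M l = 0 -> lattice_sum C l = 0) ->
  forall v, exists (k : nat) (O : seq V), [/\ (0 < k)%N, uniq O,
    exists2 w, w \in O & w *+ M = v *+ k
  & forall C, C \in Cs -> perm_eq [seq w *m C | w <- O] [seq w *+ M | w <- O]].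
Proof.
move=> M0 nz pres.
have cD u v : chiK (u + v) = chiK u * chiK v by rewrite /chiK chiD rmorphM.
have c0 : chiK 0 = 1 by rewrite /chiK chi0 rmorph1.
have dM : \det (M%:R%:M : 'M[int]_s) != 0.
  by rewrite det_scalar expf_neq0 // pnatr_eq0 -lt0n.
have [N [N0 Npos Nscale Nsub Ninv]] :=
  degree_norm cD chi_transcendental chi_dependent chiK_gen c0 s_gt1.
have refl C : C \in Cs -> forall l, evl chiK M%:R%:M l = 0 <-> evl chiK C l = 0.
  move=> CC; have [u uC] : exists u : V, u *m C != 0.
    apply: contrapT => none; case/eqP: (nz _ CC); apply/row_matrixP => j.
    rewrite rowE row0; apply: contrapT => /eqP h; apply: none; by exists (delta_mx 0 j).
  have pr l : evl chiK M%:R%:M l = 0 -> evl chiK C l = 0.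
    by move=> /lattice_sum_eq0 h; apply/lattice_sum_eq0/pres.
  move=> l; split; first exact: pr.
  exact: (relation_reflects cD chi_transcendental chi_dependent chiK_gen c0 s_gt1 dM uC pr).
(* If v C = 0, then chi(v C) = 1 is a relation, which reflects to chi(Mv) = 1 with Mv != 0. *)
have dC C : C \in Cs -> \det C != 0.
  move=> CC; apply/negP => /det0P [v v0 vC].
  have : evl chiK M%:R%:M [:: (1, v); (-1, 0)] = 0.
    apply/(refl _ CC); rewrite /evl !big_cons big_nil /= vC mul0mx c0; ring.
  rewrite /evl !big_cons big_nil /= mul0mx c0 addr0 mul1r mulr1 => /eqP.
  rewrite addr_eq0 opprK mul_mx_scalar => /eqP e.
  have vM : M%:R *: v != 0.
    by rewrite scalemx_eq0 negb_or v0 pnatr_eq0 -lt0n M0.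
  apply: (proj1 (transcendental_nalg _ _) (chi_transcendental vM)).
  by rewrite e; apply: algebraic1.
apply: (invariant_orbit Npos Nscale Nsub M0 dC) => C CC v.
rewrite -(Ninv M%:R%:M C dM (dC _ CC) (refl _ CC)) mul_mx_scalar scaler_nat.
exact: Nscale.
Qed.

End UnitLattice.

Theorem lattice_orbits (s : nat) (R : idomainType) (chi : 'rV[int]_s -> R)
  M (Cs : seq 'M[int]_s) : (1 < s)%N -> Z_torsion_free R ->
  (forall u v, chi (u + v) = chi u * chi v) -> chi 0 = 1 ->
  (forall S : R -> Prop, S 0 -> (forall x y, S x -> S y -> S (x - y)) ->
    (forall v, S (chi v)) -> forall r, S r) ->
  (forall l (P : nat -> {pred R}), prime_chain l P -> (l <= 2)%N) ->
  (forall v, v != 0 -> ~ algebraicOver (ratr : rat -> {fraction R}) (tofrac (chi v))) ->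
  (0 < M)%N -> (forall C, C \in Cs -> C != 0) ->
  (forall C, C \in Cs -> forall l, lattice_sum chi M%:R%:M l = 0 -> lattice_sum chi C l = 0) ->
  forall v, exists (k : nat) (O : seq 'rV[int]_s), [/\ (0 < k)%N, uniq O,
    exists2 w, w \in O & w *+ M = v *+ k
  & forall C, C \in Cs -> perm_eq [seq w *m C | w <- O] [seq w *+ M | w <- O]].
Proof.
move=> s1 R0 cD c0 span krull nalg M0 nz pres.
have [i iE] := rat_embedding (fraction_char_zero R0).
exact: (lattice_orbits_embedded s1 R0 cD c0 span krull nalg iE).
Qed.

(** * States, and the ring structure on A *)

Section TreeAction.
Local Open Scope group_scope.
Variables (G : groupType) (m : nat) (act : G -> vertex m -> vertex m).
Hypothesis act_faithful : faithful_tree_action act.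
Hypothesis act_states : forall g i, exists h, forall v, state (act g) i v = act h v.
Implicit Types (g h : G) (i j : 'I_m) (v w : vertex m).

Let act1 v : act 1 v = v. Proof. by case: act_faithful. Qed.
Let actM g h v : act (g * h) v = act h (act g v). Proof. by case: act_faithful. Qed.

Lemma act_root g : act g [::] = [::].
Proof. by case: act_faithful => _ _ /(_ g) []. Qed.

Lemma act_rcons g v i : exists j, act g (rcons v i) = rcons (act g v) j.
Proof.
case: act_faithful => _ _ /(_ g) [_ _ ch] _.
have /ch [j e] : child v (rcons v i) by exists i.
by exists j.
Qed.

Lemma act_cons g i v : exists j w, act g [:: i] = [:: j] /\ act g (i :: v) = j :: w.
Proof.
elim/last_ind: v => [|v k [j [w [e1 e2]]]].
  have [j] := act_rcons g [::] i; rewrite act_root /= => e.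
  by exists j, [::].
have [k' e] := act_rcons g (i :: v) k.
by exists j, (rcons w k'); split=> //; rewrite -rcons_cons e e2.
Qed.

Lemma act_inj g h : (forall v, act g v = act h v) -> g = h.
Proof.
move=> e; have : g * h^-1 = 1.
  case: act_faithful => _ _ _; apply => v.
  by rewrite actM e -actM mulgV act1.
by move/(congr1 (fun x => x * h)); rewrite mulgKV mul1g.
Qed.

Definition level_stabilizer g := forall i, act g [:: i] = [:: i].

(** A label in a finite type that separates the cosets of the level stabiliser, as needed for the
    pigeonhole argument on A modulo b. *)
Definition level_label g : {ffun 'I_m -> option 'I_m} := [ffun i => ohead (act g [:: i])].

Lemma level_label_act g h i : level_label g = level_label h -> act g [:: i] = act h [:: i].
Proof.
move=> /ffunP /(_ i); rewrite !ffunE.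
have [j [_ [-> _]]] := act_cons g i [::]; have [k [_ [-> _]]] := act_cons h i [::].
by move=> [->].
Qed.

Lemma level_label_stabilizer g h : level_label g = level_label h -> level_stabilizer (g * h^-1).
Proof. by move=> e i; rewrite actM (level_label_act i e) -actM mulgV act1. Qed.

Lemma level_stabilizerM g h : level_stabilizer g -> level_stabilizer h -> level_stabilizer (g * h).
Proof. by move=> hg hh i; rewrite actM hg hh. Qed.

Lemma level_stabilizerV g : level_stabilizer g -> level_stabilizer g^-1.
Proof. by move=> hg i; rewrite -{1}(hg i) -actM mulgV act1. Qed.

Lemma level_stabilizerJ g h : level_stabilizer g -> level_stabilizer (g ^ h).
Proof.
move=> hg i; rewrite conjgE !actM.
have [j [_ [e _]]] := act_cons h^-1 i [::].
by rewrite e hg -e -actM mulVg act1.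
Qed.

(** M is the order of the symmetric group of the first layer. *)
Lemma level_power : exists2 M, (0 < M)%N & forall g, level_stabilizer (g ^+ M).
Proof.
exists #|[set: {perm 'I_m}]|; first exact: cardG_gt0.
move=> g; have /choice [p hp] : forall i, exists j, act g [:: i] = [:: j].
  by move=> i; have [j [_ [e _]]] := act_cons g i [::]; exists j.
have pI : injective p.
  move=> i j e; have : act g [:: i] = act g [:: j] by rewrite !hp e.
  case: act_faithful => _ _ /(_ g) [/bij_inj inj _ _] _ /inj [//].
have pw n i : act (g ^+ n) [:: i] = [:: (perm pI ^+ n) i].
  elim: n i => [|n IH] i; first by rewrite !expg0 act1 perm1.
  by rewrite !expgS actM hp IH permM permE.
by move=> i; rewrite pw expg_cardG ?inE // perm1.
Qed.

(** By faithfulness a state is represented by only one element of G, so the chosen representatives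
    are multiplicative on the stabiliser. *)
Lemma level_states : exists st : 'I_m -> G -> G,
  (forall i g, level_stabilizer g -> forall v, act g (i :: v) = i :: act (st i g) v) /\
  (forall i g h, level_stabilizer g -> level_stabilizer h -> st i (g * h) = st i g * st i h).
Proof.
have /choice [st hst] : forall ig : 'I_m * G, exists h, forall v, state (act ig.2) ig.1 v = act h v.
  by move=> [i g]; apply: act_states.
have spec i g : level_stabilizer g -> forall v, act g (i :: v) = i :: act (st (i, g)) v.
  move=> hg v; rewrite -(hst (i, g)) /state /=.
  by have [j [w [e ->]]] := act_cons g i v; move: e; rewrite hg => -[->].
exists (fun i g => st (i, g)); split=> // i g h hg hh; apply: act_inj => v.
have := spec i _ (level_stabilizerM hg hh) v.
by rewrite actM (spec i g hg) (spec i h hh) actM => -[].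
Qed.

(** By induction on the length of a vertex, every element of [J] fixes it. *)
Lemma invariant_trivial (st : 'I_m -> G -> G) (J : G -> Prop) :
  (forall i g, level_stabilizer g -> forall v, act g (i :: v) = i :: act (st i g) v) ->
  (forall g, J g -> level_stabilizer g) -> (forall i g, J g -> J (st i g)) ->
  forall g, J g -> g = 1.
Proof.
move=> hst JH Jst g Jg; apply: act_inj => v; rewrite act1.
elim: v g Jg => [|i v IH] g Jg; first exact: act_root.
by rewrite (hst i g (JH _ Jg)) IH //; apply: Jst.
Qed.

End TreeAction.

(** * A as an additive group and as a module over ZQ *)

Section AbelianSubgroup.
Variables (G : groupType) (A : groupClosed G).

(** The proof of commutativity is a parameter of the type, so that an additive structure can be
    attached to it. *)
Definition abelian_zmod (abA : abelian_subgroup A) : Type := subgroup_of A.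

Variable abA : abelian_subgroup A.
HB.instance Definition _ := Choice.on (abelian_zmod abA).

Let add (x y : abelian_zmod abA) : abelian_zmod abA := ((x : subgroup_of A) * (y : subgroup_of A))%g.
Let opp (x : abelian_zmod abA) : abelian_zmod abA := ((x : subgroup_of A)^-1)%g.
Let zero : abelian_zmod abA := (1 : subgroup_of A)%g.
Let addA : associative add. Proof. exact: mulgA. Qed.
Let add0 : left_id zero add. Proof. exact: mul1g. Qed.
Let addN : left_inverse zero opp add. Proof. exact: mulVg. Qed.
Let addC : commutative add.
Proof. by move=> x y; apply: val_inj; rewrite /= abA ?(valP x) ?(valP y). Qed.
HB.instance Definition _ := GRing.isZmodule.Build (abelian_zmod abA) addA addC add0 addN.

Definition aval (x : abelian_zmod abA) : G := val (x : subgroup_of A).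

Lemma aval_inj : injective aval. Proof. exact: val_inj. Qed.
Lemma aval_mem x : aval x \in A. Proof. exact: (valP (x : subgroup_of A)). Qed.
Lemma aval0 : aval 0 = 1%g. Proof. by []. Qed.
Lemma avalD x y : aval (x + y) = (aval x * aval y)%g. Proof. by []. Qed.
Lemma avalN x : aval (- x) = ((aval x)^-1)%g. Proof. by []. Qed.
Lemma avalMn x n : aval (x *+ n) = (aval x ^+ n)%g.
Proof. by elim: n => [|n IH]; rewrite ?mulr0n ?expg0 // mulrS avalD IH expgS. Qed.
Lemma avalMz x (n : int) : aval (x *~ n) = expgz (aval x) n.
Proof.
case: n => n; first by rewrite -pmulrn avalMn.
by rewrite NegzE mulrNz avalN -pmulrn avalMn.
Qed.
Lemma aval_sum (I : Type) (r : seq I) (f : I -> abelian_zmod abA) :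
  aval (\sum_(i <- r) f i) = (\prod_(i <- r) aval (f i))%g.
Proof. exact: (big_morph aval avalD aval0). Qed.

Definition to_abelian (a : G) (aA : a \in A) : abelian_zmod abA := Sub a aA.

End AbelianSubgroup.

Section ModuleAction.
Variables (G : groupType) (A Q : groupClosed G).
Hypothesis abA : abelian_subgroup A.
Hypothesis nA : forall a g, a \in A -> (a ^ g)%g \in A.
Local Notation M := (abelian_zmod abA).
Local Notation ZQ := (groupRing (subgroup_of Q)).
Implicit Types (u v : M) (q p : subgroup_of Q) (x y : ZQ).

Definition conj_act (q : subgroup_of Q) u : M := to_abelian abA (nA (val q) (aval_mem u)).

Lemma conj_actE q u : aval (conj_act q u) = (aval u ^ val q)%g. Proof. by []. Qed.

Lemma conj_actD q u v : conj_act q (u + v) = conj_act q u + conj_act q v.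
Proof. by apply: (@aval_inj _ _ abA); rewrite avalD !conj_actE avalD conjMg. Qed.

Lemma conj_act0 q : conj_act q 0 = 0.
Proof. by apply: (@aval_inj _ _ abA); rewrite conj_actE !aval0 conj1g. Qed.

Lemma conj_actN q u : conj_act q (- u) = - conj_act q u.
Proof. by apply/eqP; rewrite -addr_eq0 -conj_actD addNr conj_act0. Qed.

Lemma conj_actMz q u (n : int) : conj_act q (u *~ n) = conj_act q u *~ n.
Proof.
have e m : conj_act q (u *+ m) = conj_act q u *+ m.
  by elim: m => [|m IH]; rewrite ?mulr0n ?conj_act0 // !mulrS conj_actD IH.
by case: n => n; rewrite ?NegzE ?mulrNz ?conj_actN -!pmulrn e.
Qed.

Lemma conj_act_mul p q u : conj_act q (conj_act p u) = conj_act (p * q)%g u.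
Proof. by apply: (@aval_inj _ _ abA); rewrite !conj_actE -conjgM. Qed.

Definition mod_act u (x : {malg int[subgroup_of Q]}) : M :=
  \sum_(q <- msupp x) conj_act q u *~ x@_q.

Lemma mod_actE u x : aval (mod_act u x) = module_act (aval u) x.
Proof.
rewrite /mod_act aval_sum; apply: eq_bigr => q _; by rewrite avalMz.
Qed.

Lemma mod_act_wide u (d : {fset subgroup_of Q}) (x : {malg int[subgroup_of Q]}) :
  (msupp x `<=` d)%fset -> mod_act u x = \sum_(q <- d) conj_act q u *~ x@_q.
Proof.
move=> le; rewrite /mod_act (big_fset_incl _ le) //= => q _ /mcoeff_outdom ->.
by rewrite mulr0z.
Qed.

Lemma mod_actD u (x y : {malg int[subgroup_of Q]}) : mod_act u (x + y) = mod_act u x + mod_act u y.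
Proof.
rewrite (mod_act_wide u (msuppD_le x y)).
rewrite (mod_act_wide u (fsubsetUl (msupp x) (msupp y))).
rewrite (mod_act_wide u (fsubsetUr (msupp x) (msupp y))) -big_split.
by apply: eq_bigr => q _; rewrite mcoeffD mulrzDr.
Qed.

Lemma mod_act0 u : mod_act u 0 = 0.
Proof. by rewrite /mod_act msupp0 big_seq_fset0. Qed.

Lemma mod_actU u c q : mod_act u << c *g q >> = conj_act q u *~ c.
Proof. by rewrite (mod_act_wide u msuppU_le) big_seq_fset1 mcoeffUU. Qed.

Lemma mod_actDl u v x : mod_act (u + v) x = mod_act u x + mod_act v x.
Proof.
by rewrite /mod_act -big_split; apply: eq_bigr => q _; rewrite conj_actD mulrzDl.
Qed.

Lemma mod_act0l x : mod_act 0 x = 0.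
Proof. by rewrite /mod_act big1 // => q _; rewrite conj_act0 mul0rz. Qed.

Lemma mod_act_sum (I : Type) (r : seq I) (f : I -> {malg int[subgroup_of Q]}) u :
  mod_act u (\sum_(i <- r) f i) = \sum_(i <- r) mod_act u (f i).
Proof. exact: (big_morph (mod_act u) (mod_actD u) (mod_act0 u)). Qed.

Lemma mod_act_suml (I : Type) (r : seq I) (f : I -> M) x :
  mod_act (\sum_(i <- r) f i) x = \sum_(i <- r) mod_act (f i) x.
Proof. exact: (big_morph (mod_act^~ x) (fun u v => mod_actDl u v x) (mod_act0l x)). Qed.

Lemma groupRing_mulUU (H : groupType) (a b : int) (p q : H) :
  groupRing_mul << a *g p >> << b *g q >> = << a * b *g (p * q)%g >>.
Proof.
rewrite /groupRing_mul !msuppU.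
have [->|a0] := eqVneq a 0; first by rewrite big_seq_fset0 mul0r monalgU0.
rewrite big_seq_fset1; have [->|b0] := eqVneq b 0; first by rewrite big_seq_fset0 mulr0 monalgU0.
by rewrite big_seq_fset1 !mcoeffUU.
Qed.

Lemma mod_actM u x y : mod_act u (x * y) = mod_act (mod_act u x) y.
Proof.
have add_mul (a b c : {malg int[subgroup_of Q]}) : groupRing_mul (a + b) c = groupRing_mul a c + groupRing_mul b c.
  exact: (@groupRing_mulDl _ a b c).
have mul_add (a b c : {malg int[subgroup_of Q]}) : groupRing_mul a (b + c) = groupRing_mul a b + groupRing_mul a c.
  exact: (@groupRing_mulDr _ a b c).
have mul0 (c : {malg int[subgroup_of Q]}) : groupRing_mul 0 c = 0 by exact: (mul0r (c : ZQ)).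
have mul0' (c : {malg int[subgroup_of Q]}) : groupRing_mul c 0 = 0 by exact: (mulr0 (c : ZQ)).
rewrite -[x * y]/(groupRing_mul x y).
rewrite [x in LHS](monalgE (x : {malg int[subgroup_of Q]})) [x in RHS](monalgE (x : {malg int[subgroup_of Q]})).
rewrite [y in LHS](monalgE (y : {malg int[subgroup_of Q]})) [y in RHS](monalgE (y : {malg int[subgroup_of Q]})).
rewrite (big_morph (fun a => groupRing_mul a _) (fun a b => add_mul a b _) (mul0 _)).
rewrite [in LHS]mod_act_sum [X in _ = mod_act X _]mod_act_sum mod_act_suml.
apply: eq_bigr => p _.
rewrite (big_morph (groupRing_mul _) (mul_add _) (mul0' _)) !mod_act_sum.
apply: eq_bigr => q _.
by rewrite groupRing_mulUU !mod_actU conj_actMz conj_act_mul mulrzA.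
Qed.

End ModuleAction.

(** [alpha] sends pi x to the generator [a0] acted on by x. *)
Theorem module_ring_iso (G : groupType) (A Q : groupClosed G) (R : idomainType)
    (pi : {rmorphism groupRing (subgroup_of Q) -> R}) :
  semidirect_product A Q -> abelian_subgroup A -> cyclic_module A Q ->
  quotient_map (annihilator A (Q := Q)) pi ->
  exists alpha : R -> G,
    [/\ forall r, alpha r \in A,
        forall r r', alpha (r + r') = (alpha r * alpha r')%g,
        forall r, alpha r = 1%g -> r = 0,
        forall a, a \in A -> exists r, a = alpha r
      & forall r q, alpha (r * pi (groupRing_of q)) = (alpha r ^ val q)%g].
Proof.
case=> nA _ _ abA [a0 a0A gen] [surj ker].
pose u0 := to_abelian abA a0A.
have well x y : pi x = pi y -> mod_act nA u0 x = mod_act nA u0 y.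
  move=> e; have /ker ann : pi (x - y) = 0 by rewrite rmorphB e subrr.
  have : mod_act nA u0 (x - y) = 0.
    by apply: (@aval_inj _ _ abA); rewrite mod_actE aval0; apply: ann.
  move=> h; rewrite -[x](subrK y) -[x - y + y]/((x - y : {malg int[_]}) + (y : {malg int[_]})).
  by rewrite mod_actD h add0r.
have /choice [X hX] : forall r, exists x, r = pi x by apply: surj.
pose alpha r := aval (mod_act nA u0 (X r)).
have alphaE x : alpha (pi x) = aval (mod_act nA u0 x) by congr aval; apply: well; rewrite -hX.
exists alpha; split=> [r|r r'|r|a aA|r q].
- exact: aval_mem.
- by rewrite (hX r) (hX r') -rmorphD !alphaE -avalD -mod_actD.
- rewrite {2}(hX r) /alpha => h; apply/ker => a aA.
  have {h} h : mod_act nA u0 (X r) = 0 by apply: (@aval_inj _ _ abA); rewrite h aval0.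
  have [y ey] := gen a aA.
  have -> : a = aval (mod_act nA u0 y) by rewrite mod_actE.
  (* Commutativity of R lets [X r] act first, and it already kills the generator. *)
  rewrite -mod_actE -mod_actM (well _ (X r * y)); last by rewrite !rmorphM mulrC.
  by rewrite mod_actM h mod_act0l aval0.
- have [y ey] := gen a aA; exists (pi y).
  by rewrite alphaE mod_actE.
- rewrite {1}(hX r) -rmorphM alphaE mod_actM /groupRing_of mod_actU mulr1z conj_actE.
  by rewrite -alphaE -hX.
Qed.

(** * Contradiction from a self-similar action *)

Section ProductCoefficients.
Variables (R1 R2 : comNzRingType) (T : R1 -> R2 -> Prop).
Hypothesis T1 : T 1 1.
Hypothesis TB : forall x y x' y', T x y -> T x' y' -> T (x - x') (y - y').
Hypothesis TM : forall x y x' y', T x y -> T x' y' -> T (x * x') (y * y').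

Lemma related0 : T 0 0. Proof. by rewrite -(subrr 1) -(subrr (1 : R2)); apply: TB. Qed.

Lemma relatedD x y x' y' : T x y -> T x' y' -> T (x + x') (y + y').
Proof.
move=> h h'; rewrite -[x']opprK -[y']opprK -(sub0r x') -(sub0r y').
by apply: TB => //; apply: TB => //; apply: related0.
Qed.

Lemma related_int (n : int) : T n%:~R n%:~R.
Proof.
have nat m : T m%:R m%:R.
  by elim: m => [|m IH]; [exact: related0 | rewrite !mulrS; apply: relatedD].
case: n => m; first exact: nat.
by rewrite NegzE !mulrNz -(sub0r (_ *~ _)) -[X in T _ X]sub0r; apply: TB; [apply: related0|apply: nat].
Qed.

(** Serves twice: with [twist], for the effect of a good state on the coefficients, and with
    [near_int], for their congruence to the coefficients of a power of X - 1. *)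
Lemma prod_coefs_related (I : eqType) (r : seq I) (f : I -> R1) (g : I -> R2) :
  (forall j, j \in r -> T (f j) (g j)) -> forall l,
  T (\prod_(j <- r) ('X - (f j)%:P))`_l (\prod_(j <- r) ('X - (g j)%:P))`_l.
Proof.
elim: r => [|j r IH] h l.
  rewrite !big_nil !coefC; case: ifP => _ //; exact: related0.
rewrite !big_cons !mulrBl !coefB !coefXM !coefCM.
have hr : forall l, T (\prod_(j <- r) ('X - (f j)%:P))`_l (\prod_(j <- r) ('X - (g j)%:P))`_l.
  by apply: IH => i ir; apply: h; rewrite inE ir orbT.
apply: TB; last by apply: TM => //; apply: h; rewrite mem_head.
by case: ifP => _ //; apply: related0.
Qed.
End ProductCoefficients.

(** Reduced by the monic [p], the powers of [y] are combinations of finitely many powers with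
    coefficients in a finite ring, so two of them agree. *)
Lemma finite_image_powers (S : idomainType) (B : S -> Prop) (l : seq S) (y : S) (p : {poly S}) :
  subring B -> (forall b, B b -> b \in l) -> p \is monic -> coefs_in B p -> p.[y] = 0 ->
  y != 0 -> exists2 n, (0 < n)%N & y ^+ n = 1.
Proof.
move=> hB fin mon Bp py y0.
pose d := size p.
pose W := [seq \sum_(j < d) nth 0 l (f j) * y ^+ j | f : {ffun 'I_d -> 'I_(size l)}].
have pw n : y ^+ n \in W.
  have BX : coefs_in B 'X^n.
    by move=> j; rewrite coefXn; case: (_ == _); [exact: subring1 hB|exact: subring0 hB].
  have [m [q1 [r [_ Br e szr]]]] := pseudo_division hB (monic_neq0 mon) Bp BX.
  have {e} e : y ^+ n = r.[y].
    have := congr1 (fun f => f.[y]) e.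
    by rewrite (eqP mon) expr1n scale1r hornerXn hornerD hornerM py mul0r add0r.
  have lt (j : nat) : (index (r`_j)%R l < size l)%N by rewrite index_mem fin.
  apply/imageP; exists [ffun j : 'I_d => Ordinal (lt j)] => //.
  rewrite e (@horner_coef_wide _ d) ?(ltnW szr) //.
  by apply: eq_bigr => j _; rewrite ffunE /= nth_index // fin.
have lt n : (index (y ^+ n)%R W < size W)%N by rewrite index_mem.
pose f (n : 'I_(size W).+1) : 'I_(size W) := Ordinal (lt n).
have /injectivePn [a [b nab fab]] : ~~ injectiveb f.
  by apply/injectiveP => /leq_card; rewrite !card_ord ltnn.
wlog ltab : a b nab fab / (a < b)%N.
  move=> h; case: (ltngtP a b) => [|/h|e]; [exact: h| apply=> //; by rewrite eq_sym|].
  by case/eqP: nab; apply: val_inj.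
exists (b - a)%N; first by rewrite subn_gt0.
have e : y ^+ a = y ^+ b.
  have := congr1 val fab; rewrite /= => h.
  by rewrite -(nth_index 0 (pw a)) h nth_index.
apply: (mulfI (expf_neq0 a y0)); rewrite mulr1 -exprD subnKC // ltnW //.
Qed.

Lemma int_residue (S : nzRingType) p (z : int) : (0 < p)%N -> p%:R = 0 :> S ->
  exists m : 'I_p, z%:~R = (m : nat)%:R :> S.
Proof.
move=> p_gt0 pS.
have h0 : (0 <= (z %% p%:Z)%Z)%R by apply: modz_ge0; rewrite eqz_nat -lt0n.
have lt : (`|(z %% p%:Z)%Z| < p)%N.
  by rewrite -ltz_nat gez0_abs // ltz_pmod // ltz_nat.
exists (Ordinal lt); rewrite /= [in RHS]pmulrn gez0_abs //.
rewrite {1}(divz_eq z p%:Z) rmorphD rmorphM /=.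
by rewrite -[p%:~R]/(p%:R) pS mulr0 add0r.
Qed.

Section FiniteResidue.
Variables (s : nat) (S : idomainType) (psi : 'rV[int]_s -> S) (p : nat).
Local Notation V := 'rV[int]_s.
Hypothesis p_gt0 : (0 < p)%N.
Hypothesis pS : p%:R = 0 :> S.
Hypothesis psiD : forall u v, psi (u + v) = psi u * psi v.
Hypothesis psi0 : psi 0 = 1.
Hypothesis psi_span : forall B : S -> Prop, B 0 -> (forall x y, B x -> B y -> B (x - y)) ->
  (forall v, B (psi v)) -> forall r, B r.
Hypothesis psi_torsion : forall v, exists2 n, (0 < n)%N & psi v ^+ n = 1.

(** With K a common exponent of the psi(e_j), the value psi v depends on v modulo K only, and
    integer coefficients matter modulo p only. *)
Lemma finite_residue : exists l : seq S, forall x, x \in l.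
Proof.
have psiN v n : psi v ^+ n = 1 -> psi (- v) ^+ n = 1.
  move=> h; have : (psi v * psi (- v)) ^+ n = 1 by rewrite -psiD subrr psi0 expr1n.
  by rewrite exprMn h mul1r.
have /choice [k hk] : forall j : 'I_s, exists n, (0 < n)%N /\ psi (delta_mx 0 j) ^+ n = 1.
  by move=> j; have [n n0 h] := psi_torsion (delta_mx 0 j); exists n.
pose K := (\prod_j k j)%N.
have K0 : (0 < K)%N by apply: prodn_gt0 => j; case: (hk j).
have psiK v : psi v ^+ K = 1.
  rewrite [v]row_sum_delta.
  apply: (big_ind (fun u => psi u ^+ K = 1)) => [|u w hu hw|j _].
  - by rewrite psi0 expr1n.
  - by rewrite psiD exprMn hu hw mulr1.
  have e1 : psi (delta_mx 0 j) ^+ K = 1.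
    by rewrite /K (bigD1 j) //= exprM (hk j).2 expr1n.
  have step u : psi u ^+ K = 1 -> forall n, psi (u *+ n) ^+ K = 1.
    move=> h; elim=> [|n IH]; first by rewrite mulr0n psi0 expr1n.
    by rewrite mulrS psiD exprMn h IH mulr1.
  case: (v 0 j) => n; first by rewrite -natz scaler_nat; apply: step.
  by rewrite NegzE scaleNr -natz scaler_nat; apply: psiN; apply: step.
pose E := {ffun 'I_s -> 'I_K}.
pose rowE (t : E) : V := \row_j (t j)%:Z.
pose comb (n : {ffun E -> 'I_p}) : S := \sum_t (n t)%:R * psi (rowE t).
exists [seq comb n | n : {ffun E -> 'I_p}] => x.
have [c ->] : exists c : E -> int, x = \sum_t (c t)%:~R * psi (rowE t).
  move: x; apply: psi_span => [|x y [c ->] [d ->]|v].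
  - by exists (fun=> 0); rewrite big1 // => t _; rewrite mul0r.
  - exists (fun t => c t - d t); rewrite -sumrB; apply: eq_bigr => t _.
    by rewrite rmorphB mulrBl.
  have lt (j : 'I_s) : (`|((v ord0 j) %% K%:Z)%Z| < K)%N.
    rewrite -ltz_nat gez0_abs ?ltz_pmod ?ltz_nat //.
    by apply: modz_ge0; rewrite eqz_nat -lt0n.
  pose t0 : E := [ffun j => Ordinal (lt j)].
  exists (fun t => (t == t0)%:Z); rewrite (bigD1 t0) //= eqxx big1 ?addr0; last first.
    by move=> t /negPf ->; rewrite mul0r.
  rewrite mul1r; have -> : v = rowE t0 + (\row_j ((v ord0 j) %/ K%:Z)%Z) *+ K.
    apply/rowP => j; rewrite mxE mulmxnE !mxE ffunE /= gez0_abs; last first.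
      by apply: modz_ge0; rewrite eqz_nat -lt0n.
    by rewrite -[(_ %/ _)%Z *+ K]mulr_natr natz addrC -divz_eq.
  rewrite psiD; have -> u n : psi (u *+ n) = psi u ^+ n.
    by elim: n => [|n IH]; rewrite ?mulr0n ?psi0 // mulrS psiD IH exprS.
  by rewrite psiK mulr1.
have /choice [m hm] := fun z => int_residue z p_gt0 pS.
apply/imageP; exists [ffun t => m (c t)] => //.
by apply: eq_bigr => t _; rewrite ffunE hm.
Qed.
End FiniteResidue.

Lemma additive_rV_matrix s (f : 'rV[int]_s -> 'rV[int]_s) :
  (forall u v, f (u + v) = f u + f v) -> exists C : 'M[int]_s, forall v, f v = v *m C.
Proof.
move=> add; have f0 : f 0 = 0 by apply: (addIr (f 0)); rewrite -add !add0r.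
have fN v : f (- v) = - f v by apply/eqP; rewrite -addr_eq0 -add addNr f0.
have fMn v n : f (v *+ n) = f v *+ n.
  by elim: n => [|n IH]; rewrite ?mulr0n // !mulrS add IH.
have fZ (z : int) v : f (z *: v) = z *: f v.
  case: z => n; first by rewrite -natz !scaler_nat fMn.
  by rewrite NegzE !scaleNr -natz !scaler_nat fN fMn.
exists (\matrix_j f (delta_mx 0 j)) => v.
rewrite {1}[v]row_sum_delta (big_morph f add f0) mulmx_sum_row.
by apply: eq_bigr => j _; rewrite fZ rowK.
Qed.

(** * The contradiction, from abstract data on the states *)

Section Core.
Variables (s m : nat) (R : idomainType) (chi : 'rV[int]_s -> R).
(** [alpha] identifies R with A, [tv] identifies Z^s with Q, and [qp] is the projection of G onto
    Z^s along A. *)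
Variables (G : groupType) (alpha : R -> G) (tv : 'rV[int]_s -> G) (qp : G -> 'rV[int]_s).
Variables (H : G -> Prop) (L : finType) (lab : G -> L) (M : nat) (st : 'I_m -> G -> G).
Local Notation V := 'rV[int]_s.
Implicit Types (r x y c : R) (u v w : V) (g h : G) (i : 'I_m).

Hypothesis s_gt1 : (1 < s)%N.
Hypothesis R0 : Z_torsion_free R.
Hypothesis chiD : forall u v, chi (u + v) = chi u * chi v.
Hypothesis chi0 : chi 0 = 1.
Hypothesis chi_span : forall S : R -> Prop, S 0 -> (forall x y, S x -> S y -> S (x - y)) ->
  (forall v, S (chi v)) -> forall r, S r.
Hypothesis krull : forall l (P : nat -> {pred R}), prime_chain l P -> (l <= 2)%N.
Hypothesis chi_nalg : forall v, v != 0 ->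
  ~ algebraicOver (ratr : rat -> {fraction R}) (tofrac (chi v)).
Hypothesis residues : forall p : nat, prime p ->
  exists (S : idomainType) (rho : {rmorphism R -> S}),
    quotient_map (fun x : R => exists y : R, x = y *+ p) rho /\ infinite_type S.

Hypothesis alphaD : forall r x, alpha (r + x) = (alpha r * alpha x)%g.
Hypothesis alpha_eq1 : forall r, alpha r = 1%g -> r = 0.
Hypothesis alphaJ : forall r v, alpha (r * chi v) = (alpha r ^ tv v)%g.
Hypothesis tvD : forall u v, tv (u + v) = (tv u * tv v)%g.
Hypothesis qpM : forall g h, qp (g * h)%g = qp g + qp h.
Hypothesis qp_alpha : forall r, qp (alpha r) = 0.
Hypothesis qp_tv : forall v, qp (tv v) = v.
Hypothesis qp_eq0 : forall g, qp g = 0 -> exists r, g = alpha r.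

Hypothesis HM : forall g h, H g -> H h -> H (g * h)%g.
Hypothesis HV : forall g, H g -> H (g^-1)%g.
Hypothesis HJ : forall g h, H g -> H (g ^ h)%g.
Hypothesis H_lab : forall g h, lab g = lab h -> H (g * h^-1)%g.
Hypothesis M_gt0 : (0 < M)%N.
Hypothesis H_pow : forall g, H (g ^+ M)%g.
Hypothesis stM : forall i g h, H g -> H h -> st i (g * h)%g = (st i g * st i h)%g.
Hypothesis trivial_core : forall J : G -> Prop, (forall g, J g -> H g) ->
  (forall i g, J g -> J (st i g)) -> forall g, J g -> g = 1%g.

Lemma alpha0 : alpha 0 = 1%g.
Proof. by apply: (mulgI (alpha 0)); rewrite mulg1 -alphaD addr0. Qed.

Lemma alphaN r : alpha (- r) = ((alpha r)^-1)%g.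
Proof. by apply: (mulgI (alpha r)); rewrite -alphaD subrr alpha0 mulgV. Qed.

Lemma alphaMn r n : alpha (r *+ n) = (alpha r ^+ n)%g.
Proof. by elim: n => [|n IH]; rewrite ?mulr0n ?alpha0 ?expg0 // mulrS alphaD IH expgS. Qed.

Lemma alpha_inj : injective alpha.
Proof.
move=> r x e; apply/eqP; rewrite -subr_eq0; apply/eqP/alpha_eq1.
by rewrite alphaD alphaN e mulgV.
Qed.

(** The A-component of [g] centralises the abelian group A. *)
Lemma alpha_conj r g : (alpha r ^ g)%g = alpha (r * chi (qp g)).
Proof.
have qpV h : qp (h^-1)%g = - qp h.
  have q1 : qp 1%g = 0 by rewrite -alpha0 qp_alpha.
  by apply/eqP; rewrite -addr_eq0 -qpM mulVg q1.
have [|x ex] := @qp_eq0 (g * (tv (qp g))^-1)%g; first by rewrite qpM qpV qp_tv subrr.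
have -> : g = (alpha x * tv (qp g))%g by rewrite -ex mulgVK.
rewrite conjgM qpM qp_alpha qp_tv add0r alphaJ; congr (_ ^ _)%g.
by rewrite conjgE -alphaD addrC alphaD mulKg.
Qed.

Lemma H1 : H 1%g. Proof. by rewrite -(expg1n _ M); apply: H_pow. Qed.

Lemma st1 i : st i 1%g = 1%g.
Proof. by apply: (mulgI (st i 1%g)); rewrite mulg1 -stM ?mulg1 //; apply: H1. Qed.

Lemma stV i g : H g -> st i (g^-1)%g = ((st i g)^-1)%g.
Proof.
by move=> Hg; apply: (mulgI (st i g)); rewrite -stM ?mulgV ?st1 //; apply: HV.
Qed.

Lemma stJ i g h : H g -> H h -> st i (g ^ h)%g = (st i g ^ st i h)%g.
Proof.
by move=> Hg Hh; rewrite !conjgE !stM ?stV //; do ?[apply: HM | apply: HV].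
Qed.

Lemma tvMn v n : tv (v *+ n) = (tv v ^+ n)%g.
Proof.
have tv0 : tv 0 = 1%g by apply: (mulgI (tv 0)); rewrite mulg1 -tvD addr0.
by elim: n => [|n IH]; rewrite ?mulr0n ?tv0 ?expg0 // mulrS tvD IH expgS.
Qed.

Lemma H_tv v : H (tv (v *+ M)). Proof. by rewrite tvMn; apply: H_pow. Qed.

Definition ideal_b r := H (alpha r).

Lemma idealB r x : ideal_b r -> ideal_b x -> ideal_b (r - x).
Proof. by move=> hr hx; rewrite /ideal_b alphaD alphaN; apply: HM => //; apply: HV. Qed.

Lemma idealD r x : ideal_b r -> ideal_b x -> ideal_b (r + x).
Proof. by move=> hr hx; rewrite /ideal_b alphaD; apply: HM. Qed.

Lemma ideal0 : ideal_b 0. Proof. by rewrite /ideal_b alpha0; apply: H1. Qed.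

Lemma idealMr r x : ideal_b r -> ideal_b (r * x).
Proof.
move=> hr; move: x; apply: chi_span => [|x y hx hy|v].
- by rewrite mulr0; apply: ideal0.
- by rewrite mulrBr; apply: idealB.
- by rewrite /ideal_b alphaJ; apply: HJ.
Qed.

Lemma idealM_nat r : ideal_b (r *+ M).
Proof. by rewrite /ideal_b alphaMn; apply: H_pow. Qed.

(** The second alternative for a state map: f_i(b) lies in A, f_i does not vanish on b, and sigma_i
    is not 0. *)
Definition good i := [/\ forall r, ideal_b r -> qp (st i (alpha r)) = 0,
  exists2 r, ideal_b r & st i (alpha r) <> 1%g
  & exists v, qp (st i (tv (v *+ M))) != 0].

Lemma chi_ne1 v : v != 0 -> chi v != 1.
Proof.
move=> v0; apply/eqP => e; apply: (chi_nalg v0); rewrite e rmorph1.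
have [j jE] := rat_embedding (fraction_char_zero R0).
have [p p0 h] := algebraic1 j; exists p; first exact: p0.
have -> : map_poly ratr p = map_poly j p by apply: eq_map_poly => r; rewrite jE.
exact: h.
Qed.

(* If st i (alpha r0) is not in A, then it acts on A without fixed points, while
   st i (alpha r) commutes with it up to A; otherwise st i is trivial on the ideal
   or st i (tv (v *+ M)) acts trivially on A. *)
Lemma bad_kills i r v : ~ good i -> ideal_b r ->
  st i (alpha (r * (chi (v *+ M) - 1))) = 1%g.
Proof.
move=> bad br.
have ez : alpha (r * (chi (v *+ M) - 1)) = ((alpha r ^ tv (v *+ M)) * (alpha r)^-1)%g.
  by rewrite mulrBr mulr1 alphaD alphaN alphaJ.
have stz : st i (alpha (r * (chi (v *+ M) - 1))) =
    ((st i (alpha r) ^ st i (tv (v *+ M))) * (st i (alpha r))^-1)%g.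
  by rewrite ez stM ?stJ ?stV //; do ?[apply: H_tv | apply: HJ | apply: HV].
have bz : ideal_b (r * (chi (v *+ M) - 1)) by apply: idealMr.
have [[r0 br0 nq]|none] := pselect (exists2 r0, ideal_b r0 & qp (st i (alpha r0)) <> 0).
  have qpJ g h : qp (g ^ h)%g = qp g.
    have q1 : qp 1%g = 0 by rewrite -alpha0 qp_alpha.
    by rewrite conjgE !qpM addrCA -qpM mulVg q1 addr0.
  have [|x ex] := @qp_eq0 (st i (alpha (r * (chi (v *+ M) - 1)))).
    by rewrite stz qpM qpJ -qpM mulgV -alpha0 qp_alpha.
  have com : (alpha x ^ st i (alpha r0))%g = alpha x.
    rewrite -ex -stJ //; congr st.
    by rewrite conjgE -alphaD addrC alphaD mulKg.
  rewrite ex; move: com; rewrite alpha_conj => /alpha_inj /eqP.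
  rewrite -subr_eq0 -{2}[x]mulr1 -mulrBr mulf_eq0 subr_eq0 => /orP [/eqP ->|]; first exact: alpha0.
  by rewrite (negPf (chi_ne1 _)) //; apply/eqP.
have all0 x : ideal_b x -> qp (st i (alpha x)) = 0.
  by move=> bx; apply: contrapT => nq; apply: none; exists x.
have [[r1 br1 n1]|none1] := pselect (exists2 x, ideal_b x & st i (alpha x) <> 1%g); last first.
  by apply: contrapT => nz; apply: none1; exists (r * (chi (v *+ M) - 1)).
have sig0 : qp (st i (tv (v *+ M))) = 0.
  apply: contrapT => /eqP nz; apply: bad; split=> //; [by exists r1 | by exists v].
have [x ex] := qp_eq0 (all0 _ br).
by rewrite stz ex alpha_conj sig0 chi0 mulr1 mulgV.
Qed.

Lemma good_data i : exists gC : (R -> R) * 'M[int]_s, good i ->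
  [/\ forall r, ideal_b r -> st i (alpha r) = alpha (gC.1 r),
      forall r x, ideal_b r -> ideal_b x -> gC.1 (r - x) = gC.1 r - gC.1 x,
      forall r v, ideal_b r -> gC.1 (r * chi (v *+ M)) = gC.1 r * chi (v *m gC.2)
    & gC.2 != 0].
Proof.
have [gd|ng] := pselect (good i); last by exists (id, 0) => /ng.
have /choice [g hg] : forall r, exists x, ideal_b r -> st i (alpha r) = alpha x.
  move=> r; have [br|nb] := pselect (ideal_b r); last by exists 0 => /nb.
  by case: gd => /(_ r br) /qp_eq0 [x ex] _ _; exists x.
have [|C hC] := @additive_rV_matrix s (fun v => qp (st i (tv (v *+ M)))).
  by move=> u v; rewrite mulrnDl tvD stM ?qpM //; apply: H_tv.
exists (g, C) => _; split=> /=.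
- exact: hg.
- move=> r x br bx; apply: alpha_inj.
  rewrite alphaD alphaN -!hg //; last exact: idealB.
  by rewrite alphaD alphaN stM ?stV //; apply: HV.
- move=> r v br; apply: alpha_inj; rewrite -hg; last exact: idealMr.
  by rewrite alphaJ stJ // ?hg // ?alpha_conj ?hC //; apply: H_tv.
case: gd => _ _ [v]; rewrite hC; apply: contraNneq => ->.
by rewrite mulmx0.
Qed.

Lemma good_nonzero i (g : R -> R) : good i -> (forall r, ideal_b r -> st i (alpha r) = alpha (g r)) ->
  exists2 r, ideal_b r & g r != 0.
Proof.
case=> _ [r br n1] _ hg; exists r => //; apply/eqP => g0; apply: n1.
by rewrite hg // g0 alpha0.
Qed.

Section Twist.
Variable g : R -> R.
Hypothesis gB : forall r x, ideal_b r -> ideal_b x -> g (r - x) = g r - g x.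

(** The related pairs form a subring of R x R, so semilinearity on the chi(Mv) spreads to polynomial
    expressions in them. *)
Definition twist (x y : R) := forall r, ideal_b r -> g (r * x) = g r * y.

Lemma twist1 : twist 1 1. Proof. by move=> r _; rewrite !mulr1. Qed.

Lemma twistB x y x' y' : twist x y -> twist x' y' -> twist (x - x') (y - y').
Proof.
move=> t t' r br; rewrite !mulrBr gB; try exact: idealMr.
by rewrite t ?t'.
Qed.

Lemma twistM x y x' y' : twist x y -> twist x' y' -> twist (x * x') (y * y').
Proof. by move=> t t' r br; rewrite !mulrA t' ?t //; apply: idealMr. Qed.

Variable C : 'M[int]_s.
Hypothesis gchi : forall r v, ideal_b r -> g (r * chi (v *+ M)) = g r * chi (v *m C).

Lemma twist_chi v : twist (chi (v *+ M)) (chi (v *m C)).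
Proof. by move=> r br; apply: gchi. Qed.

Lemma twist_lattice_sum l : twist (lattice_sum chi M%:R%:M l) (lattice_sum chi C l).
Proof.
rewrite /lattice_sum; elim: l => [|p l IH].
  by rewrite !big_nil; apply: related0 twist1 twistB.
rewrite !big_cons; apply: (relatedD twist1 twistB) => //.
apply: twistM; first exact: (related_int twist1 twistB).
by rewrite mul_mx_scalar scaler_nat; apply: twist_chi.
Qed.
End Twist.

Definition kill x := forall i r, ~ good i -> ideal_b r -> st i (alpha (r * x)) = 1%g.

Lemma kill0 : kill 0.
Proof. by move=> i r _ _; rewrite mulr0 alpha0 st1. Qed.

Lemma killB x y : kill x -> kill y -> kill (x - y).
Proof.
move=> kx ky i r bi br; rewrite mulrBr alphaD alphaN stM ?stV; try exact: idealMr.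
  by rewrite kx // ky // invg1 mulg1.
by apply: HV; apply: idealMr.
Qed.

Lemma killM x y : kill x -> kill (x * y).
Proof. by move=> kx i r bi br; rewrite [x * y]mulrC mulrA kx //; apply: idealMr. Qed.

(** Congruence to an integer modulo the ideal of elements killed by the bad states; by [bad_kills]
    each chi(Mv) is congruent to 1. *)
Definition near_int x (n : int) := kill (x - n%:~R).

Lemma near_int1 : near_int 1 1.
Proof. by rewrite /near_int subrr; apply: kill0. Qed.

Lemma near_intB x (n : int) y (k : int) : near_int x n -> near_int y k -> near_int (x - y) (n - k).
Proof.
move=> hx hy; rewrite /near_int rmorphB.
have -> : x - y - (n%:~R - k%:~R) = (x - n%:~R) - (y - k%:~R) by ring.
exact: killB.
Qed.

Lemma near_intM x (n : int) y (k : int) : near_int x n -> near_int y k -> near_int (x * y) (n * k).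
Proof.
move=> hx hy; rewrite /near_int rmorphM.
have -> : x * y - n%:~R * k%:~R = (x - n%:~R) * y - (y - k%:~R) * (- n%:~R) by ring.
by apply: killB; apply: killM.
Qed.

Section CommonRing.
Variables (gs : 'I_m -> R -> R) (Cs : 'I_m -> 'M[int]_s).
Hypothesis gs_st : forall i, good i -> forall r, ideal_b r -> st i (alpha r) = alpha (gs i r).
Hypothesis gsB : forall i, good i -> forall r x, ideal_b r -> ideal_b x ->
  gs i (r - x) = gs i r - gs i x.
Hypothesis gs_chi : forall i, good i -> forall r v, ideal_b r ->
  gs i (r * chi (v *+ M)) = gs i r * chi (v *m Cs i).
Hypothesis Cs_neq0 : forall i, good i -> Cs i != 0.

Definition fixed c := (forall i, good i -> twist (gs i) c c) /\ exists n : int, near_int c n.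

Lemma fixed_subring : subring fixed.
Proof.
split=> [|x y [tx [n hn]] [ty [k hk]]|x y [tx [n hn]] [ty [k hk]]].
- by split=> [i _|]; [apply: twist1 | exists 1; apply: near_int1].
- split=> [i gi|]; last by exists (n - k); apply: near_intB.
  by apply: twistB; [apply: gsB | apply: tx | apply: ty].
- split=> [i gi|]; last by exists (n * k); apply: near_intM.
  by apply: twistM; [apply: tx | apply: ty].
Qed.

(** The roots of [p] are the chi(Mw) for w in [O]. A good state turns them into the chi(w C_i),
    which are the same up to order, and modulo [kill] all of them are 1. One w satisfies Mw = kv. *)
Lemma fixed_annihilates v : exists k (p : {poly R}), [/\ (0 < k)%N, p \is monic,
  coefs_in fixed p & p.[chi (v *+ k)] = 0].
Proof.
pose CC := [seq Cs i | i <- enum 'I_m & `[< good i >]].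
have CCP C : C \in CC -> exists2 i, good i & C = Cs i.
  by case/mapP => i; rewrite mem_filter => /andP [/asboolP gi _] ->; exists i.
have [|C|k [O [k0 uO [w wO ew] pO]]] :=
    @lattice_orbits s R chi M CC s_gt1 R0 chiD chi0 chi_span krull chi_nalg M_gt0 _ _ v.
- by move=> C /CCP [i gi ->]; apply: Cs_neq0.
(* A relation between the chi(Mv) makes the matching sum of the chi(v C_i) annihilate a non-zero
   value of f_i, and R is a domain. *)
- case/CCP => i gi -> l l0; have [r br gr0] := good_nonzero gi (gs_st gi).
  have := twist_lattice_sum (gsB gi) (gs_chi gi) l br.
  rewrite l0 mulr0 => e; have : gs i r * lattice_sum chi (Cs i) l = 0.
    by rewrite -e -(subrr 0) gsB ?subrr //; apply: ideal0.
  by move/eqP; rewrite mulf_eq0 (negPf gr0) => /eqP.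
exists k, (\prod_(w <- O) ('X - (chi (w *+ M))%:P)); split=> //.
- exact: monic_prod_XsubC.
- move=> l; split=> [i gi|].
    have e : \prod_(w <- O) ('X - (chi (w *m Cs i))%:P) =
             \prod_(w <- O) ('X - (chi (w *+ M))%:P).
      rewrite -(big_map (fun w => w *m Cs i) xpredT (fun u => 'X - (chi u)%:P)).
      rewrite -(big_map (fun w : V => w *+ M) xpredT (fun u => 'X - (chi u)%:P)).
      by apply: perm_big; apply: pO; apply: map_f; rewrite mem_filter asboolT ?mem_enum.
    rewrite -{2}e; apply: (prod_coefs_related (@twist1 (gs i)) (twistB (gsB gi)) (@twistM (gs i))).
    by move=> u _; apply: twist_chi; apply: gs_chi.
  exists (\prod_(w <- O) ('X - (1 : int)%:P))`_l.
  have := @prod_coefs_related R int near_int near_int1 near_intB near_intM _ O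
    (fun w => chi (w *+ M)) (fun=> 1).
  by apply=> u _ i r bi br; apply: bad_kills.
- by rewrite (bigD1_seq w) //= hornerM hornerXsubC -ew subrr mul0r.
Qed.

Section Residue.
Variables (p : nat) (S : idomainType) (rho : {rmorphism R -> S}).
Hypothesis p_prime : prime p.
Hypothesis rho_quotient : quotient_map (fun x : R => exists y : R, x = y *+ p) rho.
Hypothesis S_infinite : infinite_type S.

Lemma residue_char : p%:R = 0 :> S.
Proof. by rewrite -(rmorph_nat rho); apply/rho_quotient.2; exists 1. Qed.

(* Otherwise every chi v would be a root of unity modulo p, and R / p R, spanned
   by these, would be finite. *)
Lemma fixed_residues_infinite (l : seq S) : (forall x, fixed x -> rho x \in l) -> False.
Proof.
move=> fin; pose B (z : S) := exists2 x, fixed x & z = rho x.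
have hB : subring B.
  have [f1 fB fM] := fixed_subring.
  split=> [|_ _ [x fx ->] [y fy ->]|_ _ [x fx ->] [y fy ->]].
  - by exists 1; rewrite ?rmorph1.
  - by exists (x - y); rewrite ?rmorphB //; apply: fB.
  - by exists (x * y); rewrite ?rmorphM //; apply: fM.
have chiMn v n : chi (v *+ n) = chi v ^+ n.
  by elim: n => [|n IH]; rewrite ?mulr0n // mulrS chiD IH exprS.
have [] := @finite_residue s S (rho \o chi) p (prime_gt0 p_prime) residue_char.
- by move=> u v; rewrite /= chiD rmorphM.
- by rewrite /= chi0 rmorph1.
- move=> D D0 DB Dchi y; have [x ->] := rho_quotient.1 y.
  move: x; apply: chi_span => [|x z Dx Dz|v]; last exact: Dchi.
    by rewrite rmorph0.
  by rewrite rmorphB; apply: DB.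
- move=> v; have [k [f [k0 mf cf f0]]] := fixed_annihilates v.
  have [|||||n n0 e] := @finite_image_powers S B l (rho (chi (v *+ k))) (map_poly rho f) hB.
  + by move=> _ [x fx ->]; apply: fin.
  + exact: monic_map.
  + by move=> j; rewrite coef_map; exists f`_j => //; apply: cf.
  + by rewrite horner_map f0 rmorph0.
  + apply/eqP => z0; have : rho (chi (v *+ k) * chi (- (v *+ k))) = 0 by rewrite rmorphM z0 mul0r.
    by rewrite -chiD subrr chi0 rmorph1 => /eqP; rewrite oner_eq0.
  + exists (k * n)%N; first by rewrite muln_gt0 k0.
    by rewrite exprM -rmorphXn -chiMn.
move=> ll all; apply: S_infinite; apply/cardinality.finite_seqP; exists ll.
by apply/classical_sets.seteqP; split=> // x _ /=; apply: all.
Qed.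

Definition core_multiplier c := [/\ forall i, good i -> twist (gs i) c c, ideal_b c
  & forall i r, ~ good i -> st i (alpha (c * r)) = 1%g].

(** Labels are finite in number, so two fixed elements with distinct residues share one. Their
    difference [d] lies in b and is near an integer that vanishes in S. Multiplying [d] by d minus
    this integer gives an element killed by the bad states and equal to d^2 in S. *)
Lemma exists_core_multiplier : exists2 c, core_multiplier c & rho c != 0.
Proof.
have /choice [k hk] : forall x, exists k : 'I_p,
    fixed x -> exists2 n : int, near_int x n & n%:~R = (k : nat)%:R :> S.
  move=> x; have [[_ [n hn]]|nf] := pselect (fixed x); last first.
    by exists (Ordinal (prime_gt0 p_prime)) => /nf.
  have [j e] := int_residue n (prime_gt0 p_prime) residue_char.
  by exists j => _; exists n.
pose label x := (lab (alpha x), k x).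
have [x [y [fx fy exy nz]]] : exists x y, [/\ fixed x, fixed y, label x = label y & rho (x - y) != 0].
  apply: contrapT => none.
  have /choice [f hf] : forall t, exists x, forall y, fixed y -> label y = t -> rho y = rho x.
    move=> t; have [[x fx ex]|no] := pselect (exists2 x, fixed x & label x = t); last first.
      by exists 0 => y fy ey; case: no; exists y.
    exists x => y fy ey; apply/eqP; rewrite -subr_eq0 -rmorphB; apply: contrapT => /negP h.
    by apply: none; exists y, x; rewrite ey ex.
  apply: (@fixed_residues_infinite [seq rho (f t) | t : L * 'I_p]) => x fx.
  by rewrite (hf _ _ fx erefl); apply: image_f.
have [f1 fB fM] := fixed_subring.
case: exy => exy ek; pose d := x - y.
have bd : ideal_b d by rewrite /ideal_b alphaD alphaN; apply: H_lab.
have fd : fixed d by apply: fB.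
have [n hn en] := hk _ fx; have [n' hn' en'] := hk _ fy.
have hd : near_int d (n - n') by apply: near_intB.
have rn : rho (d - (n - n')%:~R) = rho d.
  have e0 : (n - n')%:~R = 0 :> S by rewrite mulrzBr en en' ek subrr.
  by rewrite rmorphB rmorph_int e0 subr0.
exists (d * (d - (n - n')%:~R)); last by rewrite rmorphM rn mulf_neq0.
split=> [i gi||i r bi].
- apply: twistM; first exact: fd.1.
  apply: twistB; [exact: gsB | exact: fd.1 |].
  exact: (related_int (@twist1 _) (twistB (gsB gi))).
- exact: idealMr.
- have -> : d * (d - (n - n')%:~R) * r = (d * r) * (d - (n - n')%:~R) by ring.
  by apply: hd => //; apply: idealMr.
Qed.
End Residue.

Lemma core_multiplierD c d : core_multiplier c -> core_multiplier d -> core_multiplier (c + d).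
Proof.
move=> [tc bc kc] [td bd kd]; split=> [i gi||i r bi].
- by apply: (relatedD (@twist1 _) (twistB (gsB gi))); [apply: tc | apply: td].
- exact: idealD.
- by rewrite mulrDl alphaD stM ?kc ?kd ?mulg1 //; apply: idealMr.
Qed.

Lemma core_multiplierMn c n : core_multiplier c -> core_multiplier (c *+ n).
Proof.
move=> hc; elim: n => [|n IH]; last by rewrite mulrS; apply: core_multiplierD.
rewrite mulr0n; split=> [i gi||i r bi].
- exact: (related0 (@twist1 _) (twistB (gsB gi))).
- exact: ideal0.
- by rewrite mul0r alpha0 st1.
Qed.

Lemma residue_nat (p : nat) (S : idomainType) (rho : {rmorphism R -> S}) n : prime p ->
  quotient_map (fun x : R => exists y : R, x = y *+ p) rho -> (n%:R == 0 :> S) = (p %| n)%N.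
Proof.
move=> pp hq; rewrite (@dvdn_pcharf S p) // inE pp.
by rewrite (residue_char hq) eqxx.
Qed.

(** As in the Chinese remainder theorem: the first summand vanishes modulo the new prime and the
    second modulo each old one, while the remaining summand survives because the residue rings are
    domains. *)
Lemma core_multiplier_primes (ps : seq nat) : uniq ps -> all prime ps ->
  exists2 c, core_multiplier c & forall p, p \in ps -> ~ exists y, c = y *+ p.
Proof.
elim: ps => [_ _|p ps IH /= /andP [pps ups] /andP [pp aps]].
  (* The empty list imposes no condition; the prime 2 merely supplies some multiplier. *)
  have [S [rho [hq hS]]] := residues (isT : prime 2).
  by have [c hc _] := exists_core_multiplier (isT : prime 2) hq hS; exists c.
have [c hc cps] := IH ups aps.
have [S [rho [hq hS]]] := residues pp.
have [d hd rd] := exists_core_multiplier pp hq hS.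
have allP q : q \in ps -> prime q by move/(allP aps).
exists (c *+ p + d *+ (\prod_(q <- ps) q)%N).
  by apply: core_multiplierD; apply: core_multiplierMn.
move=> q; rewrite inE => /orP [/eqP ->|qps] h.
  have : rho (c *+ p + d *+ (\prod_(q <- ps) q)%N) = 0 by apply/hq.2.
  rewrite rmorphD !rmorphMn /= -[rho c *+ p]mulr_natr -[rho d *+ _]mulr_natr (residue_char hq) mulr0 add0r.
  move/eqP; rewrite mulf_eq0 (negPf rd) (residue_nat _ pp hq) Euclid_dvd_prod //.
  rewrite big_has => /hasP [q' q'ps]; rewrite dvdn_prime2 ?(allP _ q'ps) // => /eqP e.
  by rewrite e q'ps in pps.
have qq := allP _ qps.
have [S' [rho' [hq' _]]] := residues qq.
have : rho' (c *+ p + d *+ (\prod_(q <- ps) q)%N) = 0 by apply/hq'.2.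
rewrite rmorphD !rmorphMn /= -[rho' c *+ p]mulr_natr -[rho' d *+ _]mulr_natr (big_rem q) //= natrM.
rewrite (residue_char hq') mul0r mulr0 addr0 => /eqP.
rewrite mulf_eq0 (residue_nat _ qq hq') => /orP [/eqP c0|].
  by apply: (cps q qps); apply/hq'.2.
by rewrite dvdn_prime2 // => /eqP e; rewrite -e qps in pps.
Qed.

(** A prime divisor p of N divides c y but not c, hence divides y since R / pR is a domain; p is
    then cancelled, R being torsion-free. *)
Lemma divide_out_nat c N : (0 < N)%N ->
  (forall p, prime p -> (p %| N)%N -> ~ exists y, c = y *+ p) ->
  forall x y, c * y = x *+ N -> exists z, x = c * z.
Proof.
elim/ltn_ind: N => N IH N0 hc x y e.
have [N1|N1] := leqP N 1.
  have {}N1 : N = 1%N by apply/eqP; rewrite eqn_leq N1.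
  by exists y; rewrite e N1.
pose p := pdiv N; have pp : prime p by apply: pdiv_prime.
have pN : (p %| N)%N by apply: pdiv_dvd.
have [S [rho [hq _]]] := residues pp.
have Np0 : (0 < N %/ p)%N by rewrite divn_gt0 ?prime_gt0 // dvdn_leq.
have eN : (N %/ p * p)%N = N by rewrite divnK.
have : rho (c * y) = 0 by apply/hq.2; exists (x *+ (N %/ p)%N); rewrite e -mulrnA eN.
rewrite rmorphM => /eqP; rewrite mulf_eq0 => /orP [/eqP /hq.2|/eqP /hq.2 [y' ey]].
  by move=> h; case: (hc p pp pN).
apply: (IH (N %/ p)%N _ Np0 _ x y').
- by rewrite ltn_Pdiv // prime_gt1.
- by move=> q qq qN; apply: hc => //; rewrite -eN dvdn_mulr.
apply/eqP; rewrite -subr_eq0; apply/eqP.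
have [||//] := R0 (n := p) (x := c * y' - x *+ (N %/ p)%N).
  by rewrite mulrnBl -mulrnA eN -e ey mulrnAr subrr.
by move=> p0; rewrite p0 in pp.
Qed.

Theorem core_absurd : False.
Proof.
(* The factor 2 leaves a prime in the list even if M = 1, which forces c != 0. *)
have M2 : (0 < 2 * M)%N by rewrite muln_gt0.
have [|c [tc bc kc] hc] := @core_multiplier_primes (primes (2 * M)) (primes_uniq _).
  by apply/allP => p; rewrite mem_primes => /andP [].
have c0 : c <> 0.
  move=> e; apply: (hc 2%N); first by rewrite mem_primes M2 dvdn_mulr.
  by exists 0; rewrite e mul0rn.
apply/c0/alpha_eq1.
apply: (trivial_core (J := fun h => exists r, h = alpha (c * r))); last by exists 1; rewrite mulr1.
  by move=> _ [r ->]; apply: idealMr.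
move=> i _ [r ->]; have bcr : ideal_b (c * r) by apply: idealMr.
have [gi|bi] := pselect (good i); last first.
  by exists 0; rewrite mulr0 alpha0 kc.
rewrite (gs_st gi bcr).
(* The factor M is introduced because [r] need not lie in b, whereas Mr does, so that f_i(Mr) is
   meaningful. *)
have [||z ->] := @divide_out_nat c M M_gt0 _ (gs i (c * r)) (gs i (r *+ M)); last by exists z.
  move=> p pp pM; apply: hc; rewrite mem_primes pp M2 /=; exact: dvdn_mull.
have tM := related_int (@twist1 (gs i)) (twistB (gsB gi)) M.
rewrite mulrC -(tc i gi); last exact: idealM_nat.
have -> : r *+ M * c = (c * r) * M%:~R by rewrite -[r *+ M]mulr_natr -[M%:~R]/(M%:R); ring.
by rewrite tM // -[M%:~R]/(M%:R) mulr_natr.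
Qed.
End CommonRing.

Theorem no_self_similar_data : False.
Proof.
have /choice [gC h] := good_data.
apply: (@core_absurd (fun i => (gC i).1) (fun i => (gC i).2)) => i gi; by case: (h i gi).
Qed.
End Core.

Theorem mainTheorem1 (s : nat) (G : groupType) (A Q : groupClosed G)
    (R : idomainType) (pi : {rmorphism groupRing (subgroup_of Q) -> R}) :
  (2 <= s)%N ->
  semidirect_product A Q ->
  abelian_subgroup A ->
  abelian_subgroup Q ->
  isomorphic_Zn s (subgroup_of Q) ->
  cyclic_module A Q ->
  quotient_map (annihilator A (Q := Q)) pi ->
  Z_torsion_free R ->
  Krull_dimension R 2 ->
  (forall p : nat, prime p ->
     exists (S : idomainType) (rho : {rmorphism R -> S}),
       quotient_map (fun x : R => exists y : R, x = y *+ p) rho /\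
       infinite_type S) ->
  (forall q : subgroup_of Q, q != 1%g ->
     ~ algebraicOver (ratr : rat -> {fraction R})
         (tofrac (pi (groupRing_of q)))) ->
  finitely_presented G ->
  ~ self_similar G.
Proof.
move=> s2 sd abA _ [f [fD [finv fK Kf]]] cyc qm R0 [_ krull] res nalg _ [m [act [fa states]]].
have [alpha [aA aD a1 aonto aJ]] := module_ring_iso sd abA cyc qm.
have [nA trivAQ decomp] := sd.
have f0 : f 0 = 1%g by apply: (mulgI (f 0)); rewrite mulg1 -fD addr0.
pose chi v := pi (groupRing_of (f v)).
pose tv v := val (f v).
have tvD u v : tv (u + v) = (tv u * tv v)%g by rewrite /tv fD.
(* The projection is chosen from the decompositions g = a tv(v); as A meets Q trivially, v is unique
   and [qp] is additive. *)
have /choice [qp hqp] : forall g, exists v, exists2 a, a \in A & g = (a * tv v)%g.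
  move=> g; have [a [q [aAa qQ ->]]] := decomp g.
  exists (finv (Sub q qQ)); exists a => //.
  by rewrite /tv Kf SubK.
have decomp_uniq a b v w : a \in A -> b \in A -> (a * tv v = b * tv w)%g -> v = w.
  move=> aAa bA e.
  have e1 : (b^-1 * a)%g = (tv w * (tv v)^-1)%g.
    by apply: (mulIg (tv v)); rewrite mulgVK -mulgA e mulKg.
  have : (b^-1 * a)%g = 1%g.
    apply: trivAQ; first by rewrite gpredM ?gpredVr.
    by rewrite e1 gpredM ?gpredVr //; apply: valP.
  rewrite e1 => /(congr1 (fun x => x * tv v)%g); rewrite mulgVK mul1g.
  by move=> /val_inj /(can_inj fK).
have qp_eq a v : a \in A -> qp (a * tv v)%g = v.
  move=> aAa; have [b bA e] := hqp (a * tv v)%g.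
  by apply/esym; apply: decomp_uniq e.
have tv0 : tv 0 = 1%g by rewrite /tv f0.
have [M M0 powM] := level_power fa.
have [st [st_act stM]] := level_states fa states.
apply: (@no_self_similar_data s m R chi G alpha tv qp (level_stabilizer act) _
  (level_label act) M st) => //.
- by move=> u v; rewrite /chi fD -rmorphM; congr (pi _); apply: esym (groupRing_mulUU 1 1 _ _).
- by rewrite /chi f0 rmorph1.
(* R is the image of ZQ, whose elements are integral combinations of elements of Q; a multiple c q
   is reached by adding or subtracting q repeatedly. *)
- move=> S S0 SB Schi r; have [x ->] := qm.1 r.
  have SN y : S y -> S (- y) by rewrite -sub0r; apply: SB.
  have SD y z : S y -> S z -> S (y + z) by move=> Sy Sz; rewrite -[z]opprK; apply/SB/SN.
  rewrite (monalgE (x : {malg int[subgroup_of Q]})) raddf_sum.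
  apply: (big_ind S) => // q _.
  have Sq c : S (pi << c *g q >>) -> S (pi << c + 1 *g q >>).
    by rewrite monalgUD raddfD /= => h; apply: SD => //; rewrite -(Kf q); apply: Schi.
  have Sn n : S (pi << n%:Z *g q >>).
    by elim: n => [|n IH]; rewrite ?monalgU0 ?raddf0 // -addn1 PoszD; apply: Sq.
  case: (mcoeff _ _) => n; first exact: Sn.
  by rewrite NegzE monalgUN raddfN; exact: (SN _ (Sn n.+1)).
- move=> v v0; apply: nalg; apply: contra_neq v0 => e.
  by apply: (can_inj fK); rewrite e f0.
- by move=> r v; rewrite aJ.
- move=> g h; have [a aAa ->] := hqp g; have [b bA ->] := hqp h.
  rewrite !qp_eq //.
  have -> : (a * tv (qp g) * (b * tv (qp h)) = (a * (b ^ (tv (qp g))^-1)) * tv (qp g + qp h))%g.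
    by rewrite tvD conjgE invgK !mulgA mulgVK.
  by rewrite qp_eq // gpredM // nA.
- by move=> r; rewrite -[alpha r]mulg1 -tv0 qp_eq.
- by move=> v; rewrite -[tv v]mul1g qp_eq // gpred1.
- move=> g g0; have [a aAa e] := hqp g; have [r er] := aonto _ aAa.
  by exists r; rewrite e g0 tv0 mulg1.
- exact: level_stabilizerM.
- exact: level_stabilizerV.
- exact: level_stabilizerJ.
- exact: level_label_stabilizer.
- by move=> J JH Jst g Jg; apply: (invariant_trivial fa st_act JH Jst).
Qed.
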